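(* Let $T$ be an $L^2$ bounded Calderón-Zygmund operator on $\mathbb{R}^n$. Then there is a constant $c(n,T)$, depending only on $n$ and $T$, such that for every weight $w\in A_2$, $$\|T\|_{L^2(w)}\le c(n,T)\,\|w\|_{A_2}.$$
   Context: A Calderón-Zygmund operator on $\mathbb{R}^n$ is a linear operator $T$, bounded on $L^2(\mathbb{R}^n)$, represented as $Tf(x)=\int_{\mathbb{R}^n}K(x,y)f(y)\,dy$ for $x\notin \mathrm{supp}\, f$, whose kernel $K$ satisfies, for some constant $c$: (i) $|K(x,y)|\le \frac{c}{|x-y|^n}$ for all $x\ne y$; (ii) there exists $0<\delta\le 1$ such that $|K(x,y)-K(x',y)|+|K(y,x)-K(y,x')|\le c\frac{|x-x'|^{\delta}}{|x-y|^{n+\delta}}$ whenever $|x-x'|<|x-y|/2$. A weight is an a.e. positive locally integrable function $w$ on $\mathbb{R}^n$. For a cube $Q$ (sides parallel to the axes), $w(Q)=\int_Q w$ and $w^{-1}(Q)=\int_Q w^{-1}$. One says $w\in A_2$ if $$\|w\|_{A_2}=\sup_{Q\subset\mathbb{R}^n}\frac{w(Q)\,w^{-1}(Q)}{|Q|^2}<\infty,$$ the supremum being over all cubes $Q$. $L^2(w)$ is the space with norm $\|f\|_{L^2(w)}=(\int |f|^2w\,dx)^{1/2}$, and $\|T\|_{L^2(w)}$ is the operator norm of $T$ on $L^2(w)$, i.e. the smallest $C\in[0,\infty]$ such that $\|Tf\|_{L^2(w)}\le C\|f\|_{L^2(w)}$ for all bounded compactly supported $f$ (a dense class in $L^2(w)$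 on which $T$ is initially defined). *)

(* Defs.v *)
From HB Require Import structures.
From mathcomp Require Import all_boot all_order all_algebra.
From mathcomp Require Import complex.
From mathcomp Require Import all_classical all_reals all_analysis.

Set Implicit Arguments.
Unset Strict Implicit.
Unset Printing Implicit Defensive.
Import Order.TTheory GRing.Theory Num.Theory.
Import numFieldNormedType.Exports.

Local Open Scope classical_set_scope.
Local Open Scope ring_scope.

(* R^n is modelled by n.-tuple R, which carries the product Borel sigma-algebra
   in the library; its topology is transported from 'rV[R]_n. *)
#[warnings="-redundant-canonical-projection"]
HB.instance Definition _ (R : realType) (n : nat) :=
  Topological.copy (n.-tuple R)
    (initial_topology (fun x : n.-tuple R => \row_(i < n) tnth x i)).

(* Lebesgue measure on R^n, as an n-fold product of the one-dimensional one:
   |A| = \int_R |{t in R^m | (x, t) \in A}| dx for A included in R^(m+1). *)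
Fixpoint lebesgue_tuple (R : realType) (n : nat) : set (n.-tuple R) -> \bar R :=
  match n with
  | 0 => fun A => (\d_ [tuple] A)%E
  | m.+1 => fun A => (\int[lebesgue_measure]_x
      lebesgue_tuple [set t : m.-tuple R | A [tuple of x :: t]])%E
  end.
Arguments lebesgue_tuple {R n} A.

Definition sigma_finite_copy d (T : measurableType d) (R : realType)
  (q : {measure set T -> \bar R}) & sigma_finite setT q : set T -> \bar R := q.

Section sigma_finite_copy.
Context d (T : measurableType d) (R : realType) (q : {measure set T -> \bar R}).
Variable q_fin : sigma_finite setT q.

Let sigma_finite_copyT : sigma_finite setT (sigma_finite_copy q_fin).
Proof. exact: q_fin. Qed.

HB.instance Definition _ := Measure.copy (sigma_finite_copy q_fin) q.
HB.instance Definition _ := Measure_isSigmaFinite.Build _ _ _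
  (sigma_finite_copy q_fin) sigma_finite_copyT.

End sigma_finite_copy.

Section lebesgue_tuple_measure.
Context {R : realType}.
Local Open Scope ereal_scope.

Lemma sigma_finite_prod d1 d2 (T1 : measurableType d1) (T2 : measurableType d2)
    (m1 : {sigma_finite_measure set T1 -> \bar R})
    (m2 : {sigma_finite_measure set T2 -> \bar R}) :
  sigma_finite setT (m1 \x m2).
Proof.
have /sigma_finiteP[F [TF ndF Foo]] := sigma_finiteT m1.
have /sigma_finiteP[G [TG ndG Goo]] := sigma_finiteT m2.
exists (fun n => F n `*` G n).
  rewrite -setXTT TF TG predeqE => -[x y]; split.
    move=> [/= [n _ Fnx] [k _ Gky]]; exists (maxn n k) => //; split.
    - by move: x Fnx; exact/subsetPset/ndF/leq_maxl.
    - by move: y Gky; exact/subsetPset/ndG/leq_maxr.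
  by move=> [n _ []/= ? ?]; split; exists n.
move=> k; have [? ?] := Foo k; have [? ?] := Goo k.
split; first exact: measurableX.
by rewrite product_measure1E// lte_mul_pinfty// ge0_fin_numE.
Qed.

Lemma lebesgue_tupleS (n : nat) (m : {sigma_finite_measure set (n.-tuple R) -> \bar R}) :
  @lebesgue_tuple R n = m :> (set (n.-tuple R) -> \bar R) ->
  @lebesgue_tuple R n.+1 = pushforward (lebesgue_measure \x m)
    (fun p : measurableTypeR R * n.-tuple R => [tuple of p.1 :: p.2]).
Proof.
move=> mE; apply/funext => A /=; rewrite /pushforward /product_measure1 mE.
apply: eq_integral => x _ /=; congr (m _).
by apply/seteqP; split => t /=; rewrite /xsection /= inE.
Qed.

Lemma lebesgue_tuple_exists (n : nat) :
  exists m : {sigma_finite_measure set (n.-tuple R) -> \bar R},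
    @lebesgue_tuple R n = m :> (set (n.-tuple R) -> \bar R).
Proof.
elim: n => [|n [m mE]]; first by exists (dirac [tuple]).
pose h (p : measurableTypeR R * n.-tuple R) : n.+1.-tuple R :=
  [tuple of p.1 :: p.2].
have mh : measurable_fun [set: measurableTypeR R * n.-tuple R] h.
  by apply: measurable_cons; [exact: measurable_fst|exact: measurable_snd].
pose lm : {sigma_finite_measure set (measurableTypeR R) -> \bar R} :=
  @lebesgue_measure R.
pose l : {measure set (measurableTypeR R * n.-tuple R)%type -> \bar R} :=
  lm \x m.
have lE : @lebesgue_tuple R n.+1 = pushforward l h by exact: lebesgue_tupleS.
pose q : {measure set (n.+1.-tuple R) -> \bar R} :=
  measure_function_pushforward__canonical__measure_function_Measure l mh.
have l_fin : sigma_finite [set: n.+1.-tuple R] q.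
  have [F TF mF] : sigma_finite setT l by exact: (sigma_finite_prod lm m).
  pose g (t : n.+1.-tuple R) := (thead t, [tuple of behead t]).
  have hK p : g (h p) = p.
    by case: p => x t; rewrite /g /h /= theadE; congr pair; apply: val_inj.
  exists (fun k => g @^-1` F k).
    by rewrite -preimage_bigcup -TF preimage_setT.
  move=> k; have [mFk Fk] := mF k; split.
    rewrite -[X in measurable X]setTI.
    suff mg : measurable_fun [set: n.+1.-tuple R]
      (g : _ -> measurableTypeR R * n.-tuple R) by exact: mg.
    apply: measurable_fun_pair; last exact: measurable_behead.
    exact: measurable_tnth.
  rewrite /= /pushforward (_ : h @^-1` _ = F k)//.
  by apply/seteqP; split => p /=; rewrite hK.
by exists (sigma_finite_copy l_fin); rewrite lE.
Qed.

Let lebesgue_tuple0 n : @lebesgue_tuple R n set0 = 0.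
Proof. by have [m ->] := lebesgue_tuple_exists n; exact: measure0. Qed.

Let lebesgue_tuple_ge0 n (A : set (n.-tuple R)) : 0 <= lebesgue_tuple A.
Proof. by have [m ->] := lebesgue_tuple_exists n; exact: measure_ge0. Qed.

Let lebesgue_tuple_sigma_additive n :
  semi_sigma_additive (@lebesgue_tuple R n).
Proof.
by have [m ->] := lebesgue_tuple_exists n; exact: measure_semi_sigma_additive.
Qed.

HB.instance Definition _ n := isMeasure.Build _ _ _ (@lebesgue_tuple R n)
  (lebesgue_tuple0 n) (@lebesgue_tuple_ge0 n) (@lebesgue_tuple_sigma_additive n).

Let lebesgue_tuple_sigma_finite n : sigma_finite setT (@lebesgue_tuple R n).
Proof. by have [m ->] := lebesgue_tuple_exists n; exact: sigma_finiteT. Qed.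

HB.instance Definition _ n := Measure_isSigmaFinite.Build _ _ _
  (@lebesgue_tuple R n) (@lebesgue_tuple_sigma_finite n).

Lemma lebesgue_tuple_box n (a b : n.-tuple R) :
  (forall i, (tnth a i <= tnth b i)%R) ->
  lebesgue_tuple [set x : n.-tuple R |
    forall i, (tnth a i <= tnth x i <= tnth b i)%R] =
  (\prod_(i < n) (tnth b i - tnth a i)%R)%:E.
Proof.
elim: n a b => [|n IHn] a b ab.
  by rewrite big_ord0 /= diracE mem_set// => -[].
rewrite big_ord_recl /=.
pose a' : n.-tuple R := [tuple of behead a].
pose b' : n.-tuple R := [tuple of behead b].
have aS i : tnth a (lift ord0 i) = tnth a' i.
  by rewrite [in LHS](tuple_eta a) tnthS.
have bS i : tnth b (lift ord0 i) = tnth b' i.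
  by rewrite [in LHS](tuple_eta b) tnthS.
pose B := [set t | forall i, (tnth a' i <= tnth t i <= tnth b' i)%R].
pose I := `[tnth a ord0, tnth b ord0]%classic.
have box x : lebesgue_tuple [set t : n.-tuple R | forall i,
    (tnth a i <= tnth [tuple of x :: t] i <= tnth b i)%R] =
    lebesgue_tuple B * (\1_I x)%:E.
  rewrite indicE; have [xI|xI] := boolP (x \in I).
    rewrite mule1; congr lebesgue_tuple; apply/seteqP; split => t /= H i.
      by have := H (lift ord0 i); rewrite tnthS aS bS.
    case: (unliftP ord0 i) => [j ->|->]; first by rewrite tnthS aS bS; exact: H.
    by move: xI; rewrite inE /I /= in_itv.
  rewrite mule0 (_ : [set t | _] = set0) ?measure0//.
  apply/seteqP; split => t //= /(_ ord0) H; case/negP: xI.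
  by rewrite inE /I /= in_itv.
under eq_integral do rewrite box.
rewrite IHn => [|i]; last by rewrite -aS -bS.
rewrite integralZl//=; last first.
  exact: integrable_indic_itv.
rewrite integral_indic//=; last exact: measurable_itv.
rewrite (_ : I `&` _ = I); last exact: (@setIT R I).
rewrite lebesgue_measure_itv /= lte_fin.
rewrite EFinM muleC; congr (_ * _).
  have := ab ord0; rewrite le_eqVlt => /predU1P[->|->]; last by rewrite EFinB.
  by rewrite ltxx subrr.
by congr EFin; apply: eq_bigr => i _; rewrite aS bS.
Qed.
End lebesgue_tuple_measure.

Section calderon_zygmund.
Context {R : realType} {n : nat}.

Local Notation Rn := (n.-tuple R).
Local Notation mu := (@lebesgue_tuple R n).
Local Notation Cabs := (@ComplexField.Normc.normc R).
Implicit Types (f : Rn -> R[i]) (T : (Rn -> R[i]) -> Rn -> R[i])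
  (K : Rn -> Rn -> R[i]) (w : Rn -> R).

Definition euclid_dist (x y : Rn) : R :=
  Num.sqrt (\sum_(i < n) (tnth x i - tnth y i) ^+ 2).

Definition cmeasurable f :=
  measurable_fun setT (fun x => complex.Re (f x)) /\
  measurable_fun setT (fun x => complex.Im (f x)).

Definition cintegrable f :=
  mu.-integrable setT (fun x => (complex.Re (f x))%:E) /\
  mu.-integrable setT (fun x => (complex.Im (f x))%:E).

Definition cintegral f : R[i] :=
  Complex (\int[mu]_x complex.Re (f x)) (\int[mu]_x complex.Im (f x)).

Definition L2norm f : \bar R := Lnorm mu 2%:E (fun x => (Cabs (f x))%:E).

Definition inL2 f := cmeasurable f /\ (L2norm f < +oo)%E.

(* The support of a function defined up to a.e. equality: the complement of the
   largest open set on which it vanishes a.e. *)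
Definition ess_support f : set Rn :=
  ~` [set x | exists2 U, nbhs x U & {ae mu, forall y, U y -> f y = 0}].

(* Operators on L^2 act on representatives, so identities between their values
   are required a.e.; L2_bounded and L2_linear together imply that T respects
   a.e. equality. T is unconstrained outside L^2. *)
Definition L2_linear T := forall (a : R[i]) f g, inL2 f -> inL2 g ->
  {ae mu, forall x, T (fun y => a * f y + g y) x = a * T f x + T g x}.

Definition L2_bounded T := exists C : R, forall f, inL2 f ->
  inL2 (T f) /\ (L2norm (T f) <= C%:E * L2norm f)%E.

Definition kernel_size K (c : R) := forall x y, x != y ->
  Cabs (K x y) <= c / euclid_dist x y ^+ n.

Definition kernel_regularity K (c delta : R) := forall x x' y,
  euclid_dist x x' < euclid_dist x y / 2 ->
  Cabs (K x y - K x' y) + Cabs (K y x - K y x') <=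
    c * (euclid_dist x x' `^ delta / euclid_dist x y `^ (n%:R + delta)).

Definition represented_by T K := forall f, inL2 f ->
  {ae mu, forall x, ~ ess_support f x ->
    cintegrable (fun y => K x y * f y) /\
    T f x = cintegral (fun y => K x y * f y)}.

Definition calderon_zygmund T :=
  [/\ L2_linear T, L2_bounded T &
    exists K (c : R), [/\ represented_by T K, kernel_size K c &
      exists delta, 0 < delta <= 1 /\ kernel_regularity K c delta]].

Definition is_weight w :=
  [/\ measurable_fun setT w,
      (forall A : set Rn, compact A -> (\int[mu]_(x in A) `|w x|%:E < +oo)%E) &
      {ae mu, forall x, 0 < w x}].

Definition cube (a : Rn) (l : R) : set Rn :=
  [set x | forall i, tnth a i <= tnth x i <= tnth a i + l].

Definition A2_const w : \bar R :=
  ereal_sup [set r | exists (a : Rn) (l : R), 0 < l /\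
    r = ((\int[mu]_(x in cube a l) (w x)%:E) *
         (\int[mu]_(x in cube a l) (w x)^-1%:E) / mu (cube a l) ^+ 2)%E].

Definition A2_weight w := is_weight w /\ (A2_const w < +oo)%E.

Definition wL2norm w f : \bar R :=
  ((\int[mu]_x (Cabs (f x) ^+ 2 * w x)%:E) `^ 2^-1)%E.

Definition bounded_compactly_supported f :=
  [/\ cmeasurable f, (exists M : R, forall x, Cabs (f x) <= M) &
      compact (ess_support f)].

Definition wL2_opnorm T w : \bar R :=
  ereal_inf [set C : \bar R | (0 <= C)%E /\
    forall f, bounded_compactly_supported f ->
      (wL2norm w (T f) <= C * wL2norm w f)%E].

End calderon_zygmund.

(* Main.v *)
(* The proof goes through sparse domination. The Calderon-Zygmund decomposition
   gives the weak (1,1) bound for T, and with the maximal function it controls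
   the oscillation over a cube p of T(f 1_q') - T(f 1_p'), outside of a small
   part of p, by the mean of |f| over the dilate q' of a cube q containing p.
   Stopping at the maximal dyadic cubes a large part of which is exceptional and
   iterating yields |T f| <= K sum_q <|f|>_q' 1_q a.e., where the selected
   cubes q keep disjoint parts of proportional measure. Each dilate q' lies in a
   cube of comparable size from one of 2^n shifted dyadic grids. For a fixed grid
   the sparse operator S f satisfies int (S f)^2 w = sum_q <|f|>_q' int_q (S f) w,
   and Cauchy-Schwarz with the dyadic Carleson embedding theorem for w and w^-1
   bounds this linearly in the A_2 constant. *)

Require Import Defs.
From HB Require Import structures.
From mathcomp Require Import all_boot all_order all_algebra.
From mathcomp Require Import complex.
From mathcomp Require Import all_classical all_reals all_analysis.
From mathcomp Require Import measurable_realfun.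
From mathcomp Require Import ring lra.

Set Implicit Arguments.
Unset Strict Implicit.
Unset Printing Implicit Defensive.
Import Order.TTheory GRing.Theory Num.Theory.
Import numFieldNormedType.Exports.

Local Open Scope classical_set_scope.
Local Open Scope ring_scope.

(** * Cubes and sup-norm balls, and their Lebesgue measure *)

Section boxes.
Context {R : realType} {n : nat}.
Local Notation Rn := (n.-tuple R).
Local Notation mu := (@lebesgue_tuple R n).

(** Linear growth comes from using the A_2 condition once per selected cube q. If E is the disjoint
    part of q, Cauchy-Schwarz for 1 = w w^-1 gives |q|^2 <= 4 w(E) w^-1(E), and A_2 on the grid cube
    Q around the dilate gives w(q) w^-1(Q) <= B |q|^2. Each term is then at most B times the mean of
    S f over q in the measure w, times the mean of |f| w over Q in the measure w^-1, times 2
    sqrt(w(E) w^-1(E)); both families of squares are Carleson sums with the absolute constant 4.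
    Testing S f against itself instead of a dual function makes int (S f)^2 w reappear on the right,
    to be absorbed. It must be finite beforehand, so sparse families are truncated to finite depth
    and the truncation is removed by monotone convergence.

    T acts on representatives, so its properties hold only almost everywhere. Hence cubes are coded
    in a countable tree, which allows the null sets to be collected, and a step between two cubes
    goes through an actual point x' outside of the exceptional sets of both, at which the needed
    a.e. properties hold. *)

Definition hcube (u : 'I_n -> R) (l : R) : set Rn :=
  [set x | forall i, u i <= tnth x i < u i + l].

(** Open ball of the sup norm. The centre is a function rather than a point, so that a corner
    [dcorner u L p] and the coordinates [tnth x] both serve. *)
Definition sball (c : 'I_n -> R) (r : R) : set Rn :=
  [set x | forall i, `|tnth x i - c i| < r].

Lemma measurable_box (I : 'I_n -> set R) : (forall i, measurable (I i)) ->
  measurable [set x : Rn | forall i, I i (tnth x i)].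
Proof.
move=> mI; rewrite (_ : [set x | _] = \bigcap_(i in [set: 'I_n])
    ((fun x : Rn => tnth x i) @^-1` I i)); last first.
  by apply/seteqP; split => [x H i _|x H i]; [exact: H|exact: (H i)].
apply: fin_bigcap_measurable => [|i _]; first exact: finite_finset.
rewrite -[X in measurable X]setTI.
by apply: (measurable_tnth i) => //; exact: mI.
Qed.

Lemma measurable_hcube u l : measurable (hcube u l).
Proof.
rewrite (_ : hcube u l = [set x : Rn | forall i, `[u i, u i + l[%classic (tnth x i)]).
  by apply: (@measurable_box (fun i => `[u i, u i + l[%classic)) => i; exact: measurable_itv.
by apply/seteqP; split => x H i; have := H i; rewrite /= in_itv.
Qed.

Lemma measurable_sball c r : measurable (sball c r).
Proof.
rewrite (_ : sball c r =
    [set x : Rn | forall i, `]c i - r, c i + r[%classic (tnth x i)]).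
  by apply: (@measurable_box (fun i => `]c i - r, c i + r[%classic)) => i; exact: measurable_itv.
by apply/seteqP; split => x H i; have := H i; rewrite /= in_itv /= ltr_distl.
Qed.

Lemma cube_box (u : 'I_n -> R) l : cube [tuple u i | i < n] l =
  [set x : Rn | forall i, u i <= tnth x i <= u i + l].
Proof.
by apply/seteqP; split => x H i; have := H i; rewrite !tnth_mktuple.
Qed.

Lemma measurable_cube (a : Rn) l : measurable (cube a l).
Proof.
rewrite (_ : cube a l =
    [set x : Rn | forall i, `[tnth a i, tnth a i + l]%classic (tnth x i)]).
  apply: (@measurable_box (fun i => `[tnth a i, tnth a i + l]%classic)) => i.
  exact: measurable_itv.
by apply/seteqP; split => x H i; have := H i; rewrite /= in_itv.
Qed.

Lemma lebesgue_cube (a : Rn) l : 0 <= l -> mu (cube a l) = (l ^+ n)%:E.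
Proof.
move=> l0; have := @lebesgue_tuple_box R n a [tuple tnth a i + l | i < n].
rewrite (_ : [set x | _] = cube a l); last first.
  by apply/seteqP; split => x H i; have := H i; rewrite tnth_mktuple.
move=> ->; last by move=> i; rewrite tnth_mktuple lerDl.
congr EFin; rewrite (eq_bigr (fun=> l)) ?prodr_const ?card_ord// => i _.
by rewrite tnth_mktuple addrC addKr.
Qed.

Lemma hcube_sub_cube u l : hcube u l `<=` cube [tuple u i | i < n] l.
Proof. by rewrite cube_box => x H i; have /andP[-> /ltW ->] := H i. Qed.

(** The closed cube bounds the measure from above. Closed cubes of side [l * (1 - 1/(k+1))] with the
    same corner lie in the half-open one and bound it from below in the limit, so that no face has
    to be shown null. *)
Lemma lebesgue_hcube u l : 0 < l -> mu (hcube u l) = (l ^+ n)%:E.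
Proof.
move=> l0; have l0' := ltW l0; apply/eqP; rewrite eq_le; apply/andP; split.
  rewrite -(lebesgue_cube [tuple u i | i < n] l0').
  apply: le_measure; rewrite ?inE; [exact: measurable_hcube|
    exact: measurable_cube|exact: hcube_sub_cube].
apply/lee_addgt0Pr => e e0.
pose t (k : nat) : R := l * (1 - k.+1%:R^-1).
have tlt k : t k < l.
  by rewrite /t gtr_pMr// ltrBlDr ltrDl invr_gt0 ltr0n.
have t0 k : 0 <= t k.
  by rewrite mulr_ge0// subr_ge0 invf_le1 ?ltr0n// ler1n.
have tk k : (((t k) ^+ n)%:E <= mu (hcube u l))%E.
  rewrite -(lebesgue_cube [tuple u i | i < n] (t0 k)).
  apply: le_measure; rewrite ?inE; [exact: measurable_cube|
    exact: measurable_hcube|].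
  rewrite cube_box => x H i; have /andP[-> /=] := H i.
  by move/le_lt_trans; apply; rewrite ltrD2l.
have : (t k) ^+ n @[k --> \oo] --> l ^+ n.
  have : t k @[k --> \oo] --> l * (1 - 0).
    apply: cvgMr; apply: cvgB; first exact: cvg_cst.
    exact: cvg_harmonic.
  rewrite subr0 mulr1 => tl.
  apply: (@continuous_cvg _ _ _ _ _ t (fun x => x ^+ n)) => //.
  exact: exprn_continuous.
move=> /cvgrPdist_lt /(_ _ e0)[N _ /(_ N (leqnn N))] H.
apply: (@le_trans _ _ ((t N) ^+ n + e)%:E).
  rewrite lee_fin -lerBlDl.
  by move: H; rewrite /= => /ltW; apply: le_trans; exact: ler_norm.
by rewrite EFinD leeD2r.
Qed.

Lemma lebesgue_sball_le c r : 0 < r -> (mu (sball c r) <= ((2 * r) ^+ n)%:E)%E.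
Proof.
move=> r0; have r2 : 0 <= 2 * r by rewrite mulr_ge0// ltW.
rewrite -(lebesgue_cube [tuple c i - r | i < n] r2).
apply: le_measure; rewrite ?inE; [exact: measurable_sball|
  exact: measurable_cube|].
rewrite cube_box => x H i; have := H i; rewrite ltr_distl => /andP[/ltW -> /ltW].
by move/le_trans; apply; lra.
Qed.

End boxes.

(** * Dyadic cubes coded by paths *)

Section dyadic.
Context {R : realType} {n : nat}.
Local Notation Rn := (n.-tuple R).
Local Notation mu := (@lebesgue_tuple R n).

(* A dyadic subcube of [hcube u L] is coded by the list of the successive
   halvings leading to it, the most recent one first; [suffix q p] then says
   that the cube of p is contained in the cube of q. *)
Definition dpath := seq {ffun 'I_n -> bool}.
Implicit Types (p q : dpath) (v : {ffun 'I_n -> bool}).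

Definition dside (L : R) p : R := L / 2 ^+ size p.

Fixpoint dcorner (u : 'I_n -> R) (L : R) p (i : 'I_n) : R :=
  if p is v :: q then dcorner u L q i + (v i)%:R * dside L p else u i.

Definition dcube u L p : set Rn := hcube (dcorner u L p) (dside L p).

Variables (u : 'I_n -> R) (L : R).
Hypothesis L0 : 0 < L.

Lemma dside_gt0 p : 0 < dside L p.
Proof. by rewrite divr_gt0// exprn_gt0. Qed.

Lemma dside_cons v p : dside L p = 2 * dside L (v :: p).
Proof.
by rewrite /dside /= exprS invfM mulrCA [2 * _]mulrA divff// mul1r.
Qed.

Lemma measurable_dcube p : measurable (dcube u L p).
Proof. exact: measurable_hcube. Qed.

Lemma lebesgue_dcube p : mu (dcube u L p) = ((dside L p) ^+ n)%:E.
Proof. exact/lebesgue_hcube/dside_gt0. Qed.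

Lemma dcube_cons v p : dcube u L (v :: p) `<=` dcube u L p.
Proof.
move=> x H i; have := H i; rewrite /= (dside_cons v p).
move: (dside_gt0 (v :: p)); move: (dside L (v :: p)) => s s0.
move: (dcorner u L p i) (tnth x i) => c t; case: (v i) => /= /andP[h1 h2]; apply/andP; split; lra.
Qed.

Lemma dcube_child p x : dcube u L p x -> exists v, dcube u L (v :: p) x.
Proof.
move=> H; pose v := [ffun i => dcorner u L p i + dside L p / 2 <= tnth x i].
exists v => i; have := H i; rewrite /dcube /hcube /=.
have -> : v i = (dcorner u L p i + dside L p / 2 <= tnth x i) by rewrite ffunE.
rewrite (dside_cons v p); move: (dside_gt0 (v :: p)).
move: (dside L (v :: p)) (dcorner u L p i) (tnth x i) => s c t s0.
by case: (leP (_ + _ / 2) t) => /= h /andP[h1 h2]; apply/andP; split; lra.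
Qed.

Lemma dcube_child_uniq p v v' x :
  dcube u L (v :: p) x -> dcube u L (v' :: p) x -> v = v'.
Proof.
move=> H H'; apply/ffunP => i; have := H i; have := H' i => /=.
rewrite (_ : dside L (v' :: p) = dside L (v :: p))//.
move: (dside_gt0 (v :: p)); move: (dside L (v :: p)) => s s0.
by case: (v i); case: (v' i) => //= /andP[h1 h2] /andP[h3 h4];
  exfalso; lra.
Qed.

Lemma suffix_consr q v p : suffix q (v :: p) = (q == v :: p) || suffix q p.
Proof.
apply/idP/idP => [/suffixP[[|w s] /= e]|/orP[/eqP ->|/suffixP[s ->]]].
- by rewrite e eqxx.
- by apply/orP; right; case: e => _ ->; exact: suffix_suffix.
- exact: suffix_refl.
- by apply/suffixP; exists (v :: s).
Qed.

Lemma dcube_suffix q p : suffix q p -> dcube u L p `<=` dcube u L q.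
Proof.
move=> /suffixP[s ->]; elim: s => //= v s IH.
exact: subset_trans (@dcube_cons _ _) IH.
Qed.

Lemma dcube_depth k x : dcube u L [::] x ->
  exists p, size p = k /\ dcube u L p x.
Proof.
move=> H; elim: k => [|k [p [<- Hp]]]; first by exists [::].
by have [v Hv] := dcube_child Hp; exists (v :: p).
Qed.

Lemma dcube_uniq p q x : size p = size q ->
  dcube u L p x -> dcube u L q x -> p = q.
Proof.
elim: p q => [|v p IH] [|w q]//= [s] Hp Hq.
have e := IH q s (dcube_cons Hp) (dcube_cons Hq); rewrite e in Hp *.
by rewrite (dcube_child_uniq Hp Hq).
Qed.

(** Dropping the latest halvings of [p] leaves its ancestor of depth [size q]; it contains [x],
    hence equals [q]. This is the nested-or-disjoint alternative, exact because the cubes are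
    half-open. *)
Lemma dcube_comparable p q x : (size q <= size p)%N ->
  dcube u L p x -> dcube u L q x -> suffix q p.
Proof.
move=> s Hp Hq; have sd : suffix (drop (size p - size q) p) p.
  by rewrite -[X in suffix _ X](cat_take_drop (size p - size q)) suffix_suffix.
rewrite -(_ : drop (size p - size q) p = q)//.
apply: (@dcube_uniq _ _ x) => //; first by rewrite size_drop subKn.
exact: (dcube_suffix sd).
Qed.

End dyadic.

(** * Countable families of sets and comparison of measures *)

Section enumeration.
Context {T : Type} {I : countType}.
Implicit Types (D : set I) (G : I -> set T).

(** A family over a countable type as a sequence, empty at the numbers that code no member of [D],
    so that countable additivity applies. *)
Definition enum_sets D G (k : nat) : set T :=
  if @pickle_inv I k is Some p then if p \in D then G p else set0 else set0.

Lemma enum_setsP D G k x : enum_sets D G k x ->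
  exists p, [/\ pickle_inv k = Some p, D p & G p x].
Proof.
rewrite /enum_sets; case: (pickle_inv k) => [p|//].
by case: ifPn => //; rewrite inE => Dp Gpx; exists p.
Qed.

Lemma bigcup_enum_sets D G :
  \bigcup_k enum_sets D G k = \bigcup_(p in D) G p.
Proof.
apply/seteqP; split => [x [k _ /enum_setsP[p [_ Dp Gpx]]]|x [p Dp Gpx]].
  by exists p.
by exists (pickle p) => //; rewrite /enum_sets pickleK_inv mem_set.
Qed.

Lemma trivIset_enum_sets D G : trivIset D G -> trivIset setT (enum_sets D G).
Proof.
move=> tD i j _ _ [x [/enum_setsP[p [ip Dp Gp]] /enum_setsP[q [jq Dq Gq]]]].
have pq : p = q by apply: (tD _ _ Dp Dq); exists x.
have := @pickle_invK I i; rewrite ip /= => <-.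
by have := @pickle_invK I j; rewrite jq /= => <-; rewrite pq.
Qed.

End enumeration.

Section measure_comparison.
Context d {T : measurableType d} {R : realType} {I : countType}.
Implicit Types (m : {measure set T -> \bar R}) (D : set I) (G H : I -> set T).
Local Open Scope ereal_scope.

Lemma measurable_enum_sets D G : (forall p, D p -> measurable (G p)) ->
  forall k, measurable (enum_sets D G k).
Proof.
move=> mG k; rewrite /enum_sets; case: pickle_inv => [p|//].
by case: ifPn => //; rewrite inE => /mG.
Qed.

Lemma measurable_bigcupI D G : (forall p, D p -> measurable (G p)) ->
  measurable (\bigcup_(p in D) G p).
Proof.
move=> mG; rewrite -(bigcup_enum_sets D G); apply: bigcupT_measurable.
exact: measurable_enum_sets.
Qed.

(** Subadditivity for [m1] and additivity over the disjoint [H] for [m2]. The [G] may overlap, as do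
    the dilates of disjoint cubes to which this is applied. *)
Lemma measure_bigcup_le m1 m2 D G H (c : R) : (0 <= c)%R ->
  (forall p, D p -> measurable (G p)) -> (forall p, D p -> measurable (H p)) ->
  trivIset D H -> (forall p, D p -> m1 (G p) <= c%:E * m2 (H p)) ->
  m1 (\bigcup_(p in D) G p) <= c%:E * m2 (\bigcup_(p in D) H p).
Proof.
move=> c0 mG mH tH GH; rewrite -(bigcup_enum_sets D G) -(bigcup_enum_sets D H).
have mG' := measurable_enum_sets mG; have mH' := measurable_enum_sets mH.
apply: (@le_trans _ _ (\sum_(0 <= k <oo) m1 (enum_sets D G k))).
  by apply: measure_sigma_subadditive => //; exact: bigcupT_measurable.
rewrite measure_bigcup//; last exact: trivIset_enum_sets.
rewrite [X in _ * X](eq_eseriesl (Q := xpredT)); last by move=> ?; rewrite in_setT.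
rewrite -nneseriesZl//; apply: lee_nneseries => // k _.
rewrite /enum_sets; case: pickle_inv => [p|]; last by rewrite !measure0 mule0.
by case: ifPn; rewrite ?measure0 ?mule0// inE => /GH.
Qed.

End measure_comparison.

Section density.
Context d {T : measurableType d} {R : realType}.
Variable mu : {measure set T -> \bar R}.

(** Makes [A |-> int_A f] a measure, so that covering arguments for two measures also compare
    integrals of [f] with volumes. *)
Lemma density_measure (f : T -> R) :
  measurable_fun setT f -> (forall x, 0 <= f x) ->
  exists nu : {measure set T -> \bar R},
    forall A, nu A = (\int[mu]_(x in A) (f x)%:E)%E.
Proof.
move=> mf f0; pose m A := (\int[mu]_(x in A) (f x)%:E)%E.
have m0 : m set0 = 0%E by rewrite /m integral_set0.
have mge0 A : (0 <= m A)%E by apply: integral_ge0 => x _; rewrite lee_fin.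
have madd : semi_sigma_additive m.
  move=> F mF tF mUF; rewrite /m ge0_integral_bigcup//; first last.
  - by move=> x _; rewrite lee_fin.
  - by apply/measurable_EFinP; exact: measurable_funTS.
  apply: is_cvg_nneseries => k _ _; exact: mge0.
pose nu : {measure set T -> \bar R} :=
  HB.pack m (isMeasure.Build _ _ _ m m0 mge0 madd).
by exists nu.
Qed.

End density.

(** * Stopping at maximal cubes *)

Section stopping.
Context {R : realType} {n : nat}.
Local Notation Rn := (n.-tuple R).
Local Notation dpath := (@dpath n).
Variables (u : 'I_n -> R) (L : R).
Hypothesis L0 : 0 < L.
Implicit Types bad : set dpath.

(** The maximal bad cubes: a proper suffix of a path is a strictly larger cube. *)
Definition first_bad bad : set dpath :=
  [set p | bad p /\ forall q, suffix q p -> bad q -> q = p].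

Lemma first_bad_sub bad : first_bad bad `<=` bad.
Proof. by move=> p []. Qed.

Lemma first_bad_exists bad p : bad p -> exists2 q, suffix q p & first_bad bad q.
Proof.
have [k] := ubnP (size p); elim: k p => // k IH p pk b.
have [[q [qp qq bq]]|nb] :=
    pselect (exists q, [/\ suffix q p, q <> p & bad q]); last first.
  exists p; first exact: suffix_refl.
  split => // q qp bq; apply: contrapT => qq; apply: nb; by exists q.
have qlt : (size q < size p)%N.
  case/suffixP: qp qq => s ->; case: s => [//|v s] _.
  by rewrite size_cat /= addSn ltnS leq_addl.
have [r rq fr] := IH q (leq_trans qlt pk) bq.
by exists r => //; exact: suffix_trans rq qp.
Qed.

Lemma bigcup_first_bad bad : \bigcup_(p in first_bad bad) dcube u L p =
  \bigcup_(p in bad) dcube u L p.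
Proof.
apply/seteqP; split => [x [p /first_bad_sub bp px]|x [p bp px]]; first by exists p.
by have [q qp fq] := first_bad_exists bp; exists q => //; exact: (dcube_suffix L0 qp).
Qed.

Lemma trivIset_first_bad bad : trivIset (first_bad bad) (dcube u L).
Proof.
move=> p q [bp fp] [bq fq] [x [xp xq]].
have [s|/ltnW s] := leqP (size q) (size p).
  by apply/esym/fp => //; exact: (dcube_comparable L0 s xp xq).
by apply/fq => //; exact: (dcube_comparable L0 s xq xp).
Qed.

(** The maximal bad cubes are disjoint with the same union as all bad ones, so a comparison on each
    of them adds up. The measures will be Lebesgue measure, densities and restrictions to a set. *)
Lemma stopping_le (m1 m2 : {measure set Rn -> \bar R}) bad (c : R) : 0 <= c ->
  (forall p, first_bad bad p -> (m1 (dcube u L p) <= c%:E * m2 (dcube u L p))%E) ->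
  (m1 (\bigcup_(p in bad) dcube u L p) <=
   c%:E * m2 (\bigcup_(p in bad) dcube u L p))%E.
Proof.
move=> c0 H; rewrite -bigcup_first_bad; apply: measure_bigcup_le => //.
- by move=> p _; exact: measurable_dcube.
- by move=> p _; exact: measurable_dcube.
- exact: trivIset_first_bad.
Qed.

Lemma measurable_bad bad : measurable (\bigcup_(p in bad) dcube u L p).
Proof. by apply: measurable_bigcupI => p _; exact: measurable_dcube. Qed.

End stopping.

(** * Outer regularity by dyadic cubes *)

Section outer_regularity.
Context {R : realType} {n : nat}.
Local Notation Rn := (n.-tuple R).
Local Notation mu := (@lebesgue_tuple R n).
Local Notation dpath := (@dpath n).
Variables (u : 'I_n -> R) (L : R).
Hypothesis L0 : 0 < L.
Implicit Types (S : set dpath) (A B : set Rn).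

Local Notation root := (dcube u L [::]).

Definition dcover S : set Rn := \bigcup_(p in S) dcube u L p.

Lemma dcube_root p : dcube u L p `<=` root.
Proof. exact: (dcube_suffix L0 (suffix0s p)). Qed.

Lemma dcover_root S : dcover S `<=` root.
Proof. by move=> x [p _ /dcube_root]. Qed.

Lemma measurable_dcover S : measurable (dcover S).
Proof. exact: measurable_bad. Qed.

Lemma dside_small (e : R) : 0 < e -> exists k, L / 2 ^+ k < e.
Proof.
move=> e0; exists (Num.truncn (L / e)).+1.
rewrite ltr_pdivrMr ?exprn_gt0// mulrC -ltr_pdivrMr//.
apply: (lt_trans (truncnS_gt _)).
by rewrite -natrX ltr_nat ltn_expl.
Qed.

Lemma dcube_dist p (x y : Rn) i : dcube u L p x -> dcube u L p y ->
  `|tnth x i - tnth y i| < dside L p.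
Proof.
move=> /(_ i) /andP[x1 x2] /(_ i) /andP[y1 y2].
by rewrite ltr_norml; apply/andP; split; lra.
Qed.

(** Outer regularity inside the root, with unions of cubes of the given grid in the role of the open
    sets. *)
Definition outer_dyadic B := forall e : R, 0 < e ->
  exists S, B `&` root `<=` dcover S /\ (mu (dcover S `\` B) <= e%:E)%E.

Lemma outer_dyadic_bigcup (B : (set Rn)^nat) : (forall k, measurable (B k)) ->
  (forall k, outer_dyadic (B k)) -> outer_dyadic (\bigcup_k B k).
Proof.
move=> mB oB e e0.
have /choice[S HS] : forall k, exists S, B k `&` root `<=` dcover S /\
    (mu (dcover S `\` B k) <= (e / (2 ^ k.+1)%:R)%:E)%E.
  by move=> k; apply: oB; rewrite divr_gt0// ltr0n expn_gt0.
exists (\bigcup_k S k); split.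
  move=> x [[k _ Bkx] rx]; have [+ _] := HS k; move=> /(_ x (conj Bkx rx)).
  by move=> [p Sp px]; exists p => //; exists k.
apply: (@le_trans _ _ (\sum_(0 <= k <oo) mu (dcover (S k) `\` B k))%E).
  apply: measure_sigma_subadditive => //.
  - by move=> k; apply: measurableD => //; exact: measurable_dcover.
  - apply: measurableD; first exact: measurable_dcover.
    exact: bigcupT_measurable.
  - move=> x [[p [k _ Sp] px] nB]; exists k => //; split; first by exists p.
    by move=> Bk; apply: nB; exists k.
apply: le_trans (epsilon_trick0 xpredT (ltW e0)).
by apply: lee_nneseries => // k _; have [_] := HS k.
Qed.

Lemma outer_dyadicI A B : measurable A -> measurable B ->
  outer_dyadic A -> outer_dyadic B -> outer_dyadic (A `&` B).
Proof.
move=> mA mB oA oB e e0; have e2 : 0 < e / 2 by rewrite divr_gt0.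
have [S [AS Se]] := oA _ e2; have [S' [BS Se']] := oB _ e2.
(* Two dyadic cubes that meet intersect in the smaller one, so the cubes lying under a cube of each
   cover form a cover of the intersection. *)
exists [set p | (exists2 q, S q & suffix q p) /\ exists2 q, S' q & suffix q p].
split.
  move=> x [[Ax Bx] rx]; have [p Sp px] := AS x (conj Ax rx).
  have [q Sq qx] := BS x (conj Bx rx).
  have [s|/ltnW s] := leqP (size q) (size p).
    exists p => //; split; first by exists p => //; exact: suffix_refl.
    by exists q => //; exact: (dcube_comparable L0 s px qx).
  exists q => //; split; last by exists q => //; exact: suffix_refl.
  by exists p => //; exact: (dcube_comparable L0 s qx px).
set S2 := [set p | _].
apply: (@le_trans _ _ (mu ((dcover S `\` A) `|` (dcover S' `\` B)))).
  apply: le_measure; rewrite ?inE.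
  - by apply: measurableD; [exact: measurable_dcover|exact: measurableI].
  - by apply: measurableU; apply: measurableD => //; exact: measurable_dcover.
  move=> x [[p [[q Sq qp] [q' Sq' qp']] px] nAB].
  have [Ax|nA] := pselect (A x); [right|left]; split.
  + by exists q' => //; exact: (dcube_suffix L0 qp').
  + by move=> Bx; apply: nAB.
  + by exists q => //; exact: (dcube_suffix L0 qp).
  + by [].
apply: (le_trans (measureU2 _ _ _)).
- by apply: measurableD => //; exact: measurable_dcover.
- by apply: measurableD => //; exact: measurable_dcover.
by rewrite [e in leRHS]splitr EFinD leeD.
Qed.

Lemma lebesgue_root_fin : (mu root < +oo)%E.
Proof. by rewrite lebesgue_dcube// ltry. Qed.

(** By continuity from above on the root, of finite measure, some finite intersection [C N] exceeds
    the whole one by at most [e / 2] inside the root; then a cover of [C N] with excess [e / 2]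
    suffices. *)
Lemma outer_dyadic_bigcap (B : (set Rn)^nat) : (forall k, measurable (B k)) ->
  (forall k, outer_dyadic (B k)) -> outer_dyadic (\bigcap_k B k).
Proof.
move=> mB oB.
pose C := fix C k := if k is k'.+1 then C k' `&` B k else B 0%N.
have mC k : measurable (C k) by elim: k => //= k IH; exact: measurableI.
have oC k : outer_dyadic (C k) by elim: k => //= k IH; exact: outer_dyadicI.
have CB k j : (k <= j)%N -> C j `<=` B k.
  elim: j => [|j IH]; first by rewrite leqn0 => /eqP ->.
  by rewrite leq_eqVlt => /orP[/eqP -> x []//|]; rewrite ltnS => /IH + x [] => /[apply].
have BC k : \bigcap_k B k `<=` C k.
  elim: k => [x H|k IH x H]; first exact: H.
  by split; [exact: IH|exact: H].
have -> : \bigcap_k B k = \bigcap_k C k.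
  apply/seteqP; split => [x H k _|x H k _]; first exact: BC.
  by apply: (CB k k) => //; exact: H.
move=> e e0; have e2 : 0 < e / 2 by rewrite divr_gt0.
have mCC : measurable (\bigcap_k C k) by exact: bigcapT_measurable.
pose D k := (C k `\` \bigcap_k C k) `&` root.
have mD k : measurable (D k).
  by apply: measurableI; [exact: measurableD|exact: measurable_dcube].
have mu_le A B' : measurable A -> measurable B' -> A `<=` B' -> (mu A <= mu B')%E.
  by move=> mA mB' AB; apply: le_measure; rewrite ?inE.
have : mu (D k) @[k --> \oo] --> mu (\bigcap_k D k).
  apply: nonincreasing_cvg_mu => //.
  - apply: le_lt_trans lebesgue_root_fin; apply: mu_le => //.
      exact: measurable_dcube.
    exact: subIsetr.
  - exact: bigcapT_measurable.
  - apply/nonincreasing_seqP => k; apply/subsetPset => x [[[Cx _] nx] rx].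
    by split.
rewrite (_ : \bigcap_k D k = set0) ?measure0; last first.
  apply/seteqP; split => // x H; have [[_ nx] _] := H 0%N I.
  by apply: nx => k _; have [[]] := H k I.
move=> /fine_cvgP[_ /cvgrPdist_lt /(_ _ e2)[N _ /(_ N (leqnn N)) HN]].
have [S [CS Se]] := oC N _ e2.
exists S; split.
  by move=> x [H rx]; apply: CS; split => //; exact: H.
apply: (@le_trans _ _ (mu ((dcover S `\` C N) `|` D N))).
  apply: mu_le.
  - by apply: measurableD => //; exact: measurable_dcover.
  - by apply: measurableU => //; apply: measurableD => //; exact: measurable_dcover.
  move=> x [Sx nx]; have rx := dcover_root Sx.
  by have [Cx|Cx] := pselect (C N x); [right|left].
apply: (le_trans (measureU2 _ _ _)) => //.
  by apply: measurableD => //; exact: measurable_dcover.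
rewrite [e in leRHS]splitr EFinD; apply: leeD => //.
have fD : mu (D N) \is a fin_num.
  rewrite ge0_fin_numE//; apply: le_lt_trans lebesgue_root_fin.
  by apply: mu_le => //; [exact: measurable_dcube|exact: subIsetr].
move: HN; rewrite /= sub0r normrN => /ltW HN.
by rewrite -(fineK fD) lee_fin; apply: le_trans HN; exact: ler_norm.
Qed.

Lemma outer_dyadic_open A : measurable A ->
  (forall x, A x -> root x -> exists2 p, dcube u L p x & dcube u L p `<=` A) ->
  outer_dyadic A.
Proof.
move=> mA H e e0; exists [set p | dcube u L p `<=` A]; split.
  by move=> x [Ax rx]; have [p px pA] := H x Ax rx; exists p.
rewrite (_ : _ `\` _ = set0) ?measure0 ?lee_fin ?ltW//.
by apply/seteqP; split => // x [[p /= pA px]]; apply; exact: pA.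
Qed.

Lemma measurable_coord i (A : set R) : measurable A ->
  measurable [set x : Rn | A (tnth x i)].
Proof.
move=> mA; rewrite -[X in measurable X]setTI.
by apply: (measurable_tnth i) => //.
Qed.

Lemma outer_dyadic_gt i (a : R) : outer_dyadic [set x : Rn | a < tnth x i].
Proof.
apply: outer_dyadic_open.
  rewrite (_ : [set x | _] = [set x : Rn | `]a, +oo[%classic (tnth x i)]).
    by apply: measurable_coord; exact: measurable_itv.
  by apply/seteqP; split => x; rewrite /= in_itv /= andbT.
move=> x /= ax rx; have /dside_small[k ke] : 0 < tnth x i - a by rewrite subr_gt0.
have [p [sp px]] := dcube_depth L0 k rx; exists p => // y py /=.
have := dcube_dist i px py; rewrite /dside sp ltr_norml => /andP[_].
by move: ke; move: (L / _) (tnth x i) (tnth y i) ax => *; lra.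
Qed.

Lemma outer_dyadic_lt i (a : R) : outer_dyadic [set x : Rn | tnth x i < a].
Proof.
apply: outer_dyadic_open.
  rewrite (_ : [set x | _] = [set x : Rn | `]-oo, a[%classic (tnth x i)]).
    by apply: measurable_coord; exact: measurable_itv.
  by apply/seteqP; split => x; rewrite /= in_itv /=.
move=> x /= ax rx; have /dside_small[k ke] : 0 < a - tnth x i by rewrite subr_gt0.
have [p [sp px]] := dcube_depth L0 k rx; exists p => // y py /=.
have := dcube_dist i px py; rewrite /dside sp ltr_norml => /andP[+ _].
by move: ke; move: (L / _) (tnth x i) (tnth y i) ax => *; lra.
Qed.

Lemma outer_dyadic_le i (a : R) : outer_dyadic [set x : Rn | tnth x i <= a].
Proof.
rewrite (_ : [set x | _] =
    \bigcap_k [set x : Rn | tnth x i < a + k.+1%:R^-1]); last first.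
  apply/seteqP; split => x /= H.
    by move=> k _ /=; apply: (le_lt_trans H); rewrite ltrDl invr_gt0.
  apply/ler_addgt0Pr => e e0.
  have := H (Num.truncn e^-1) I => /= /ltW /le_trans; apply.
  rewrite lerD2l -[leRHS]invrK lef_pV2 ?posrE ?invr_gt0//.
  exact: ltW (truncnS_gt _).
apply: outer_dyadic_bigcap => k; last exact: outer_dyadic_lt.
rewrite (_ : [set x | _] =
    [set x : Rn | `]-oo, (a + k.+1%:R^-1)[%classic (tnth x i)]).
  by apply: measurable_coord; exact: measurable_itv.
by apply/seteqP; split => x; rewrite /= in_itv /=.
Qed.

(** The sets that are outer dyadic together with their complement form a sigma-algebra; stability
    under countable intersections handles the complement of a union. It contains the open
    half-spaces, which inside the root are unions of cubes, and whose complements are countable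
    intersections of open half-spaces. *)
Lemma outer_dyadic_measurable B : measurable B -> outer_dyadic B.
Proof.
pose F : set (set Rn) :=
  [set A | [/\ measurable A, outer_dyadic A & outer_dyadic (~` A)]].
have o0 : outer_dyadic set0 by apply: outer_dyadic_open.
have oT : outer_dyadic setT.
  by apply: outer_dyadic_open => // x _ rx; exists [::].
have FU (A : (set Rn)^nat) : (forall k, F (A k)) -> F (\bigcup_k A k).
  move=> FA; split.
  - by apply: bigcupT_measurable => k; have [] := FA k.
  - by apply: outer_dyadic_bigcup => k; have [] := FA k.
  - rewrite setC_bigcup; apply: outer_dyadic_bigcap => k; have [? ? ?] := FA k => //.
    exact: measurableC.
have FC A : F A -> F (~` A).
  by move=> [mA oA oCA]; split => //; [exact: measurableC|rewrite setCK].
have F0 : F set0 by split => //; rewrite setC0.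
suff : measurable `<=` F by move=> /(_ B) + mB => /(_ mB)[].
apply: smallest_sub.
  by split => // A FA; rewrite setTD; exact: FC.
(* The product sigma-algebra is generated by the preimages of measurable sets under the
   coordinates. *)
suff H i (A : set R) : measurable A -> F [set x : Rn | A (tnth x i)].
  elim/big_ind : _ => // [X Y HX HY x [/HX|/HY]//|i _ A [A' mA' <-]].
  by rewrite setTI; exact: H.
pose G := [set A : set R | F [set x : Rn | A (tnth x i)]].
suff : (RGenOInfty.G (R := R)).-sigma.-measurable `<=` G.
  by rewrite -RGenOInfty.measurableE => /[apply].
apply: smallest_sub.
  split; rewrite /G /=.
  - by rewrite (_ : [set x | _] = set0).
  - move=> A' FA; rewrite (_ : [set x | _] = ~` [set x : Rn | A' (tnth x i)]).
      exact: FC.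
    by apply/seteqP; split => x //= [].
  - move=> A' FA.
    rewrite (_ : [set x | _] = \bigcup_k [set x : Rn | A' k (tnth x i)])//.
    exact: FU.
move=> A' [a ->]; rewrite /G /=.
rewrite (_ : [set x | _] = [set x : Rn | a < tnth x i]); last first.
  by apply/seteqP; split => x; rewrite /= in_itv /= andbT.
split; first last.
- rewrite (_ : ~` _ = [set x : Rn | tnth x i <= a]); first exact: outer_dyadic_le.
  by apply/seteqP; split => x /=; [move/negP; rewrite -leNgt|
    move=> xa; apply/negP; rewrite -leNgt].
- exact: outer_dyadic_gt.
rewrite (_ : [set x | _] = [set x : Rn | `]a, +oo[%classic (tnth x i)]).
  by apply: measurable_coord; exact: measurable_itv.
by apply/seteqP; split => x; rewrite /= in_itv /= andbT.
Qed.

End outer_regularity.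

(** * Lebesgue differentiation along a grid *)

Section differentiation.
Context {R : realType} {n : nat}.
Local Notation Rn := (n.-tuple R).
Local Notation mu := (@lebesgue_tuple R n).
Local Notation dpath := (@dpath n).
Variables (u : 'I_n -> R) (L : R).
Hypothesis L0 : 0 < L.

Lemma mu_le (A B : set Rn) : measurable A -> measurable B -> A `<=` B ->
  (mu A <= mu B)%E.
Proof. by move=> mA mB AB; apply: le_measure; rewrite ?inE. Qed.

Lemma measurable_gt (f : Rn -> R) (a : R) : measurable_fun setT f ->
  measurable [set x | a < f x].
Proof.
move=> mf; rewrite (_ : [set x | _] = setT `&` f @^-1` `]a, +oo[%classic).
  exact: mf.
by rewrite setTI; apply/seteqP; split => x; rewrite /= in_itv /= andbT.
Qed.

Lemma measurable_ge (f : Rn -> R) (a : R) : measurable_fun setT f ->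
  measurable [set x | a <= f x].
Proof.
move=> mf; rewrite (_ : [set x | _] = setT `&` f @^-1` `[a, +oo[%classic).
  exact: mf.
by rewrite setTI; apply/seteqP; split => x; rewrite /= in_itv /= andbT.
Qed.

(* Outer regularity covers the set where f > lam by cubes of total measure
   almost minimal, on each of which f has average at most lam. *)
Lemma dyadic_differentiation (f : Rn -> R) (lam : R) (A : set Rn) :
  measurable_fun setT f -> (forall x, 0 <= f x) -> 0 <= lam ->
  measurable A -> A `<=` dcube u L [::] ->
  (forall p x, A x -> dcube u L p x ->
    (\int[mu]_(y in dcube u L p) (f y)%:E <= lam%:E * mu (dcube u L p))%E) ->
  {ae mu, forall x, A x -> f x <= lam}.
Proof.
move=> mf f0 lam0 mA Aroot H.
have [nu nuE] := density_measure mu mf f0.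
pose B k := A `&` [set x | lam + k.+1%:R^-1 <= f x].
have mB k : measurable (B k) by apply: measurableI => //; exact: measurable_ge.
suff B0 k : mu (B k) = 0%E.
  exists (\bigcup_k B k); split.
  - exact: bigcupT_measurable.
  - apply/eqP; rewrite eq_le measure_ge0 andbT.
    apply: (le_trans (measure_sigma_subadditive mu mB _ (@subset_refl _ _))).
      exact: bigcupT_measurable.
    by rewrite eseries0// => k _ _; exact: B0.
  - move=> x /= /not_implyP[Ax /negP]; rewrite -ltNge => lamf.
    exists (Num.truncn (f x - lam)^-1) => //; split => //=.
    rewrite -lerBrDl -[leRHS]invrK lef_pV2 ?posrE ?invr_gt0 ?subr_gt0//.
    exact: ltW (truncnS_gt _).
have Bfin : mu (B k) \is a fin_num.
  rewrite ge0_fin_numE//; apply: le_lt_trans (lebesgue_root_fin u L0).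
  apply: mu_le => //; first exact: measurable_dcube.
  by move=> x [/Aroot].
set eta := k.+1%:R^-1 : R; have eta0 : 0 < eta by rewrite invr_gt0.
set b := fine (mu (B k)); have b0 : 0 <= b by rewrite fine_ge0.
have key e : 0 < e -> eta * b <= lam * e.
  move=> e0; have [S [BS Se]] := outer_dyadic_measurable u L0 (mB k) e0.
  (* Cubes of the cover that miss [B k] are discarded, since the bound on averages is only known for
     cubes meeting [A]. *)
  pose S' : set dpath := [set p | S p /\ exists2 x, B k x & dcube u L p x].
  have S'S : dcover u L S' `<=` dcover u L S by move=> x [p [Sp _] px]; exists p.
  have BS' : B k `<=` dcover u L S'.
    move=> x Bx; have [p Sp px] := BS x (conj Bx (Aroot _ Bx.1)).
    by exists p => //; split => //; exists x.
  have h1 : (nu (dcover u L S') <= lam%:E * mu (dcover u L S'))%E.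
    apply: stopping_le => // p [[_ [x [Ax _] px]] _].
    by rewrite nuE; exact: (H p x).
  have h2 : (mu (dcover u L S') <= (b + e)%:E)%E.
    apply: (@le_trans _ _ (mu (B k `|` (dcover u L S `\` B k)))).
      apply: mu_le.
      - exact: measurable_dcover.
      - apply: measurableU => //; apply: measurableD => //.
        exact: measurable_dcover.
      - move=> x /S'S Sx; have [Bx|Bx] := pselect (B k x); first by left.
        by right.
    apply: (le_trans (measureU2 _ _ _)) => //.
      by apply: measurableD => //; exact: measurable_dcover.
    by rewrite EFinD /b fineK// leeD2l.
  have h3 : ((lam + eta)%:E * mu (B k) <= nu (dcover u L S'))%E.
    apply: (@le_trans _ _ (nu (B k))); last first.
      by apply: le_measure; rewrite ?inE//; exact: measurable_dcover.
    rewrite nuE -integral_cst//; apply: ge0_le_integral => //=.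
    - by move=> x _; rewrite lee_fin addr_ge0// ltW.
    - by apply/measurable_EFinP; exact: measurable_funTS.
    - by move=> x [_ /=]; rewrite lee_fin.
  have := le_trans h3 (le_trans h1 (lee_wpmul2l _ h2)).
  rewrite -(fineK Bfin) -/b -!EFinM lee_fin  => /(_ lam0).
  by rewrite lee_fin mulrDl mulrDr lerD2l.
apply/eqP; rewrite -(fineK Bfin) eqe -/b eq_le b0 andbT.
rewrite leNgt; apply/negP => bpos.
have l1 : 0 < lam + 1 by lra.
have eb : 0 < eta * b by rewrite mulr_gt0.
(* With this choice of [e] the bound [lam * e] falls below [eta * b], against [key]. *)
have := key (eta * b / (2 * (lam + 1))) (divr_gt0 eb (mulr_gt0 (ltr0n _ 2) l1)).
rewrite mulrA ler_pdivlMr ?mulr_gt0// -subr_ge0.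
have -> : lam * (eta * b) - eta * b * (2 * (lam + 1)) = - ((lam + 2) * (eta * b)) by ring.
by rewrite oppr_ge0 leNgt mulr_gt0//; lra.
Qed.

End differentiation.

(** * Integrals over dyadic annuli *)

Section annuli.
Context {R : realType} {n : nat}.
Local Notation Rn := (n.-tuple R).
Local Notation mu := (@lebesgue_tuple R n).

Lemma half_powR_lt1 (del : R) : 0 < del -> 2^-1 `^ del < 1.
Proof.
move=> d0; suff : 2^-1 `^ del < 1 `^ del :> R by rewrite powR1.
apply: gt0_ltr_powR => //; rewrite ?nnegrE ?invr_ge0//.
by rewrite invf_lt1// ltr1n.
Qed.

Lemma powR_exprn (x del : R) j : 0 <= x -> (x ^+ j) `^ del = (x `^ del) ^+ j.
Proof.
move=> x0; rewrite -powR_mulrn// -powRrM mulrC powRrM powR_mulrn//.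
exact: powR_ge0.
Qed.

Lemma eseries_geometric_le (a t : R) : 0 <= a -> 0 <= t < 1 ->
  (\sum_(0 <= j <oo) (a * t ^+ j)%:E <= (a / (1 - t))%:E)%E.
Proof.
move=> a0 /andP[t0 t1]; apply: lime_le.
  by apply: is_cvg_nneseries => k _ _; rewrite lee_fin mulr_ge0// exprn_ge0.
apply: nearW => N; rewrite sumEFin lee_fin.
have := geometric_seriesE a (negbT (lt_eqF t1)).
move=> /(congr1 (fun f => f N)); rewrite /series /= => ->.
rewrite ler_pM2r ?invr_gt0 ?subr_gt0// ler_piMr//.
by rewrite gerBl exprn_ge0.
Qed.

Lemma sball_homo (c : 'I_n -> R) (r s : R) : r <= s -> sball c r `<=` sball c s.
Proof. by move=> rs x H i; exact: lt_le_trans (H i) rs. Qed.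

Lemma sball_exhaust (c : 'I_n -> R) (r : R) : 0 < r ->
  \bigcup_j sball c (2 ^+ j * r) = setT.
Proof.
move=> r0; apply/seteqP; split => // x _.
pose M := \sum_i `|tnth x i - c i|.
have M0 : 0 <= M by apply: sumr_ge0.
have [k] := @dside_small R (M + 1) r r0.
rewrite ltr_pdivrMr ?exprn_gt0// mulrC => Mk; exists k => // i.
apply: le_lt_trans Mk; rewrite /M (bigD1 i)//= -addrA lerDl addr_ge0//.
exact: sumr_ge0.
Qed.

(** On the shell of radii [2^j r0] to [2^(j+1) r0] the decay contributes [2^-(j del)], and the
    remaining [r^-n] is compensated by the mass of [G], at the cost of [2^n] for the outer radius; a
    geometric series is left. With [G = 1] this bounds [U b] far from the cube of [b], with
    [G = |F|] an oscillation of [U F]. *)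
Lemma annulus_integral (phi G : Rn -> R) (c : 'I_n -> R) (r0 del C Lam : R) :
  measurable_fun setT phi -> measurable_fun setT G ->
  (forall y, 0 <= phi y) -> (forall y, 0 <= G y) ->
  0 < r0 -> 0 < del -> 0 <= C -> 0 <= Lam ->
  {ae mu, forall y, (sball c r0 y -> phi y = 0) /\
    forall r, r0 <= r -> ~ sball c r y ->
      phi y <= C * ((r0 / r) `^ del / r ^+ n) * G y} ->
  (forall r, r0 <= r ->
    (\int[mu]_(y in sball c r) (G y)%:E <= (Lam * r ^+ n)%:E)%E) ->
  (\int[mu]_y (phi y)%:E <=
    (C * Lam * 2 ^+ n / (1 - 2^-1 `^ del))%:E)%E.
Proof.
move=> mphi mG phi0 G0 r00 del0 C0 Lam0 H HG.
pose F j := sball c (2 ^+ j.+1 * r0).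
have ndF : {homo F : j k / (j <= k)%N >-> (j <= k)%O}.
  move=> j k jk; apply/subsetPset/sball_homo; rewrite ler_pM2r//.
  by rewrite ler_weXn2l// ler1n.
have mF j : measurable (F j) by exact: measurable_sball.
have mD j : measurable (seqD F j) by case: j => [|j] //=; exact: measurableD.
have FT : \bigcup_j F j = setT.
  rewrite -(@sball_exhaust c (2 * r0)) ?mulr_gt0//.
  by apply: eq_bigcupr => j _; rewrite /F exprSr mulrA.
rewrite -FT -eq_bigcup_seqD ge0_integral_bigcup//; first last.
- exact: trivIset_seqD.
- by move=> x _; rewrite lee_fin.
- by apply/measurable_EFinP; exact: measurable_funTS.
set t := 2^-1 `^ del; have t01 : 0 <= t < 1.
  by rewrite powR_ge0 half_powR_lt1.
apply: le_trans (eseries_geometric_le (a := C * Lam * 2 ^+ n) _ t01); last first.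
  by rewrite !mulr_ge0// exprn_ge0.
apply: lee_nneseries => [j _ _|j _].
  by apply: integral_ge0 => x _; rewrite lee_fin.
pose r := 2 ^+ j * r0; have r_gt0 : 0 < r by rewrite mulr_gt0// exprn_gt0.
have r0r : r0 <= r by rewrite ler_peMl ?(ltW r00) ?exprn_ege1 ?ler1n.
have tE : (r0 / r) `^ del = t ^+ j.
  by rewrite /r invfM mulrCA divff ?gt_eqF// mulr1 -exprVn powR_exprn.
pose k := C * (t ^+ j / r ^+ n).
have k0 : 0 <= k.
  have [t0 _] := andP t01.
  by rewrite /k mulr_ge0// divr_ge0 ?exprn_ge0// ltW.
apply: (@le_trans _ _ (\int[mu]_(y in seqD F j) (k%:E * (G y)%:E))%E).
  apply: ae_ge0_le_integral => //.
  - by move=> x _; rewrite lee_fin.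
  - by apply/measurable_EFinP; exact: measurable_funTS.
  - by move=> x _; rewrite -EFinM lee_fin mulr_ge0.
  - apply: measurable_funeM; apply/measurable_EFinP; exact: measurable_funTS.
  apply: filterS H => x [Hin Hout] Dx; rewrite -EFinM lee_fin.
  have [xr|xr] := pselect (sball c r x); last by rewrite /k -tE; exact: Hout.
  (* Only shell 0 reaches inside the ball of radius [2^j r0]: it is the whole ball of radius [2 r0],
     and [phi] vanishes on the ball of radius [r0]. *)
  case: j @r r_gt0 r0r tE @k k0 Dx xr => [|j] r r_gt0 r0r tE k k0 Dx xr.
    rewrite Hin; first exact: mulr_ge0.
    by move: xr; rewrite /r expr0 mul1r.
  by case: Dx.
rewrite ge0_integralZl_EFin//; first last.
- by apply/measurable_EFinP; exact: measurable_funTS.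
- by move=> x _; rewrite lee_fin.
apply: (@le_trans _ _ (k%:E * (Lam * (2 * r) ^+ n)%:E)%E).
  apply: lee_wpmul2l; first by rewrite lee_fin.
  apply: le_trans (HG _ _); last first.
    by rewrite (le_trans r0r)// ler_peMl ?ler1n ?(ltW r_gt0).
  apply: ge0_subset_integral => //.
  - exact: measurable_sball.
  - by apply/measurable_EFinP; exact: measurable_funTS.
  - by move=> x _; rewrite lee_fin.
  - have -> : sball c (2 * r) = F j by rewrite /F /r exprS mulrA.
    by case: (j) => [|i] //=; exact: subDsetl.
rewrite -EFinM lee_fin /k.
move: (r) r_gt0 => x x0; rewrite exprMn.
have xn : x ^+ n != 0 by rewrite expf_neq0// gt_eqF.
rewrite le_eqVlt; apply/orP; left; apply/eqP.
by move: (2 ^+ n) (t ^+ j) (x ^+ n) xn => y z v v0; field.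
Qed.

End annuli.

(** * Bounded functions of bounded support *)

Section bounded_compactly_supported.
Context {R : realType} {n : nat}.
Local Notation Rn := (n.-tuple R).
Local Notation mu := (@lebesgue_tuple R n).
Implicit Types f g : Rn -> R.

(** Bound and support are meant everywhere, not almost everywhere, so that truncations such as
    [f * \1_A] stay in the class by pointwise arguments alone. *)
Definition bcs f := [/\ measurable_fun setT f, (exists M, forall x, `|f x| <= M) &
  exists r, forall x, ~ sball (fun=> 0) r x -> f x = 0].

Lemma bcs_lin a f g : bcs f -> bcs g -> bcs (fun x => a * f x + g x).
Proof.
move=> [mf [M fM] [r fr]] [mg [M' gM] [r' gr]]; split.
- by apply: measurable_funD => //; exact: measurable_funM.
- exists (`|a| * M + M') => x; apply: (le_trans (ler_normD _ _)).
  by rewrite lerD// normrM ler_wpM2l.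
- exists (Num.max r r') => x xr.
  rewrite fr ?gr ?mulr0 ?addr0// => h; apply: xr; apply: sball_homo h.
  + by rewrite le_max lexx orbT.
  + by rewrite le_max lexx.
Qed.

Lemma bcs_indic f (A : set Rn) : bcs f -> measurable A ->
  bcs (fun x => f x * \1_A x).
Proof.
move=> [mf [M fM] [r fr]] mA; split.
- by apply: measurable_funM => //; exact: measurable_indic.
- exists M => x; rewrite normrM indicE; case: (x \in A).
    by rewrite normr1 mulr1.
  by rewrite normr0 mulr0; exact: le_trans (fM x).
- by exists r => x /fr ->; rewrite mul0r.
Qed.

Lemma bcs_cst_indic (a r : R) (A : set Rn) : measurable A ->
  A `<=` sball (fun=> 0) r -> bcs (fun x => a * \1_A x).
Proof.
move=> mA Ar; split.
- by apply: measurable_funM => //; exact: measurable_indic.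
- exists `|a| => x; rewrite normrM indicE; case: (x \in A).
    by rewrite normr1 mulr1.
  by rewrite normr0 mulr0.
- exists r => x xr; rewrite indicE memNset ?mulr0// => Ax; apply: xr; exact: Ar.
Qed.

Lemma bcs0 : bcs (fun=> 0).
Proof.
split; first exact: measurable_cst.
- by exists 0 => x; rewrite normr0.
- by exists 0.
Qed.

Lemma bcs_sum (I : eqType) (s : seq I) (F : I -> Rn -> R) :
  (forall i, i \in s -> bcs (F i)) -> bcs (fun x => \sum_(i <- s) F i x).
Proof.
elim: s => [|i s IH] H.
  by under eq_fun do rewrite big_nil; exact: bcs0.
under eq_fun do rewrite big_cons -[F i _]mul1r.
apply: bcs_lin; first by apply: H; rewrite mem_head.
by apply: IH => j js; apply: H; rewrite in_cons js orbT.
Qed.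

Lemma sball_bounded (c : 'I_n -> R) (r : R) :
  exists r', sball c r `<=` sball (fun=> 0) r'.
Proof.
exists (r + \sum_i `|c i|) => x H i; rewrite subr0.
rewrite -(subrK (c i) (tnth x i)); apply: (le_lt_trans (ler_normD _ _)).
apply: ltr_leD (H i) _; rewrite (bigD1 i)//= lerDl.
exact: sumr_ge0.
Qed.

Lemma dcube_sball (u : 'I_n -> R) (L : R) p : dcube u L p `<=`
  sball (dcorner u L p) (dside L p).
Proof.
move=> x /= H i; have /andP[h1 h2] := H i.
by rewrite ger0_norm ?subr_ge0// ltrBlDl.
Qed.

Lemma bcs_pos_support f : bcs f ->
  exists2 r, 0 < r & forall x, ~ sball (fun=> 0) r x -> f x = 0.
Proof.
move=> [_ _ [r fr]]; exists (Num.max r 1); first by rewrite lt_max ltr01 orbT.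
by move=> x xr; apply: fr => h; apply: xr; apply: sball_homo h; rewrite le_max lexx.
Qed.

Lemma bcs_integrable f : bcs f -> mu.-integrable setT (EFin \o f).
Proof.
move=> bf; have [r r0 fr] := bcs_pos_support bf; case: bf => mf [M fM] _.
have mB : measurable (sball (fun=> 0) r : set Rn) by exact: measurable_sball.
have fE : EFin \o f = (EFin \o f) \_ (sball (fun=> 0) r).
  apply/funext => x; rewrite patchE /=; case: ifPn => //.
  by rewrite notin_setE => /fr ->.
rewrite fE -integrable_mkcond//.
apply: measurable_bounded_integrable => //.
- by apply: le_lt_trans (lebesgue_sball_le _ r0) _; rewrite ltry.
- exact: measurable_funTS.
- exists M; split; first exact: num_real.
  by move=> M' MM' x _; apply: (le_trans (fM x)); exact: ltW.
Qed.

Lemma bcs_norm f : bcs f -> bcs (fun x => `|f x|).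
Proof.
move=> [mf [M fM] [r fr]]; split.
- exact: measurableT_comp.
- by exists M => x; rewrite normr_id.
- by exists r => x /fr ->; rewrite normr0.
Qed.

Lemma bcs_sqr f : bcs f -> bcs (fun x => f x ^+ 2).
Proof.
move=> [mf [M fM] [r fr]]; split.
- exact: measurable_funX.
- exists (M ^+ 2) => x; rewrite normrX ler_pXn2r ?nnegrE//.
  exact: le_trans (fM x).
- by exists r => x /fr ->; rewrite expr0n.
Qed.

Lemma bcs_norm_fin f : bcs f -> exists2 i : R, 0 <= i &
  (\int[mu]_x (`|f x|)%:E)%E = i%:E.
Proof.
move=> /bcs_norm/bcs_integrable/integrable_fin_num => /(_ measurableT).
move=> /fineK e; exists (fine (\int[mu]_x (`|f x|)%:E)%E); last exact/esym.
by rewrite fine_ge0// integral_ge0// => x _; rewrite lee_fin.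
Qed.

(** A side [L >= max A 1] gives [A <= L ^+ n] because [n > 0]. A large root is needed for the mean
    of [|f|] on it to lie below a prescribed level. *)
Lemma bcs_root f (A : R) : (0 < n)%N -> bcs f -> exists u L,
  [/\ 0 < L, A <= L ^+ n & forall x, ~ dcube u L [::] x -> f x = 0].
Proof.
move=> n0 /bcs_pos_support[r r0 fr].
pose L := Num.max (2 * r) (Num.max A 1).
have L1 : 1 <= L by rewrite /L !le_max lexx !orbT.
have Lr : 2 * r <= L by rewrite /L le_max lexx.
have AL : A <= L by rewrite /L !le_max lexx orbT.
exists (fun=> - r), L; split.
- exact: lt_le_trans L1.
- apply: (le_trans AL); case: n n0 => // k _.
  by rewrite exprS ler_peMr ?exprn_ege1// (le_trans ler01).
- move=> x xr; apply: fr => H; apply: xr => i; have := H i.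
  rewrite subr0 ltr_norml /= /dside expr0 divr1 => /andP[h1 h2].
  by apply/andP; split; [exact: ltW|lra].
Qed.

End bounded_compactly_supported.

(** * Cubes of large average and the maximal function *)

Section maximal.
Context {R : realType} {n : nat}.
Local Notation Rn := (n.-tuple R).
Local Notation mu := (@lebesgue_tuple R n).
Local Notation dpath := (@dpath n).
Implicit Types f g : Rn -> R.

Section cz_cubes.
Variables (u : 'I_n -> R) (L : R) (f : Rn -> R) (lam : R).
Hypothesis L0 : 0 < L.
Hypothesis lam0 : 0 < lam.
Hypothesis bf : bcs f.
Hypothesis fL : (\int[mu]_x (`|f x|)%:E <= (lam * L ^+ n)%:E)%E.

Definition cz_bad : set dpath := [set p |
  (lam%:E * mu (dcube u L p) < \int[mu]_(x in dcube u L p) `|f x|%:E)%E].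

Lemma bcs_density : exists nu : {measure set Rn -> \bar R},
  forall A, nu A = (\int[mu]_(x in A) (`|f x|)%:E)%E.
Proof.
apply: density_measure => //; apply: measurableT_comp => //.
by case: bf.
Qed.

Lemma lebesgue_cz_bad : (mu (dcover u L cz_bad) <=
  (lam^-1)%:E * \int[mu]_x (`|f x|)%:E)%E.
Proof.
have [nu nuE] := bcs_density.
have il : 0 <= lam^-1 by rewrite invr_ge0 ltW.
apply: (@le_trans _ _ ((lam^-1)%:E * nu (dcover u L cz_bad))%E).
  apply: stopping_le => // p [/= pb _]; rewrite nuE.
  rewrite -[leLHS]mul1e -(@mulVf _ lam) ?gt_eqF// EFinM -muleA.
  by apply: lee_wpmul2l; rewrite ?lee_fin// ltW.
apply: lee_wpmul2l; first by rewrite lee_fin.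
rewrite -nuE; apply: le_measure; rewrite ?inE//; exact: measurable_dcover.
Qed.

Lemma cz_bad_root : ~ cz_bad [::].
Proof.
rewrite /cz_bad /= lebesgue_dcube// /dside expr0 divr1 -EFinM.
apply/negP; rewrite -leNgt; apply: le_trans fL.
apply: ge0_subset_integral => //; first exact: measurable_dcube.
by apply/measurable_EFinP; apply: measurableT_comp => //; case: bf.
Qed.

Lemma not_cz_bad p : ~ cz_bad p ->
  (\int[mu]_(x in dcube u L p) `|f x|%:E <= lam%:E * mu (dcube u L p))%E.
Proof. by move/negP; rewrite -leNgt. Qed.

(** The root is not bad, so a maximal bad cube has a parent; the parent is not bad and [2^n] times
    as large. *)
Lemma first_cz_bad_le p : first_bad cz_bad p ->
  (\int[mu]_(x in dcube u L p) `|f x|%:E <=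
   (2 ^+ n * lam)%:E * mu (dcube u L p))%E.
Proof.
case: p => [[] /cz_bad_root//|v p [_ fp]].
have np : ~ cz_bad p.
  move=> /(fp p (suffix_cons _ _)) /(congr1 size)/eqP /=.
  by rewrite eqn_leq ltnn andbF.
apply: (@le_trans _ _ (\int[mu]_(x in dcube u L p) `|f x|%:E)%E).
  apply: ge0_subset_integral => //; try exact: measurable_dcube.
    by apply/measurable_EFinP; apply: measurable_funTS; apply: measurableT_comp => //; case: bf.
  exact: dcube_cons.
apply: (le_trans (not_cz_bad np)).
by rewrite !lebesgue_dcube// -!EFinM lee_fin (dside_cons L v p) exprMn mulrA (mulrC lam).
Qed.

End cz_cubes.
End maximal.

Section maximal_function.
Context {R : realType} {n : nat}.
Hypothesis n_gt0 : (0 < n)%N.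
Local Notation Rn := (n.-tuple R).
Local Notation mu := (@lebesgue_tuple R n).
Local Notation dpath := (@dpath n).
Implicit Types f g : Rn -> R.

Lemma bcs_root_avg f (lam : R) : 0 < lam -> bcs f -> exists u L,
  [/\ 0 < L, (\int[mu]_x (`|f x|)%:E <= (lam * L ^+ n)%:E)%E &
      forall x, ~ dcube u L [::] x -> f x = 0].
Proof.
move=> lam0 bf; have [i i0 iE] := bcs_norm_fin bf.
have [u [L [L0 iL fu]]] := bcs_root (i / lam) n_gt0 bf.
exists u, L; split => //; rewrite iE lee_fin.
by move: iL; rewrite ler_pdivrMr// mulrC.
Qed.

Definition triple (u : 'I_n -> R) (L : R) (p : dpath) : set Rn :=
  cube [tuple dcorner u L p i - dside L p | i < n] (3 * dside L p).

Lemma triple_near (u : 'I_n -> R) (L : R) p q (x y : Rn) : 0 < L ->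
  suffix q p -> dcube u L p y ->
  (forall i, `|tnth x i - tnth y i| <= dside L p) -> triple u L q x.
Proof.
move=> L0 qp py xy; rewrite /triple cube_box => i.
have spq : dside L p <= dside L q.
  case/suffixP: qp => s ->; rewrite /dside size_cat exprD invfM mulrA.
  rewrite mulrAC ler_piMr//; first by rewrite ltW// divr_gt0// exprn_gt0.
  by rewrite invf_le1 ?exprn_gt0// exprn_ege1// ler1n.
have /andP[h1 h2] := dcube_suffix L0 qp py i.
have := le_trans (xy i) spq; rewrite ler_norml => /andP[h3 h4].
by apply/andP; split; lra.
Qed.

(* The exceptional set is the union of the triples of the maximal cubes with
   large average: a cube meeting a ball around a point outside of it, of size
   comparable to the radius, has average at most lam. *)
Lemma maximal_set f (lam : R) : bcs f -> 0 < lam -> exists Om : set Rn,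
  [/\ measurable Om,
     (mu Om <= (3 ^+ n / lam)%:E * \int[mu]_x (`|f x|)%:E)%E &
     forall x, ~ Om x -> forall r, 0 < r ->
      (\int[mu]_(y in sball (tnth x) r) (`|f y|)%:E <=
       (6 ^+ n * lam * r ^+ n)%:E)%E].
Proof.
move=> bf lam0; have [u [L [L0 fL fu]]] := bcs_root_avg lam0 bf.
pose bad := cz_bad u L f lam.
have mT p : measurable (triple u L p) by exact: measurable_cube.
have muT p : (mu (triple u L p) <= (3 ^+ n)%:E * mu (dcube u L p))%E.
  rewrite /triple lebesgue_cube; last by rewrite mulr_ge0// ltW// dside_gt0.
  by rewrite lebesgue_dcube// -EFinM exprMn.
exists (\bigcup_(p in first_bad bad) triple u L p); split.
- exact: measurable_bigcupI.
- apply: (@le_trans _ _ ((3 ^+ n)%:E * mu (\bigcup_(p in first_bad bad) dcube u L p))%E).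
    apply: measure_bigcup_le => //.
    + by move=> p _; exact: measurable_dcube.
    + exact: trivIset_first_bad.
    + by move=> p _; exact: muT.
  rewrite bigcup_first_bad// EFinM -muleA; apply: lee_wpmul2l => //.
  exact: lebesgue_cz_bad.
move=> x Omx r r0.
have [nu nuE] := bcs_density bf.
have mB : measurable (sball (tnth x) r : set Rn) by exact: measurable_sball.
have le6 : lam * r ^+ n <= 6 ^+ n * lam * r ^+ n.
  by rewrite -mulrA ler_peMl ?mulr_ge0 ?exprn_ge0 ?exprn_ege1 ?ler1n ?(ltW r0) ?(ltW lam0).
have mf : measurable_fun setT (fun y => `|f y|%:E).
  by apply/measurable_EFinP; apply: measurableT_comp => //; case: bf.
have [Lr|rL] := leP L r.
  apply: (@le_trans _ _ (\int[mu]_y (`|f y|)%:E)%E).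
    exact: ge0_subset_integral.
  apply: (le_trans fL); rewrite lee_fin; apply: le_trans le6.
  by rewrite ler_pM2l// ler_pXn2r ?nnegrE ?(ltW L0) ?(ltW r0).
(* The scale at which cubes have side between [r] and [2 r]: one less than the first depth with side
   below [r]. *)
have [k [rk kr]] : exists k, r <= L / 2 ^+ k /\ L / 2 ^+ k < 2 * r.
  have ex : exists k, L / 2 ^+ k < r by exact: dside_small.
  case: (ex_minnP ex) => -[|k] H1 H2.
    by move: H1; rewrite expr0 divr1 ltNge (ltW rL).
  exists k; split; first by rewrite leNgt; apply/negP => /H2; rewrite ltnn.
  by move: H1; rewrite exprSr invfM mulrA ltr_pdivrMr// (mulrC r).
pose S : set dpath :=
  [set p | size p = k /\ exists2 y, dcube u L p y & sball (tnth x) r y].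
have sS p : S p -> dside L p = L / 2 ^+ k by move=> [sp _]; rewrite /dside sp.
have nubad p : S p -> ~ bad p.
  move=> Sp bp; have [q qp fq] := first_bad_exists bp.
  case: (Sp) => _ [y py xy]; apply: Omx; exists q => //.
  apply: (triple_near L0 qp py) => i; rewrite sS// distrC.
  exact: le_trans (ltW (xy i)) rk.
have mS : measurable (dcover u L S) by exact: measurable_dcover.
have h1 : (nu (dcover u L S) <= lam%:E * mu (dcover u L S))%E.
  apply: stopping_le => //; first exact: ltW.
  by move=> p [/nubad np _]; rewrite nuE; exact: not_cz_bad.
(* The cubes of [S] have side below [2 r] and meet the ball, so they lie in the ball of radius
   [3 r], of volume at most [(6 r)^n]. *)
have h2 : (mu (dcover u L S) <= ((6 * r) ^+ n)%:E)%E.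
  have r3 : 0 < 3 * r by rewrite mulr_gt0.
  apply: (@le_trans _ _ (mu (sball (tnth x) (3 * r) : set Rn))).
    apply: mu_le => //; first exact: measurable_sball.
    move=> y [p Sp py] i; have [_ [z pz xz]] := Sp.
    have := dcube_dist i py pz; have := xz i; rewrite sS//.
    rewrite !ltr_norml => /andP[a1 a2] /andP[a3 a4].
    move: a1 a2 a3 a4 kr; move: (L / _) => l *.
    by apply/andP; split; lra.
  apply: (le_trans (lebesgue_sball_le _ r3)).
  by rewrite mulrA (_ : 2 * 3 = 6 :> R)// -natrM.
rewrite -nuE; apply: (@le_trans _ _ (nu (dcover u L S `|` ~` dcube u L [::]))).
  apply: le_measure; rewrite ?inE//.
    by apply: measurableU => //; apply: measurableC; exact: measurable_dcube.
  move=> y yr; have [ry|] := pselect (dcube u L [::] y); last by right.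
  have [p [sp py]] := dcube_depth L0 k ry.
  by left; exists p => //; split => //; exists y.
have nu0 : nu (~` dcube u L [::]) = 0%E.
  by rewrite nuE integral0_eq// => y /fu ->; rewrite normr0.
apply: (le_trans (measureU2 _ _ _)) => //.
  by apply: measurableC; exact: measurable_dcube.
apply: (@le_trans _ _ (nu (dcover u L S) + 0)%E).
  by apply: leeD => //; move/eqP: nu0; rewrite eq_le => /andP[].
rewrite adde0; apply: (le_trans h1); apply: (le_trans (lee_wpmul2l _ h2)).
  by rewrite lee_fin ltW.
by rewrite -EFinM lee_fin exprMn mulrA (mulrC lam).
Qed.

End maximal_function.

(** * Real-valued singular integrals *)

Section real_cz.
Context {R : realType} {n : nat}.
Local Notation Rn := (n.-tuple R).
Local Notation mu := (@lebesgue_tuple R n).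
Implicit Types f g b : Rn -> R.

(* The real-valued shape in which the hypothesis on T is used: Re T and Im T,
   restricted to real bounded compactly supported functions, satisfy it.
   Distances are measured by the sup norm. *)
Record real_cz (U : (Rn -> R) -> Rn -> R) (k : Rn -> Rn -> R) (C kap del : R) :
  Prop := RealCZ {
  cz_C : 0 <= C;
  cz_del : 0 < del;
  cz_kap : 2 <= kap;
  cz_meas : forall f, bcs f -> measurable_fun setT (U f);
  cz_lin : forall a f g, bcs f -> bcs g ->
    {ae mu, forall x, U (fun y => a * f y + g y) x = a * U f x + U g x};
  cz_L2 : forall f, bcs f ->
    (\int[mu]_x ((U f x) ^+ 2)%:E <= C%:E * \int[mu]_x ((f x) ^+ 2)%:E)%E;
  cz_rep : forall f, bcs f ->
    {ae mu, forall x, (exists2 r, 0 < r & forall y, sball (tnth x) r y -> f y = 0) ->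
      mu.-integrable setT (EFin \o (fun y => k x y * f y)) /\
      U f x = \int[mu]_y (k x y * f y)};
  cz_reg : forall (x x' y : Rn) rho r, 0 < rho ->
    (forall i, `|tnth x i - tnth x' i| <= rho) -> kap * rho <= r ->
    ~ sball (tnth x) r y ->
    `|k x y - k x' y| <= C * ((kap * rho / r) `^ del / r ^+ n) /\
    `|k y x - k y x'| <= C * ((kap * rho / r) `^ del / r ^+ n) }.

Variables (U : (Rn -> R) -> Rn -> R) (k : Rn -> Rn -> R) (C kap del : R).
Hypothesis UT : real_cz U k C kap del.

Lemma measurable_fun_EFin_norm (A : set Rn) f : measurable_fun setT f ->
  measurable_fun A (fun x => `|f x|%:E).
Proof.
move=> mf; apply/measurable_EFinP; apply: measurable_funTS.
exact: measurableT_comp.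
Qed.

(** Since [b] has mean zero, [k x cp] may be subtracted from the kernel, [cp] being the corner of
    the cube, and smoothness in the second variable gives decay in the distance of [x]. One factor
    [2^n] is the volume of a ball over [r^n], the other comes from the sum over annuli. *)
Lemma cz_far b (u : 'I_n -> R) (L : R) p : 0 < L -> bcs b ->
  (forall y, ~ dcube u L p y -> b y = 0) -> \int[mu]_y b y = 0 ->
  (\int[mu]_(x in ~` sball (dcorner u L p) (kap * dside L p)) `|U b x|%:E <=
   (C * 2 ^+ n * 2 ^+ n / (1 - 2^-1 `^ del))%:E * \int[mu]_x `|b x|%:E)%E.
Proof.
move=> L0 bb bp b0; have [i i0 iE] := bcs_norm_fin bb.
set c := dcorner u L p; set s := dside L p; have s0 : 0 < s by exact: dside_gt0.
have k0 : 0 < kap by exact: lt_le_trans (cz_kap UT).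
have r00 : 0 < kap * s by rewrite mulr_gt0.
have mB r : measurable (sball c r : set Rn) by exact: measurable_sball.
have mUb := cz_meas UT bb; have C0 := cz_C UT.
have d01 : 0 < 1 - 2^-1 `^ del by rewrite subr_gt0 half_powR_lt1// (cz_del UT).
rewrite iE -EFinM.
pose phi x := `|U b x| * \1_(~` sball c (kap * s)) x.
have phiE : (\int[mu]_(x in ~` sball c (kap * s)) `|U b x|%:E =
    \int[mu]_x (phi x)%:E)%E.
  rewrite integral_mkcond; apply: eq_integral => x _.
  by rewrite patchE /phi indicE; case: (_ \in _); rewrite ?mulr1 ?mulr0.
rewrite phiE; apply: (@le_trans _ _
    ((C * i * 2 ^+ n * 2 ^+ n / (1 - 2^-1 `^ del))%:E)); last first.
  by rewrite lee_fin le_eqVlt; apply/orP; left; apply/eqP; ring.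
apply: (@annulus_integral R n phi (fun=> 1) c (kap * s)) => //.
- apply: measurable_funM; first exact: measurableT_comp.
  by apply: measurable_indic; exact: measurableC.
- by move=> y; rewrite mulr_ge0.
- exact: cz_del UT.
- by rewrite mulr_ge0.
- apply: filterS (cz_rep UT bb) => x Hrep; split.
    by move=> xB; rewrite /phi indicE memNset ?mulr0//; apply.
  move=> r rr xr; have r0 : 0 < r by exact: lt_le_trans rr.
  have xB : ~ sball c (kap * s) x by move=> h; apply: xr; exact: sball_homo h.
  rewrite /phi indicE mem_set// !mulr1.
  (* The representation at [x] needs [b] to vanish near [x]. As [kap >= 2], outside of the ball of
     radius [kap * s] about the corner the ball of radius [s] about [x] misses the cube. *)
  have far : exists2 t, 0 < t & forall y, sball (tnth x) t y -> b y = 0.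
    exists s => // y xy; apply: bp => py; apply: xB => j.
    have := dcube_sball py j; have := xy j; rewrite -/c -/s.
    have k2 : 2 * s <= kap * s by rewrite ler_pM2r// (cz_kap UT).
    rewrite !ltr_norml => /andP[a1 a2] /andP[a3 a4].
    by apply/andP; split; lra.
  have [ikb ->] := Hrep far.
  pose cp : Rn := [tuple c j | j < n].
  have ib : mu.-integrable setT (EFin \o b) by exact: bcs_integrable.
  have icb : mu.-integrable setT (EFin \o (fun y => k x cp * b y)).
    exact: (integrableZl measurableT (k x cp) ib).
  have -> : \int[mu]_y (k x y * b y) = \int[mu]_y (k x y * b y - k x cp * b y).
    by rewrite RintegralB// RintegralZl// b0 mulr0 subr0.
  have ikcb : mu.-integrable setT (EFin \o (fun y => k x y * b y - k x cp * b y)).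
    exact: (integrableB measurableT ikb icb).
  apply: (le_trans (le_normr_Rintegral measurableT ikcb)).
  have inb : mu.-integrable setT (EFin \o (fun y => `|b y|)).
    exact/bcs_integrable/bcs_norm.
  set B := C * ((kap * s / r) `^ del / r ^+ n).
  have iBb : mu.-integrable setT (EFin \o (fun y => B * `|b y|)).
    exact: (integrableZl measurableT B inb).
  apply: (@le_trans _ _ (\int[mu]_y (B * `|b y|))).
    apply: le_Rintegral => //; first exact: integrable_norm.
    move=> y _; rewrite -mulrBl normrM.
    have [py|/bp ->] := pselect (dcube u L p y); last by rewrite normr0 !mulr0.
    apply: ler_wpM2r => //; rewrite distrC.
    have [] // := @cz_reg _ _ _ _ _ UT cp y x s r s0.
      move=> j; rewrite tnth_mktuple distrC.
      exact: ltW (dcube_sball py j).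
    by rewrite (_ : tnth cp = c)//; apply/funext => j; rewrite tnth_mktuple.
  rewrite RintegralZl// /Rintegral iE /=.
  by rewrite le_eqVlt; apply/orP; left; apply/eqP; rewrite /B; ring.
- move=> r rr; have r0 : 0 < r by exact: lt_le_trans rr.
  rewrite integral_cst// mul1e -exprMn; exact: lebesgue_sball_le.
Qed.

End real_cz.

(** * Finite enumerations of cubes and tools for integrals *)

Section finite_depth.
Context {n : nat}.
Local Notation dpath := (@dpath n).

Lemma dpath_enum N : exists s : seq dpath,
  uniq s /\ forall p, (p \in s) = (size p <= N)%N.
Proof.
pose t := [seq [seq tval w | w : k.-tuple {ffun 'I_n -> bool}] | k <- iota 0 N.+1].
exists (undup (flatten t)); split; first exact: undup_uniq.
move=> p; rewrite mem_undup; apply/flattenP/idP => [[_ /mapP[k + ->] /mapP[w _ ->]]|pN].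
  by rewrite mem_iota size_tuple /= add0n ltnS.
exists [seq tval w | w : (size p).-tuple {ffun 'I_n -> bool}].
  by apply/mapP; exists (size p) => //; rewrite mem_iota /= add0n ltnS.
by apply/mapP; exists (in_tuple p) => //; rewrite mem_enum.
Qed.

Lemma dpath_enum_set N (D : set dpath) : exists s : seq dpath,
  uniq s /\ forall p, (p \in s) <-> D p /\ (size p <= N)%N.
Proof.
have [s [us sN]] := dpath_enum N.
exists [seq p <- s | p \in D]; split; first exact: filter_uniq.
move=> p; rewrite mem_filter sN; split => [/andP[]|[Dp ->]].
  by rewrite inE.
by rewrite mem_set.
Qed.

End finite_depth.

Section integral_tools.
Context {R : realType} {n : nat}.
Local Notation Rn := (n.-tuple R).
Local Notation mu := (@lebesgue_tuple R n).

Lemma integral_mul_indic (f : Rn -> R) (D : set Rn) :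
  (\int[mu]_(x in D) (f x)%:E = \int[mu]_x (f x * \1_D x)%:E)%E.
Proof.
rewrite integral_mkcond; apply: eq_integral => x _.
by rewrite patchE indicE; case: (_ \in _); rewrite ?mulr1 ?mulr0.
Qed.

Lemma integrable_const (D : set Rn) (a : R) : measurable D -> (mu D < +oo)%E ->
  mu.-integrable D (EFin \o (fun=> a)).
Proof.
move=> mD Dfin; apply: measurable_bounded_integrable => //.
exists `|a|; split; first exact: num_real.
by move=> M aM x _; exact: ltW.
Qed.

Lemma mu_le_ae (A B : set Rn) : measurable A -> measurable B ->
  {ae mu, forall x, A x -> B x} -> (mu A <= mu B)%E.
Proof.
move=> mA mB [N [mN N0 AB]].
rewrite -[leRHS]adde0 -N0; apply: le_trans (measureU2 _ mB mN).
apply: mu_le => //; first exact: measurableU.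
move=> x Ax; have [Bx|nBx] := pselect (B x); first by left.
by right; apply: AB => /= H; apply: nBx; exact: H.
Qed.

Lemma chebyshev_le (h : Rn -> R) (a : R) : 0 < a -> measurable_fun setT h ->
  (forall x, 0 <= h x) ->
  (mu [set x | (a < h x)%R] <= (a^-1)%:E * \int[mu]_x (h x)%:E)%E.
Proof.
move=> a0 mh h0; have mA : measurable [set x | a < h x] by exact: measurable_gt.
have ai : 0 <= a^-1 by rewrite invr_ge0 ltW.
rewrite -[leLHS]mul1e -(@mulVf _ a) ?gt_eqF// EFinM -muleA.
apply: lee_wpmul2l; rewrite ?lee_fin// -integral_cst//.
have mhE (D : set Rn) : measurable_fun D (fun x => (h x)%:E).
  by apply/measurable_EFinP; exact: measurable_funTS.
apply: (@le_trans _ _ (\int[mu]_(x in [set x | (a < h x)%R]) (h x)%:E)%E).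
  apply: ge0_le_integral => //=.
  - by move=> x _; rewrite lee_fin ltW.
  - by move=> x; rewrite lee_fin => /ltW.
apply: ge0_subset_integral => //.
by move=> x _; rewrite lee_fin.
Qed.

Lemma sum_integral_le (I : eqType) (s : seq I) (F : I -> set Rn) (f : Rn -> R) :
  uniq s -> (forall i, measurable (F i)) -> trivIset [set` s] F ->
  measurable_fun setT f -> (forall x, 0 <= f x) ->
  (\sum_(i <- s) \int[mu]_(x in F i) (f x)%:E <= \int[mu]_x (f x)%:E)%E.
Proof.
move=> us mF tF mf f0; rewrite -ge0_integral_bigsetU//.
- apply: ge0_subset_integral => //; first exact: bigsetU_measurable.
    exact/measurable_EFinP.
  by move=> x _; rewrite lee_fin.
- by apply/measurable_EFinP; exact: measurable_funTS.
- by move=> x _; rewrite lee_fin.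
Qed.

End integral_tools.

(** * The Calderon-Zygmund decomposition *)

Section calderon_zygmund_decomposition.
Context {R : realType} {n : nat}.
Local Notation Rn := (n.-tuple R).
Local Notation mu := (@lebesgue_tuple R n).
Local Notation dpath := (@dpath n).
Variables (u : 'I_n -> R) (L : R) (f : Rn -> R) (lam : R).
Hypothesis L0 : 0 < L.
Hypothesis lam0 : 0 < lam.
Hypothesis bf : bcs f.
Hypothesis fL : (\int[mu]_x (`|f x|)%:E <= (lam * L ^+ n)%:E)%E.
Hypothesis fu : forall x, ~ dcube u L [::] x -> f x = 0.

Local Notation bad := (cz_bad u L f lam).

Definition cz_avg (p : dpath) : R :=
  (\int[mu]_(x in dcube u L p) f x) / (dside L p) ^+ n.

Definition cz_b (p : dpath) (x : Rn) : R := (f x - cz_avg p) * \1_(dcube u L p) x.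

Let side_n (p : dpath) : 0 < (dside L p) ^+ n.
Proof. by rewrite exprn_gt0// dside_gt0. Qed.

Lemma cz_b_bcs p : bcs (cz_b p).
Proof.
have [r pr] := sball_bounded (dcorner u L p) (dside L p).
have mp : measurable (dcube u L p) by exact: measurable_dcube.
have -> : cz_b p = fun x => 1 * (f x * \1_(dcube u L p) x) +
    (- cz_avg p) * \1_(dcube u L p) x.
  by apply/funext => x; rewrite /cz_b mul1r mulrBl mulNr.
apply: bcs_lin; first exact: bcs_indic.
by apply: (@bcs_cst_indic _ _ _ r) => //; apply: subset_trans pr; exact: dcube_sball.
Qed.

Lemma cz_b_out p x : ~ dcube u L p x -> cz_b p x = 0.
Proof. by move=> px; rewrite /cz_b indicE memNset ?mulr0. Qed.

Lemma cz_b_in p x : dcube u L p x -> cz_b p x = f x - cz_avg p.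
Proof. by move=> px; rewrite /cz_b indicE mem_set ?mulr1. Qed.

Let integrable_f (D : set Rn) : measurable D -> mu.-integrable D (EFin \o f).
Proof. by move=> mD; apply: integrableS (bcs_integrable bf). Qed.

Lemma cz_b_mean p : \int[mu]_x cz_b p x = 0.
Proof.
have mp : measurable (dcube u L p) by exact: measurable_dcube.
rewrite /Rintegral /cz_b -integral_mul_indic.
have fin : (mu (dcube u L p) < +oo)%E by rewrite lebesgue_dcube// ltry.
change (\int[mu]_(x in dcube u L p) (f x - cz_avg p) = 0).
rewrite RintegralB//; last exact: integrable_const.
  rewrite Rintegral_cst//= lebesgue_dcube//= /cz_avg divfK ?subrr//.
  by rewrite gt_eqF.
exact: integrable_f.
Qed.

Lemma cz_avg_le p : ((`|cz_avg p| * (dside L p) ^+ n)%:E <=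
  \int[mu]_(x in dcube u L p) `|f x|%:E)%E.
Proof.
have mp : measurable (dcube u L p) by exact: measurable_dcube.
rewrite /cz_avg normrM normfV (gtr0_norm (side_n p)) divfK ?gt_eqF//.
have h := le_normr_Rintegral mp (integrable_f mp).
apply: (@le_trans _ _ (\int[mu]_(x in dcube u L p) `|f x|)%:E).
  by rewrite lee_fin.
rewrite /Rintegral fineK//.
exact: (integrable_fin_num mp (integrable_norm (integrable_f mp))).
Qed.

Lemma cz_b_norm p : (\int[mu]_x `|cz_b p x|%:E <=
  2%:E * \int[mu]_(x in dcube u L p) `|f x|%:E)%E.
Proof.
have mp : measurable (dcube u L p) by exact: measurable_dcube.
have mf : measurable_fun (dcube u L p) (fun x => `|f x|%:E).
  by apply: measurable_fun_EFin_norm; case: bf.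
have -> : (\int[mu]_x `|cz_b p x|%:E =
    \int[mu]_(x in dcube u L p) `|f x - cz_avg p|%:E)%E.
  rewrite [RHS]integral_mul_indic; apply: eq_integral => x _.
  by rewrite /cz_b normrM indicE (ger0_norm (ler0n _ _)).
apply: (@le_trans _ _ (\int[mu]_(x in dcube u L p) (`|f x|%:E + `|cz_avg p|%:E))%E).
  apply: ge0_le_integral => //.
  - apply/measurable_EFinP; apply: measurableT_comp => //.
    by apply: measurable_funB => //; apply: measurable_funTS; case: bf.
  - by apply: emeasurable_funD.
  - by move=> x _; rewrite -EFinD lee_fin ler_normB.
rewrite ge0_integralD// integral_cst//= lebesgue_dcube//.
rewrite -EFinM (_ : 2%:E = 1 + 1)%E// ge0_muleDl// !mul1e.
by apply: leeD => //; exact: cz_avg_le.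
Qed.

(* Only the selected cubes of bounded depth are used, so that all sums are
   finite; the mass of the remaining ones is absorbed in [e]. *)
Lemma cz_good_part (e : R) : 0 < e -> exists s : seq dpath,
  [/\ uniq s, forall p, p \in s -> first_bad bad p &
   (\int[mu]_x ((f x - \sum_(p <- s) cz_b p x) ^+ 2)%:E <=
    ((2 ^+ n + 1) * lam)%:E * \int[mu]_x `|f x|%:E + e%:E)%E].
Proof.
move=> e0; have [mf [M fM] _] := bf.
have M0 : 0 <= M by exact: le_trans (fM [tuple 0 | i < n]).
(* On the selected cubes deeper than [N] the function is kept, with [f^2 <= M^2], so their measure
   is made at most [e / (M^2 + 1)]. *)
have e1 : 0 < e / (M ^+ 2 + 1) by rewrite divr_gt0// ltr_wpDl// exprn_ge0.
pose D N : set dpath := [set p | first_bad bad p /\ (size p <= N)%N].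
pose Om := dcover u L bad.
have mOm : measurable Om by exact: measurable_dcover.
have OmE : \bigcup_N dcover u L (D N) = Om.
  apply/seteqP; split => [x [N _ [p [fp _] px]]|x].
    by exists p => //; exact: first_bad_sub fp.
  rewrite /Om /dcover -bigcup_first_bad// => -[p fp px].
  by exists (size p) => //; exists p.
have OmFin : (mu Om < +oo)%E.
  apply: le_lt_trans (lebesgue_root_fin u L0).
  by apply: mu_le => //; [exact: measurable_dcube|exact: dcover_root].
have [N HN] : exists N, (mu (Om `\` dcover u L (D N)) <= (e / (M ^+ 2 + 1))%:E)%E.
  have mD N : measurable (dcover u L (D N)) by exact: measurable_dcover.
  have : mu (Om `\` dcover u L (D N)) @[N --> \oo] -->
      mu (\bigcap_N (Om `\` dcover u L (D N))).
    apply: nonincreasing_cvg_mu => //.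
    - apply: le_lt_trans OmFin; apply: mu_le => //; exact: measurableD.
    - by move=> N; exact: measurableD.
    - by apply: bigcapT_measurable => N; exact: measurableD.
    - apply/nonincreasing_seqP => N; apply/subsetPset => x [Ox nx].
      split => // -[p [fp pN] px]; apply: nx; exists p => //; split => //.
      exact: leqW.
  rewrite (_ : \bigcap_N _ = set0) ?measure0; last first.
    apply/seteqP; split => // x H; have [+ _] := H 0%N I.
    rewrite -OmE => -[N _ xN]; have [_] := H N I; exact.
  move=> /fine_cvgP[[N1 _ H1] /cvgrPdist_le /(_ _ e1)[N2 _ H2]].
  exists (maxn N1 N2).
  have := H1 (maxn N1 N2) (leq_maxl _ _); have := H2 (maxn N1 N2) (leq_maxr _ _).
  rewrite /= sub0r normrN => h2 h1; rewrite -(fineK h1) lee_fin.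
  by apply: le_trans h2; exact: ler_norm.
have [s [us sD]] := dpath_enum_set N (first_bad bad).
exists s; split => // [p /sD[]//|].
have tS : trivIset [set` s] (dcube u L).
  move=> p q /= /sD[fp _] /sD[fq _]; exact: (@trivIset_first_bad _ _ u L L0 bad).
have mp p : measurable (dcube u L p) by exact: measurable_dcube.
pose W := Om `\` dcover u L (D N).
have mW : measurable W by apply: measurableD => //; exact: measurable_dcover.
have diff : {ae mu, forall x, (dcube u L [::] `\` Om) x -> `|f x| <= lam}.
  apply: (@dyadic_differentiation _ _ u L L0) => //.
  - exact: measurableT_comp.
  - exact: ltW.
  - exact: measurableD.
  - by move=> p x [_ nO] px; apply: not_cz_bad => bp; apply: nO; exists p.
(* Majorant of the square of the good part: [h1] on the cubes of [s], where the good part is a mean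
   of size at most [2^n lam]; [M^2] on the deeper cubes [W]; [lam |f|] elsewhere, where [|f| <= lam]
   almost everywhere. *)
pose h1 x := \sum_(p <- s) (2 ^+ n * lam * `|cz_avg p|) * \1_(dcube u L p) x.
have h10 x : 0 <= h1 x.
  by apply: sumr_ge0 => p _; rewrite !mulr_ge0// ?exprn_ge0// ltW.
have mh1p p : measurable_fun setT (fun x => (2 ^+ n * lam * `|cz_avg p|) * \1_(dcube u L p) x : R).
  by apply: measurable_funM => //; exact: measurable_indic.
have mh1 : measurable_fun setT h1 by exact: measurable_sum.
have mWi : measurable_fun setT (\1_W : Rn -> R) by exact: measurable_indic.
apply: (@le_trans _ _ (\int[mu]_x ((h1 x)%:E + ((M ^+ 2 * \1_W x)%:E + (lam * `|f x|)%:E)))%E).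
  apply: ae_ge0_le_integral => //.
  - by move=> x _; rewrite lee_fin sqr_ge0.
  - apply/measurable_EFinP; apply: measurable_funX; apply: measurable_funB => //.
    by apply: measurable_sum => p; have [] := cz_b_bcs p.
  - by move=> x _; rewrite -!EFinD lee_fin !addr_ge0// ?mulr_ge0 ?sqr_ge0// ltW.
  - apply/measurable_EFinP; apply: measurable_funD => //.
    apply: measurable_funD; apply: measurable_funM => //.
    exact: measurableT_comp.
  apply: filterS diff => x fx _; rewrite -!EFinD lee_fin.
  have lf0 : 0 <= lam * `|f x| by rewrite mulr_ge0// ltW.
  have MW0 : 0 <= M ^+ 2 * \1_W x by rewrite mulr_ge0// sqr_ge0.
  have [[p ps px]|np] := pselect (exists2 p, p \in s & dcube u L p x).
    have oth q : q \in s -> q != p -> ~ dcube u L q x.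
      by move=> qs /eqP qp qx; apply: qp; apply: tS => //; exists x.
    have -> : \sum_(q <- s) cz_b q x = f x - cz_avg p.
      rewrite (bigD1_seq p)//= cz_b_in// big_seq_cond big1 ?addr0// => q /andP[qs qp].
      by apply: cz_b_out; exact: oth.
    rewrite subKr.
    apply: (@le_trans _ _ (h1 x)); last by rewrite lerDl addr_ge0.
    rewrite /h1 (bigD1_seq p)//= indicE mem_set// mulr1.
    apply: ler_wpDr.
      by apply: sumr_ge0 => q _; rewrite !mulr_ge0// ?exprn_ge0// ltW.
    rewrite -[leLHS]real_normK ?num_real// expr2; apply: ler_wpM2r => //.
    have := le_trans (cz_avg_le p) (first_cz_bad_le L0 bf fL (proj1 ((sD p).1 ps))).
    by rewrite lebesgue_dcube// -EFinM lee_fin ler_pM2r// side_n.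
  have -> : \sum_(q <- s) cz_b q x = 0.
    rewrite big_seq big1// => q qs; apply: cz_b_out => qx; apply: np; by exists q.
  rewrite subr0; have [rx|/fu ->] := pselect (dcube u L [::] x); last first.
    by rewrite expr0n /= normr0 mulr0 addr0 addr_ge0.
  have [Ox|nOx] := pselect (Om x).
    apply: (@le_trans _ _ (M ^+ 2 * \1_W x)); last first.
      by rewrite addrCA lerDl addr_ge0.
    rewrite indicE mem_set ?mulr1; last first.
      split => // -[p [fp pN] px]; apply: np; exists p => //; exact/sD.
    by rewrite -real_normK ?num_real// ler_pXn2r ?nnegrE.
  apply: (@le_trans _ _ (lam * `|f x|)); last by rewrite addrA lerDr addr_ge0.
  rewrite -real_normK ?num_real// expr2 ler_wpM2r//; exact: fx.
have mfn : measurable_fun setT (fun x => `|f x|) by exact: measurableT_comp.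
rewrite ge0_integralD//; first last.
- by apply/measurable_EFinP; apply: measurable_funD; apply: measurable_funM.
- by move=> x _; rewrite -EFinD lee_fin addr_ge0// mulr_ge0 ?sqr_ge0// ltW.
- exact/measurable_EFinP.
- by move=> x _; rewrite lee_fin.
rewrite ge0_integralD//; first last.
- by apply/measurable_EFinP; apply: measurable_funM.
- by move=> x _; rewrite lee_fin mulr_ge0// ltW.
- by apply/measurable_EFinP; apply: measurable_funM.
- by move=> x _; rewrite lee_fin mulr_ge0// sqr_ge0.
have -> : (\int[mu]_x (lam * `|f x|)%:E = lam%:E * \int[mu]_x `|f x|%:E)%E.
  under eq_integral do rewrite EFinM.
  by rewrite ge0_integralZl_EFin ?ltW//; exact/measurable_EFinP.
have I0 : (0 <= \int[mu]_x `|f x|%:E)%E.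
  by apply: integral_ge0 => x _; rewrite lee_fin.
have hW : (\int[mu]_x (M ^+ 2 * \1_W x)%:E <= e%:E)%E.
  under eq_integral do rewrite EFinM.
  rewrite ge0_integralZl_EFin ?sqr_ge0//; last exact/measurable_EFinP.
  rewrite integral_indic// setIT.
  apply: (le_trans (lee_wpmul2l _ HN)); first by rewrite lee_fin sqr_ge0.
  rewrite -EFinM lee_fin mulrA ler_pdivrMr ?ltr_wpDl ?sqr_ge0//.
  by rewrite mulrDr mulr1 mulrC lerDl ltW.
have hh : (\int[mu]_x (h1 x)%:E <= (2 ^+ n * lam)%:E * \int[mu]_x `|f x|%:E)%E.
  rewrite (eq_integral (fun x => \sum_(p <- s) ((2 ^+ n * lam * `|cz_avg p|) *
      \1_(dcube u L p) x)%:E)); last by move=> x _; rewrite sumEFin.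
  have c0 p : 0 <= 2 ^+ n * lam * `|cz_avg p| by rewrite !mulr_ge0// ?exprn_ge0// ltW.
  rewrite ge0_integral_sum//; first last.
  - by move=> p x _; rewrite lee_fin mulr_ge0.
  - by move=> p; exact/measurable_EFinP.
  apply: (@le_trans _ _ ((2 ^+ n * lam)%:E *
      \sum_(p <- s) \int[mu]_(x in dcube u L p) `|f x|%:E)%E); last first.
    apply: lee_wpmul2l; first by rewrite lee_fin mulr_ge0 ?exprn_ge0// ltW.
    exact: sum_integral_le.
  rewrite ge0_sume_distrr; last first.
    by move=> p _; apply: integral_ge0 => x _; rewrite lee_fin.
  apply: lee_sum => p _.
  under eq_integral do rewrite EFinM.
  rewrite ge0_integralZl_EFin//; last exact/measurable_EFinP/measurable_indic.
  rewrite integral_indic// setIT /= lebesgue_dcube// -EFinM -(mulrA (2 ^+ n * lam)) EFinM.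
  apply: lee_wpmul2l; first by rewrite lee_fin mulr_ge0 ?exprn_ge0// ltW.
  exact: cz_avg_le.
rewrite mulrDl mul1r EFinD ge0_muleDl ?lee_fin ?mulr_ge0 ?exprn_ge0 ?(ltW lam0)//.
apply: (le_trans (leeD hh (leeD hW (lexx _)))).
by rewrite [X in (_ + X)%E]addeC addeA.
Qed.

End calderon_zygmund_decomposition.

(** * The weak (1,1) bound *)

Section weak_type.
Context {R : realType} {n : nat}.
Hypothesis n_gt0 : (0 < n)%N.
Local Notation Rn := (n.-tuple R).
Local Notation mu := (@lebesgue_tuple R n).
Local Notation dpath := (@dpath n).
Implicit Types f g b : Rn -> R.
Variables (U : (Rn -> R) -> Rn -> R) (k : Rn -> Rn -> R) (C kap del : R).
Hypothesis UT : real_cz U k C kap del.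

Lemma cz0 : {ae mu, forall x, U (fun=> 0) x = 0}.
Proof.
have b0 : @bcs R n (fun=> 0) by exact: bcs0.
apply: filterS (cz_lin UT 1 b0 b0) => x.
rewrite (_ : (fun=> 1 * 0 + 0) = (fun=> 0)); last first.
  by apply/funext => y; rewrite mulr0 addr0.
by rewrite mul1r => /eqP; rewrite -subr_eq0 opprD addNKr oppr_eq0 => /eqP.
Qed.

Lemma cz_sum (I : eqType) (s : seq I) (F : I -> Rn -> R) :
  (forall i, bcs (F i)) ->
  {ae mu, forall x, U (fun y => \sum_(i <- s) F i y) x = \sum_(i <- s) U (F i) x}.
Proof.
move=> bF; elim: s => [|i s IH].
  rewrite (_ : (fun y => \sum_(i <- [::]) F i y) = fun=> 0); last first.
    by apply/funext => y; rewrite big_nil.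
  by apply: filterS cz0 => x ->; rewrite big_nil.
have bs : bcs (fun y => \sum_(i <- s) F i y) by apply: bcs_sum => j _.
rewrite (_ : (fun y => \sum_(j <- i :: s) F j y) =
    fun y => 1 * F i y + \sum_(j <- s) F j y); last first.
  by apply/funext => y; rewrite big_cons mul1r.
by apply: filterS2 IH (cz_lin UT 1 (bF i) bs) => x Hs ->; rewrite Hs big_cons mul1r.
Qed.

Let H := C * 2 ^+ n * 2 ^+ n / (1 - 2^-1 `^ del).

Let H0 : 0 <= H.
Proof.
rewrite /H divr_ge0 ?mulr_ge0 ?exprn_ge0 ?(cz_C UT)//.
by rewrite subr_ge0 ltW// half_powR_lt1// (cz_del UT).
Qed.

Let far_part (u : 'I_n -> R) L f (s : seq dpath) : 0 < L -> bcs f -> uniq s ->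
  trivIset [set` s] (dcube u L) ->
  (\int[mu]_x (\sum_(p <- s) `|U (cz_b u L f p) x| *
     \1_(~` sball (dcorner u L p) (kap * dside L p)) x)%:E <=
   (2 * H)%:E * \int[mu]_x `|f x|%:E)%E.
Proof.
move=> L0 bf us tS.
have mB p : measurable (~` sball (dcorner u L p) (kap * dside L p) : set Rn).
  by apply: measurableC; exact: measurable_sball.
have mUb p : measurable_fun setT (U (cz_b u L f p)).
  by apply: (cz_meas UT); exact: cz_b_bcs.
under eq_integral do rewrite -sumEFin.
rewrite ge0_integral_sum//; first last.
- move=> p; apply/measurable_EFinP; apply: measurable_funM.
    exact: measurableT_comp.
  exact: measurable_indic.
apply: (@le_trans _ _ ((2 * H)%:E *
    \sum_(p <- s) \int[mu]_(x in dcube u L p) `|f x|%:E)%E); last first.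
  apply: lee_wpmul2l; first by rewrite lee_fin mulr_ge0.
  apply: sum_integral_le => //; first by move=> p; exact: measurable_dcube.
  by have [mf _ _] := bf; exact: measurableT_comp.
rewrite ge0_sume_distrr; last first.
  by move=> p _; apply: integral_ge0 => x _; rewrite lee_fin.
apply: lee_sum => p _; rewrite -integral_mul_indic.
have := @cz_far _ _ _ _ _ _ _ UT (cz_b u L f p) u L p L0 (cz_b_bcs u L bf p).
move=> /(_ (@cz_b_out _ _ u L f p) (cz_b_mean u L0 bf p)) /le_trans; apply.
rewrite (mulrC 2 H) (EFinM H 2) -(muleA H%:E); apply: lee_wpmul2l; first by rewrite lee_fin.
exact: cz_b_norm.
Qed.

(** With [f = g + sum b p], the part [g] is handled by the L^2 bound and Chebyshev ([E1]), the balls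
    around the cubes are exceptional ([E2]), and off them the sum of the [U (b p)] is controlled in
    L^1 by [cz_far] ([E3]). *)
Theorem weak_type : exists2 A, 0 < A & forall f lam, bcs f -> 0 < lam ->
  (mu [set x | (lam < `|U f x|)%R] <= (A / lam)%:E * \int[mu]_x `|f x|%:E)%E.
Proof.
have C0 := cz_C UT; have k2 := cz_kap UT.
have k0 : 0 < kap by exact: lt_le_trans k2.
(* The factor 4 is from Chebyshev at the level [lam / 2] squared; it multiplies the L^2 constant and
   that of the good part. *)
pose A1 := 4 * C * (2 ^+ n + 1).
have A10 : 0 <= A1 by rewrite !mulr_ge0// addr_ge0// exprn_ge0.
have k20 : 0 <= (2 * kap) ^+ n by rewrite exprn_ge0// mulr_ge0// ltW.
exists (A1 + (2 * kap) ^+ n + 4 * H + 1).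
  by rewrite ltr_wpDl// !addr_ge0// mulr_ge0.
move=> f lam bf lam0; have [u [L [L0 fL fu]]] := bcs_root_avg n_gt0 lam0 bf.
have [i i0 iE] := bcs_norm_fin bf.
have mUf : measurable_fun setT (U f) by exact: (cz_meas UT).
have il : 0 <= lam^-1 by rewrite invr_ge0 ltW.
apply/lee_addgt0Pr => d d0.
(* Chosen for [4 C e / lam^2 <= d]: the price of selecting only finitely many cubes is the arbitrary
   [d]. *)
pose e := d * lam ^+ 2 / (4 * (C + 1)).
have C1 : 0 < 4 * (C + 1) by rewrite mulr_gt0// ltr_wpDl.
have e0 : 0 < e by rewrite /e divr_gt0// mulr_gt0// exprn_gt0.
have [s [us sb gle]] := cz_good_part L0 lam0 bf fL fu e0.
have tS : trivIset [set` s] (dcube u L).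
  move=> p q /= /sb fp /sb fq; exact: (@trivIset_first_bad _ _ u L L0 _ p q fp fq).
pose b p := cz_b u L f p.
have bb p : bcs (b p) by exact: cz_b_bcs.
have bsum : bcs (fun x => \sum_(p <- s) b p x) by apply: bcs_sum => p _.
pose g x := f x - \sum_(p <- s) b p x.
have bg : bcs g.
  have -> : g = fun x => (-1) * \sum_(p <- s) b p x + f x.
    by apply/funext => x; rewrite /g mulN1r addrC.
  exact: bcs_lin.
have mUg := cz_meas UT bg.
pose B p : set Rn := sball (dcorner u L p) (kap * dside L p).
have mB p : measurable (B p) by exact: measurable_sball.
pose h x := \sum_(p <- s) `|U (b p) x| * \1_(~` B p) x.
have mh : measurable_fun setT h.
  apply: measurable_sum => p; apply: measurable_funM.
    by apply: measurableT_comp => //; exact: (cz_meas UT).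
  by apply: measurable_indic; exact: measurableC.
have h0 x : 0 <= h x by apply: sumr_ge0 => p _; rewrite mulr_ge0.
pose E1 := [set x | (lam / 2) ^+ 2 < (U g x) ^+ 2].
pose E2 := \bigcup_(p in [set` s]) B p.
pose E3 := [set x | lam / 2 < h x].
have mE1 : measurable E1 by apply: measurable_gt; exact: measurable_funX.
have mE2 : measurable E2 by exact: measurable_bigcupI.
have mE3 : measurable E3 by exact: measurable_gt.
have sub : {ae mu, forall x, [set x | lam < `|U f x|] x -> (E1 `|` E2 `|` E3) x}.
  apply: filterS2 (cz_lin UT 1 bsum bg) (cz_sum s bb) => x + Us /= lamx.
  rewrite (_ : (fun y => _) = f); last first.
    by apply/funext => y; rewrite mul1r /g addrC subrK.
  rewrite Us mul1r => Uf.
  have [x2|nx2] := pselect (E2 x); first by left; right.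
  have [x3|/negP] := pselect (lam / 2 < h x); first by right.
  rewrite -leNgt => x3; left; left; rewrite /E1 /=.
  have hx : `|\sum_(p <- s) U (b p) x| <= h x.
    apply: (le_trans (ler_norm_sum _ _ _)).
    rewrite /h big_seq [leRHS]big_seq; apply: ler_sum => p ps.
    rewrite indicE mem_set ?mulr1// => xB; apply: nx2; by exists p.
  have : lam / 2 < `|U g x|.
    have := ler_normD (\sum_(p <- s) U (b p) x) (U g x); rewrite -Uf.
    by move=> t1; move: lamx hx x3 t1; lra.
  rewrite -[X in _ -> _ < X]real_normK ?num_real// => t.
  by rewrite ltr_pXn2r ?nnegrE// ltW// divr_gt0.
have muE1 : (mu E1 <= (A1 / lam * i + d)%:E)%E.
  have l2 : 0 < (lam / 2) ^+ 2 by rewrite exprn_gt0// divr_gt0.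
  apply: (le_trans (@chebyshev_le _ _ (fun x => (U g x) ^+ 2) _ l2 _ _)).
  - exact: measurable_funX.
  - by move=> x; exact: sqr_ge0.
  apply: (@le_trans _ _ ((((lam / 2) ^+ 2)^-1)%:E *
      (C%:E * (((2 ^+ n + 1) * lam * i) + e)%:E))%E).
    apply: lee_wpmul2l; first by rewrite lee_fin invr_ge0 ltW.
    apply: (le_trans (cz_L2 UT bg)); apply: lee_wpmul2l; first by rewrite lee_fin.
    by move: gle; rewrite iE -EFinM -EFinD.
  rewrite -!EFinM lee_fin.
  have -> : ((lam / 2) ^+ 2)^-1 * (C * ((2 ^+ n + 1) * lam * i + e)) =
      A1 / lam * i + 4 * C * e / lam ^+ 2.
    by rewrite /A1; move: (2 ^+ n) => z; field; rewrite gt_eqF.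
  rewrite lerD2l /e ler_pdivrMr ?exprn_gt0//.
  rewrite mulrA ler_pdivrMr//.
  have dl : 0 <= d * lam ^+ 2 by rewrite mulr_ge0 ?sqr_ge0// ltW.
  by move: dl; move: (d * lam ^+ 2) => z z0; nra.
have muE2 : (mu E2 <= ((2 * kap) ^+ n / lam * i)%:E)%E.
  have mBp p : (mu (B p) <= ((2 * kap) ^+ n)%:E * mu (dcube u L p))%E.
    apply: (le_trans (lebesgue_sball_le _ _)).
      by rewrite mulr_gt0// dside_gt0.
    by rewrite lebesgue_dcube// mulrA exprMn EFinM.
  apply: (@le_trans _ _ (((2 * kap) ^+ n)%:E * mu (\bigcup_(p in [set` s]) dcube u L p))%E).
    apply: measure_bigcup_le => // p _; [exact: measurable_dcube|exact: mBp].
  rewrite -mulrA EFinM; apply: lee_wpmul2l; first by rewrite lee_fin.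
  apply: (@le_trans _ _ (mu (dcover u L (cz_bad u L f lam)))).
    apply: mu_le; [|exact: measurable_dcover|].
      by apply: measurable_bigcupI => p _; exact: measurable_dcube.
    by move=> x [p /= /sb/first_bad_sub bp px]; exists p.
  by rewrite EFinM -iE; exact: lebesgue_cz_bad.
have muE3 : (mu E3 <= (4 * H / lam * i)%:E)%E.
  have l2 : 0 < lam / 2 by rewrite divr_gt0.
  apply: (le_trans (chebyshev_le l2 mh h0)).
  apply: (@le_trans _ _ (((lam / 2)^-1)%:E * ((2 * H)%:E * \int[mu]_x `|f x|%:E))%E).
    apply: lee_wpmul2l; first by rewrite lee_fin invr_ge0 ltW.
    exact: far_part.
  rewrite iE -!EFinM lee_fin le_eqVlt; apply/orP; left; apply/eqP.
  by move: (H) => z; field; rewrite gt_eqF.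
apply: (@le_trans _ _ (mu (E1 `|` E2 `|` E3))).
  apply: mu_le_ae => //; last by apply: measurableU => //; exact: measurableU.
  by apply: measurable_gt; exact: measurableT_comp.
apply: (@le_trans _ _ (mu E1 + mu E2 + mu E3)%E).
  apply: le_trans (measureU2 _ _ _) _ => //; first exact: measurableU.
  by apply: leeD => //; exact: measureU2.
apply: (le_trans (leeD (leeD muE1 muE2) muE3)).
rewrite iE -EFinM -!EFinD lee_fin.
have li : 0 <= lam^-1 * i by rewrite mulr_ge0.
rewrite -subr_ge0 (_ : _ - _ = lam^-1 * i)//; ring.
Qed.

End weak_type.

(** * Exceptional sets and oscillation *)

Section local_estimates.
Context {R : realType} {n : nat}.
Hypothesis n_gt0 : (0 < n)%N.
Local Notation Rn := (n.-tuple R).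
Local Notation mu := (@lebesgue_tuple R n).
Implicit Types f g b F : Rn -> R.
Variables (U : (Rn -> R) -> Rn -> R) (k : Rn -> Rn -> R) (C kap del : R).
Hypothesis UT : real_cz U k C kap del.

(** The weak type bound at every level [1/(j+1)]. It covers functions of mean [a = 0], for which the
    level [A * a] would be zero. *)
Lemma cz_null F : bcs F -> (\int[mu]_x `|F x|%:E = 0)%E ->
  {ae mu, forall x, U F x = 0}.
Proof.
move=> bF F0; have [A A0 HA] := weak_type n_gt0 UT.
have mUF := cz_meas UT bF.
have H j : {ae mu, forall x, `|U F x| <= j.+1%:R^-1}.
  exists [set x | j.+1%:R^-1 < `|U F x|]; split.
  - by apply: measurable_gt; exact: measurableT_comp.
  - apply/eqP; rewrite eq_le measure_ge0 andbT.
    have j0 : 0 < j.+1%:R^-1 :> R by rewrite invr_gt0.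
    by apply: (le_trans (HA F _ bF j0)); rewrite F0 mule0.
  - by move=> x /= /negP; rewrite -ltNge.
apply: filterS (ae_foralln H) => x Hx; apply/eqP; rewrite -normr_eq0 eq_le normr_ge0 andbT.
apply/ler_addgt0Pr => e e0; rewrite add0r.
apply: (le_trans (Hx (Num.truncn e^-1))).
by rewrite -[leRHS]invrK lef_pV2 ?posrE ?invr_gt0// ltW// truncnS_gt.
Qed.

(** Joins the set where [|U F|] is large to the exceptional set of the maximal function, both of
    weak type (1,1) at levels proportional to [A * a]. Later [v] is the volume of a cube and [a] a
    mean over its dilate, so that [A], proportional to [1 / eps], does not depend on the cube. *)
Lemma good_set (eps : R) : 0 < eps -> exists2 A, 0 < A &
  forall F (a v : R), bcs F -> 0 <= a -> 0 < v ->
    (\int[mu]_x `|F x|%:E = (a * v)%:E)%E ->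
  exists Bad : set Rn, [/\ measurable Bad, (mu Bad <= (eps * v)%:E)%E,
    {ae mu, forall x, ~ Bad x -> `|U F x| <= A * a} &
    forall x r, ~ Bad x -> 0 < r ->
      (\int[mu]_(y in sball (tnth x) r) `|F y|%:E <= (A * a * r ^+ n)%:E)%E].
Proof.
move=> eps0; have [A1 A10 HA] := weak_type n_gt0 UT.
have n18 : 0 < 3 ^+ n * 6 ^+ n :> R by rewrite mulr_gt0// exprn_gt0.
pose A := (A1 + 3 ^+ n * 6 ^+ n) / eps.
have A0 : 0 < A by rewrite divr_gt0// addr_gt0.
exists A => // F a v bF; rewrite le_eqVlt => /predU1P[<-|a0] v0 Fa.
  rewrite mul0r in Fa; exists set0; split => //.
  - by rewrite measure0 lee_fin mulr_ge0// ltW.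
  - by apply: filterS (cz_null bF Fa) => x -> _; rewrite normr0 mulr0.
  - move=> x r _ r0; rewrite mulr0 mul0r -Fa; apply: ge0_subset_integral => //.
      exact: measurable_sball.
    by apply/measurable_EFinP; apply: measurableT_comp => //; case: bF.
have Aa : 0 < A * a by rewrite mulr_gt0.
(* The division by [6^n] cancels the factor in the conclusion of [maximal_set]. *)
have l6 : 0 < A * a / 6 ^+ n by rewrite divr_gt0// exprn_gt0.
have [Om [mOm muOm HOm]] := maximal_set n_gt0 bF l6.
pose W := [set x | A * a < `|U F x|].
have mW : measurable W.
  apply: measurable_gt; apply: measurableT_comp => //.
  exact: (cz_meas UT).
have muW : (mu W <= (A1 / A * v)%:E)%E.
  apply: (le_trans (HA F _ bF Aa)); rewrite Fa -EFinM lee_fin.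
  by rewrite le_eqVlt; apply/orP; left; apply/eqP; field; rewrite !gt_eqF.
exists (W `|` Om); split.
- exact: measurableU.
- apply: (le_trans (measureU2 _ _ _)) => //; apply: (le_trans (leeD muW muOm)).
  rewrite Fa -EFinM -EFinD lee_fin le_eqVlt; apply/orP; left; apply/eqP.
  have A1s : A1 + 3 ^+ n * 6 ^+ n != 0 by rewrite gt_eqF// addr_gt0.
  have n6 : 6 ^+ n != 0 :> R by rewrite gt_eqF// exprn_gt0.
  rewrite /A; move: (3 ^+ n) (6 ^+ n) A1s n6 => y z A1s n6.
  by field; rewrite A1s n6 !gt_eqF.
- apply: aeW => x nx; rewrite leNgt; apply/negP => h; apply: nx; by left.
- move=> x r nx r0; apply: (le_trans (HOm x _ r r0)); first by move=> h; apply: nx; right.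
  rewrite lee_fin (_ : 6 ^+ n * _ = A * a)// mulrC divfK// gt_eqF// exprn_gt0//.
Qed.

(** The content of [cz_rep] at a single point, so that it can be carried to a chosen point of a
    cube. *)
Definition cz_rep_at F (x : Rn) :=
  (exists2 r, 0 < r & forall y, sball (tnth x) r y -> F y = 0) ->
  mu.-integrable setT (EFin \o (fun y => k x y * F y)) /\
  U F x = \int[mu]_y (k x y * F y).

(** As [F] vanishes within [kap * s] of every point of the cube, both values are kernel integrals,
    and the difference of the kernels is summed over annuli about [x'], where [Lam] controls the
    means of [|F|] at all radii. The radius [(kap + 1) * s] adds the distance from a point of the
    cube to the corner. *)
Lemma cz_oscillation F (u : 'I_n -> R) (L : R) p (Lam : R) (x x' : Rn) :
  0 < L -> bcs F ->
  (forall y, sball (dcorner u L p) ((kap + 1) * dside L p) y -> F y = 0) ->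
  0 <= Lam -> (forall r, 0 < r ->
    (\int[mu]_(y in sball (tnth x') r) `|F y|%:E <= (Lam * r ^+ n)%:E)%E) ->
  cz_rep_at F x -> cz_rep_at F x' -> dcube u L p x -> dcube u L p x' ->
  `|U F x - U F x'| <= C * 2 ^+ n / (1 - 2^-1 `^ del) * Lam.
Proof.
move=> L0 bF F0 Lam0 HLam rx rx' px px'.
set s := dside L p in F0 *; have s0 : 0 < s by exact: dside_gt0.
have k2 := cz_kap UT; have k0 : 0 < kap by exact: lt_le_trans k2.
have r00 : 0 < kap * s by rewrite mulr_gt0.
have k2s : 2 * s <= kap * s by rewrite ler_pM2r.
have near (z : Rn) : dcube u L p z -> forall r y, r <= kap * s -> sball (tnth z) r y -> F y = 0.
  move=> pz r y rk zy; apply: F0 => j.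
  have := zy j; have := dcube_sball pz j; rewrite -/s mulrDl mul1r.
  rewrite !ltr_norml => /andP[a1 a2] /andP[a3 a4].
  by apply/andP; split; move: a1 a2 a3 a4 rk; move: (kap * s) => w *; lra.
have sk : s <= kap * s by move: k2s s0; lra.
have far z : dcube u L p z -> exists2 r, 0 < r & forall y, sball (tnth z) r y -> F y = 0.
  by move=> pz; exists s => // y; exact: near.
have [ix ->] := rx (far _ px); have [ix' ->] := rx' (far _ px').
rewrite distrC -RintegralB//.
have iD : mu.-integrable setT (EFin \o (fun y => k x' y * F y - k x y * F y)).
  exact: (integrableB measurableT ix' ix).
apply: (le_trans (le_normr_Rintegral measurableT iD)).
have mF : measurable_fun setT F by case: bF.
pose phi y := `|k x' y * F y - k x y * F y|.
have mphi : measurable_fun setT phi.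
  apply: measurableT_comp => //.
  by have /integrableP[/measurable_EFinP] := iD.
have h : (\int[mu]_y (phi y)%:E <= (C * Lam * 2 ^+ n / (1 - 2^-1 `^ del))%:E)%E.
  apply: (@annulus_integral R n phi (fun y => `|F y|) (tnth x') (kap * s)) => //.
  - exact: measurableT_comp.
  - by move=> y; exact: normr_ge0.
  - exact: cz_del UT.
  - exact: cz_C UT.
  - apply: aeW => y; split.
      by move=> yb; rewrite /phi (near _ px' _ _ (lexx _) yb) !mulr0 subrr normr0.
    move=> r rr xr; rewrite /phi -mulrBl normrM; apply: ler_wpM2r => //.
    have [] // := @cz_reg _ _ _ _ _ _ _ UT x' x y s r s0.
    move=> j; apply/ltW; exact: dcube_dist px' px.
  - by move=> r rr; apply: HLam; exact: lt_le_trans rr.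
have fin : (\int[mu]_y (phi y)%:E)%E \is a fin_num.
  rewrite ge0_fin_numE; first by apply: (le_lt_trans h); rewrite ltry.
  by apply: integral_ge0 => y _; rewrite lee_fin; exact: normr_ge0.
rewrite /Rintegral -lee_fin fineK//; apply: (le_trans h).
by rewrite lee_fin le_eqVlt; apply/orP; left; apply/eqP; ring.
Qed.

End local_estimates.

(** * Dilated cubes and their means *)

Section dilations.
Context {R : realType} {n : nat}.
Local Notation Rn := (n.-tuple R).
Local Notation mu := (@lebesgue_tuple R n).
Local Notation dpath := (@dpath n).

(** A ball about the corner rather than the centre; it still contains the cube for [bet >= 1]. *)
Definition dil (bet : R) (u : 'I_n -> R) (L : R) (p : dpath) : set Rn :=
  sball (dcorner u L p) (bet * dside L p).

(** Normalised by the volume of the cube, not of the dilate, hence a mean only up to the factor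
    [(2 * bet)^n]. *)
Definition dil_avg (bet : R) (u : 'I_n -> R) (L : R) (f : Rn -> R) (p : dpath) : R :=
  fine (\int[mu]_(x in dil bet u L p) `|f x|%:E) / dside L p ^+ n.

Variables (bet : R) (u : 'I_n -> R) (L : R) (f : Rn -> R).
Hypothesis bet1 : 1 <= bet.
Hypothesis L0 : 0 < L.
Hypothesis bf : bcs f.

Local Notation D := (dil bet u L).
Local Notation a := (dil_avg bet u L f).

Lemma measurable_dil p : measurable (D p).
Proof. exact: measurable_sball. Qed.

(** Passing to a child of side [t] moves the corner by at most [t] and decreases the radius by
    [bet * t >= t]. *)
Lemma dil_suffix q p : suffix q p -> D p `<=` D q.
Proof.
move=> /suffixP[s ->]; elim: s => //= v s IH; apply: subset_trans IH.
move=> x H i; have := H i; rewrite /= (dside_cons L v (s ++ q)).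
have := @dside_gt0 R n L L0 (v :: s ++ q).
move: (dside L (v :: s ++ q)) (tnth x i) (dcorner u L (s ++ q) i) => t y c t0.
have bt : t <= bet * t by rewrite ler_peMl// ltW.
rewrite mulrCA; move: bt; move: (bet * t) => w wt.
rewrite !ltr_norml; case: (v i) => /= /andP[h1 h2]; apply/andP; split; lra.
Qed.

Lemma dil_avg_ge0 p : 0 <= a p.
Proof.
rewrite divr_ge0 ?exprn_ge0//; last by rewrite ltW// dside_gt0.
by rewrite fine_ge0// integral_ge0// => x _; rewrite lee_fin.
Qed.

Lemma dil_avgE p : (\int[mu]_(x in D p) `|f x|%:E = (a p * dside L p ^+ n)%:E)%E.
Proof.
rewrite divfK ?gt_eqF ?exprn_gt0 ?dside_gt0// fineK//.
rewrite ge0_fin_numE; last by apply: integral_ge0 => x _; rewrite lee_fin.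
have [i i0 iE] := bcs_norm_fin bf.
apply: (@le_lt_trans _ _ (\int[mu]_x `|f x|%:E)%E); last by rewrite iE ltry.
apply: ge0_subset_integral => //; first exact: measurable_dil.
by apply: measurable_fun_EFin_norm; case: bf.
Qed.

Lemma dil_restrict_norm p : (\int[mu]_x `|(f x * \1_(D p) x)%R|%:E =
  (a p * dside L p ^+ n)%:E)%E.
Proof.
rewrite -dil_avgE [RHS]integral_mul_indic; apply: eq_integral => x _.
by rewrite normrM indicE (ger0_norm (ler0n _ _)).
Qed.

End dilations.

(** * Comparison of two nested cubes *)

Section one_step.
Context {R : realType} {n : nat}.
Hypothesis n_gt0 : (0 < n)%N.
Local Notation Rn := (n.-tuple R).
Local Notation mu := (@lebesgue_tuple R n).
Local Notation dpath := (@dpath n).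
Variables (U : (Rn -> R) -> Rn -> R) (k : Rn -> Rn -> R) (C kap del : R).
Hypothesis UT : real_cz U k C kap del.
Local Notation bet := (kap + 1).

Variables (u : 'I_n -> R) (L : R) (f : Rn -> R).
Hypothesis L0 : 0 < L.
Hypothesis bf : bcs f.
Local Notation D := (dil bet u L).
Local Notation a := (dil_avg bet u L f).
Local Notation loc p := (fun x => f x * \1_(D p) x).

Variables (A : R) (Bad : dpath -> set Rn).
Hypothesis A0 : 0 < A.
Hypothesis mBad : forall p, measurable (Bad p).
Hypothesis muBad : forall p,
  (mu (Bad p) <= (2^-1 ^+ n.+2 * dside L p ^+ n)%:E)%E.
Hypothesis BadU : forall p,
  {ae mu, forall x, ~ Bad p x -> `|U (loc p) x| <= A * a p}.
Hypothesis BadM : forall p x r, ~ Bad p x -> 0 < r ->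
  (\int[mu]_(y in sball (tnth x) r) `|(f y * \1_(D p) y)%R|%:E <=
   (A * a p * r ^+ n)%:E)%E.

Let bet1 : 1 <= bet.
Proof. by rewrite lerDr; apply: le_trans (cz_kap UT). Qed.

(** The three summands bound, in units of [a q], the value at [x'] of [U (loc q)], that of
    [U (loc p)], and the oscillation of their difference. *)
Definition step_const : R :=
  A + A * (A * (bet + 1) ^+ n) + C * 2 ^+ n / (1 - 2^-1 `^ del) * A.

Lemma step_const_ge : A <= step_const.
Proof.
have b1 : 0 <= bet + 1 by rewrite addr_ge0//; apply: le_trans bet1.
rewrite /step_const -addrA lerDl addr_ge0// !mulr_ge0 ?exprn_ge0 ?(ltW A0) ?(cz_C UT)//.
by rewrite invr_ge0 subr_ge0 ltW// half_powR_lt1// (cz_del UT).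
Qed.

Lemma bcs_loc p : bcs (loc p).
Proof. by apply: bcs_indic => //; exact: measurable_dil. Qed.

(** [U (loc q) - U (loc p)] is a.e. [U F] with [F] vanishing on the dilate of [p]. Its oscillation
    over [p] is therefore at most a multiple of [a q], and its size is read off at one good point
    [x']. *)
Lemma one_step q p : suffix q p ->
  (mu (dcube u L p `&` Bad q) <= (2^-1)%:E * mu (dcube u L p))%E ->
  {ae mu, forall x, dcube u L p x ->
     `|U (loc q) x| <= step_const * a q + `|U (loc p) x|}.
Proof.
move=> qp muq; set s := dside L p; have s0 : 0 < s by exact: dside_gt0.
have mp : measurable (dcube u L p) by exact: measurable_dcube.
have sn0 : 0 < s ^+ n by rewrite exprn_gt0.
pose F x := -1 * (f x * \1_(D p) x) + f x * \1_(D q) x.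
have bF : bcs F by apply: bcs_lin; exact: bcs_loc.
have FE x : F x = f x * (\1_(D q) x - \1_(D p) x) by rewrite /F; ring.
have DS := @dil_suffix _ _ bet u L bet1 L0 _ _ qp.
have F0 y : sball (dcorner u L p) (bet * dside L p) y -> F y = 0.
  move=> py; rewrite FE !indicE (mem_set (DS _ py)) mem_set// subrr mulr0//.
have Fq x : `|F x| <= `|f x * \1_(D q) x|.
  rewrite FE !normrM ler_wpM2l// !indicE.
  have [xp|xp] := boolP (x \in D p).
    by rewrite (mem_set (DS _ (set_mem xp))) subrr normr0.
  by rewrite subr0.
have good : {ae mu, forall x, [/\ (~ Bad q x -> `|U (loc q) x| <= A * a q),
    (~ Bad p x -> `|U (loc p) x| <= A * a p),
    U F x = - U (loc p) x + U (loc q) x & cz_rep_at U k F x]}.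
  have H1 : {ae mu, forall x, (~ Bad q x -> `|U (loc q) x| <= A * a q) /\
      (~ Bad p x -> `|U (loc p) x| <= A * a p)}.
    by apply: filterS2 (BadU q) (BadU p).
  have H2 := cz_lin UT (-1) (bcs_loc p) (bcs_loc q).
  apply: filterS3 H1 H2 (cz_rep UT bF) => x [h1 h2] h3 h4.
  by split => //; rewrite -[- _]mulN1r.
(* [Bad q] takes at most half of [p] and [Bad p] at most a quarter, as [2^-(n+2) <= 1/4]; together
   with the null set where an a.e. property fails, they cannot cover [p]. *)
have [x' [px' nq np [g1 g2 g3 g4]]] : exists x', [/\ dcube u L p x', ~ Bad q x',
    ~ Bad p x' & [/\ (~ Bad q x' -> `|U (loc q) x'| <= A * a q),
    (~ Bad p x' -> `|U (loc p) x'| <= A * a p),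
    U F x' = - U (loc p) x' + U (loc q) x' & cz_rep_at U k F x']].
  apply: contrapT => nex; have [N [mN N0 NH]] := good.
  have sub : dcube u L p `<=` (dcube u L p `&` Bad q) `|` Bad p `|` N.
    move=> x px; have [xq|xq] := pselect (Bad q x); first by left; left.
    have [xp|xp] := pselect (Bad p x); first by left; right.
    right; apply: NH => /= gx; apply: nex; by exists x.
  have m1 : measurable (dcube u L p `&` Bad q) by exact: measurableI.
  have : (mu (dcube u L p) <= mu (dcube u L p `&` Bad q) + mu (Bad p) + mu N)%E.
    apply: (le_trans (mu_le mp _ sub)).
      by apply: measurableU => //; exact: measurableU.
    apply: (le_trans (measureU2 _ _ _)) => //; first exact: measurableU.
    by apply: leeD => //; exact: measureU2.
  apply/negP; rewrite -ltNge N0 adde0.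
  apply: (le_lt_trans (leeD muq (muBad p))).
  rewrite lebesgue_dcube// -EFinM -EFinD lte_fin -/s -mulrDl gtr_pMl//.
  have : 2^-1 ^+ n.+2 <= 2^-1 ^+ 2 :> R by rewrite ler_wiXn2l// ?invr_ge0// invf_le1// ler1n.
  by rewrite expr2; lra.
have Aaq : 0 <= A * a q by rewrite mulr_ge0 ?(ltW A0)// dil_avg_ge0.
(* The ball of radius [(bet + 1) * s] about [x'] contains the dilate of [p], so the maximal bound of
   [q] at [x'] controls [a p]. *)
have ap : a p <= A * (bet + 1) ^+ n * a q.
  have b10 : 0 < (bet + 1) * s.
    by rewrite mulr_gt0// (lt_le_trans ltr01)// (le_trans bet1)// lerDl.
  have := BadM nq b10.
  have : ((a p * s ^+ n)%:E <= \int[mu]_(y in sball (tnth x') ((bet + 1) * s))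
      `|(f y * \1_(D q) y)%R|%:E)%E.
    rewrite -(@dil_avgE R n bet u L f L0 bf).
    have mf : measurable_fun setT f by case: bf.
    apply: (@le_trans _ _ (\int[mu]_(y in D p) `|(f y * \1_(D q) y)%R|%:E)%E).
      rewrite le_eqVlt; apply/orP; left; apply/eqP; apply: eq_integral => y.
      by rewrite inE => /DS yq; rewrite indicE mem_set// mulr1.
    apply: ge0_subset_integral => //.
    - exact: measurable_dil.
    - exact: measurable_sball.
    - by apply: measurable_fun_EFin_norm; have [] := bcs_loc q.
    - move=> y py i; have := py i; have := dcube_sball px' i; rewrite -/s.
      rewrite !ltr_norml mulrDl mul1r; move: (bet * s) => w.
      by move=> /andP[h1 h2] /andP[h3 h4]; apply/andP; split; lra.
  move=> h1 h2; have := le_trans h1 h2; rewrite lee_fin.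
  rewrite (_ : ((bet + 1) * s) ^+ n = (bet + 1) ^+ n * s ^+ n); last exact: exprMn.
  rewrite mulrA ler_pM2r//.
  by move/le_trans; apply; rewrite le_eqVlt; apply/orP; left; apply/eqP; ring.
have HL r : 0 < r -> (\int[mu]_(y in sball (tnth x') r) `|F y|%:E <=
    (A * a q * r ^+ n)%:E)%E.
  move=> r0; apply: le_trans (BadM nq r0); apply: ge0_le_integral => //.
  - exact: measurable_sball.
  - by apply: measurable_fun_EFin_norm; case: bF.
  - by apply: measurable_fun_EFin_norm; have [] := bcs_loc q.
  - by move=> y _; rewrite lee_fin.
apply: filterS good => x [_ _ x3 x4] px.
have osc := cz_oscillation UT L0 bF F0 Aaq HL x4 g4 px px'.
have := g1 nq; have := g2 np => e2 e1.
have UFx' : `|U F x'| <= A * a p + A * a q.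
  by rewrite g3; apply: (le_trans (ler_normD _ _)); rewrite normrN lerD.
have e3 : `|U (loc q) x| <= `|U F x| + `|U (loc p) x|.
  rewrite (_ : U (loc q) x = U F x + U (loc p) x); last by rewrite x3; ring.
  exact: ler_normD.
have e4 : `|U F x| <= `|U F x - U F x'| + `|U F x'|.
  by rewrite -{1}(subrK (U F x') (U F x)) ler_normD.
have e5 : A * a p <= A * (A * (bet + 1) ^+ n * a q) by rewrite ler_pM2l.
have alg (K B1 ap' aq v1 v2 v3 v4 : R) : v1 <= K * (A * aq) ->
    A * ap' <= A * (A * B1 * aq) -> v2 <= A * ap' + A * aq ->
    v3 <= v4 + `|U (loc p) x| -> v4 <= v1 + v2 ->
    v3 <= (A + A * (A * B1) + K * A) * aq + `|U (loc p) x| by move=> *; lra.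
exact: alg osc e5 UFx' e3 e4.
Qed.

End one_step.

(** * The selected cubes as paths *)

Section selection.
Context {n : nat}.
Local Notation dpath := (@dpath n).
Variable bad : dpath -> dpath -> Prop.

(* [stop p] is the deepest selected cube containing the cube of p: going down
   from a selected cube q, the next one is the first p with [bad q p]. *)
Fixpoint stop (p : dpath) : dpath :=
  if p is v :: p' then if `[< bad (stop p') p >] then p else stop p' else [::].

Fixpoint stops (p : dpath) : seq dpath :=
  if p is v :: p' then
    if `[< bad (stop p') p >] then p :: stops p' else stops p'
  else [:: [::]].

(** For a selected [q], the maximal elements are the selected cubes of the next generation. *)
Definition sbad q : set dpath := [set p | [/\ suffix q p, p <> q & bad q p]].

Lemma stop_suffix p : suffix (stop p) p.
Proof.
elim: p => //= v p IH; case: ifP => _; first exact: suffix_refl.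
by rewrite suffix_consr IH orbT.
Qed.

Lemma suffix_cons_size v (q p : dpath) : suffix q p -> q <> v :: p.
Proof.
move=> /suffixP[s ->] /(congr1 size)/eqP; rewrite /= size_cat.
by rewrite ltn_eqF// ltnS leq_addl.
Qed.

(** Below a selected [q] the value of [stop] first changes at a cube that is bad for [q], which is
    the witness [r]. *)
Lemma stop_dichotomy q p : stop q = q -> suffix q p ->
  stop p = q \/ exists2 r, sbad q r & suffix r p.
Proof.
move=> sq; elim: p => [|v p IH].
  by rewrite suffixs0 => /eqP ->; left.
rewrite suffix_consr => /orP[/eqP <-|qp]; first by left.
have [e|[r br rp]] := IH qp; last first.
  by right; exists r => //; rewrite suffix_consr rp orbT.
rewrite /= e; case: asboolP => b; last by left.
right; exists (v :: p); last exact: suffix_refl.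
split => //; first by rewrite suffix_consr qp orbT.
by move=> h; apply: (suffix_cons_size (v := v) qp).
Qed.

(** By maximality no cube strictly between [q] and [p] is bad for [q], so [stop] is still [q] at the
    parent of [p] and moves to [p]. *)
Lemma first_sbad_stop q p : stop q = q -> first_bad (sbad q) p -> stop p = p.
Proof.
move=> sq [[]]; case: p => [|v p] // + nq bq fp.
rewrite suffix_consr => /orP[/eqP/esym//|qp].
have [e|[r br rp]] := stop_dichotomy sq qp; first by rewrite /= e; case: asboolP.
by case: (suffix_cons_size (v := v) rp); apply: fp => //; rewrite suffix_consr rp orbT.
Qed.

Lemma mem_stops p q : (q \in stops p) = (stop q == q) && suffix q p.
Proof.
elim: p => [|v p IH]; first by rewrite /= inE suffixs0; case: eqP => [->|]; rewrite ?andbF.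
rewrite suffix_consr.
have [e|qvp] := eqVneq q (v :: p).
  rewrite e in IH *; rewrite /= andbT; case: ifP => b; first by rewrite inE !eqxx.
  rewrite IH; apply/andP/eqP => [[_ h]|h].
    by case: (suffix_cons_size (v := v) h).
  by have := stop_suffix p; rewrite h => h'; case: (suffix_cons_size (v := v) h').
by rewrite /= -IH; case: ifP => // _; rewrite inE (negbTE qvp).
Qed.

Lemma uniq_stops p : uniq (stops p).
Proof.
elim: p => //= v p IH; case: ifP => //= _; rewrite IH andbT mem_stops.
by apply/negP => /andP[_ h]; case: (suffix_cons_size (v := v) h).
Qed.

End selection.

Lemma ler_sum_subset (R : realType) (I : eqType) (s1 s2 : seq I) (F : I -> R) :
  uniq s1 -> uniq s2 -> {subset s1 <= s2} -> (forall i, 0 <= F i) ->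
  \sum_(i <- s1) F i <= \sum_(i <- s2) F i.
Proof.
move=> u1 u2 s12 F0.
have p12 : perm_eq s1 [seq i <- s2 | i \in s1].
  apply: uniq_perm => //; first exact: filter_uniq.
  by move=> i; rewrite mem_filter andb_idr// => /s12.
rewrite (perm_big _ p12) /= big_filter big_mkcond /=.
by apply: ler_sum => i _; case: ifP.
Qed.

(** Paths being countable, this makes one null set out of the exceptional null sets of all cubes. *)
Lemma ae_forall_countable d (T : measurableType d) (R : realType)
    (mu : {measure set T -> \bar R}) (I : countType) (P : I -> T -> Prop) :
  (forall i, {ae mu, forall x, P i x}) -> {ae mu, forall x, forall i, P i x}.
Proof.
move=> H; have : {ae mu, forall x, forall k : nat,
    if @unpickle I k is Some i then P i x else True}.
  apply: ae_foralln => k; case: unpickle => [i|]; first exact: H.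
  exact: aeW.
by apply: filterS => x Hx i; have := Hx (pickle i); rewrite pickleK.
Qed.

(** * Sparse domination *)

Section sparse_domination.
Context {R : realType} {n : nat}.
Hypothesis n_gt0 : (0 < n)%N.
Local Notation Rn := (n.-tuple R).
Local Notation mu := (@lebesgue_tuple R n).
Local Notation dpath := (@dpath n).
Variables (U : (Rn -> R) -> Rn -> R) (k : Rn -> Rn -> R) (C kap del : R).
Hypothesis UT : real_cz U k C kap del.
Local Notation bet := (kap + 1).

Section one_function.
Variables (u : 'I_n -> R) (L : R) (f : Rn -> R).
Hypothesis L0 : 0 < L.
Hypothesis bf : bcs f.
Local Notation D := (dil bet u L).
Local Notation a := (dil_avg bet u L f).
Local Notation loc p := (fun x => f x * \1_(D p) x).

Variables (A : R) (Bad : dpath -> set Rn).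
Hypothesis A0 : 0 < A.
Hypothesis mBad : forall p, measurable (Bad p).
Hypothesis muBad : forall p,
  (mu (Bad p) <= (2^-1 ^+ n.+2 * dside L p ^+ n)%:E)%E.
Hypothesis BadU : forall p,
  {ae mu, forall x, ~ Bad p x -> `|U (loc p) x| <= A * a p}.
Hypothesis BadM : forall p x r, ~ Bad p x -> 0 < r ->
  (\int[mu]_(y in sball (tnth x) r) `|(f y * \1_(D p) y)%R|%:E <=
   (A * a p * r ^+ n)%:E)%E.

(** The threshold [2^-(n+1)] meets three demands. It is twice the share [2^-(n+2)] of [Bad q] in
    [q], so dense cubes fill at most half of [q]; it is [2^-n / 2], so a child of a cube that is not
    dense has at most half of its measure in [Bad q], as [one_step] asks; and it is below 1, so
    almost no point off the dense cubes is in [Bad q]. *)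
Definition dense q p : Prop :=
  ((2^-1 ^+ n.+1)%:E * mu (dcube u L p) < mu (dcube u L p `&` Bad q))%E.

Local Notation stp := (stop dense).
Local Notation below q := (dcover u L (sbad dense q)).
Definition sparse_part q : set Rn := dcube u L q `\` below q.
Local Notation K := (@step_const R n C kap del A).
Local Notation E := sparse_part.

Let mp p : measurable (dcube u L p). Proof. exact: measurable_dcube. Qed.
Let mE q : measurable (E q).
Proof. by apply: measurableD => //; exact: measurable_dcover. Qed.

Lemma not_dense_self q : (mu (dcube u L q `&` Bad q) <=
  (2^-1 ^+ n.+1)%:E * mu (dcube u L q))%E.
Proof.
apply: (@le_trans _ _ (mu (Bad q))).
  by apply: mu_le => //; exact: measurableI.
apply: (le_trans (muBad q)); rewrite lebesgue_dcube// -EFinM lee_fin.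
apply: ler_wpM2r; first by rewrite exprn_ge0// ltW// dside_gt0.
by rewrite exprS ler_piMl ?exprn_ge0 ?invr_ge0// invf_le1// ler1n.
Qed.

Lemma stop_not_dense p : (mu (dcube u L p `&` Bad (stp p)) <=
  (2^-1 ^+ n.+1)%:E * mu (dcube u L p))%E.
Proof.
case: p => [|v p] /=; first exact: (not_dense_self [::]).
case: asboolP => [_|]; first exact: not_dense_self.
by move/negP; rewrite -leNgt.
Qed.

Lemma stop_step v p : {ae mu, forall x, dcube u L (v :: p) x ->
  dense (stp p) (v :: p) ->
  `|U (loc (stp p)) x| <= K * a (stp p) + `|U (loc (v :: p)) x|}.
Proof.
have sp : suffix (stp p) (v :: p) by rewrite suffix_consr stop_suffix orbT.
have hm : (mu (dcube u L (v :: p) `&` Bad (stp p)) <=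
    (2^-1)%:E * mu (dcube u L (v :: p)))%E.
  apply: (@le_trans _ _ (mu (dcube u L p `&` Bad (stp p)))).
    apply: mu_le; try exact: measurableI.
    by move=> x [/(dcube_cons L0) px Bx].
  apply: (le_trans (stop_not_dense p)); rewrite !lebesgue_dcube// -!EFinM lee_fin.
  rewrite (_ : dside L p ^+ n = 2 ^+ n * dside L (v :: p) ^+ n); last first.
    by rewrite (dside_cons L v p) exprMn.
  by rewrite mulrA exprS -[2^-1 * _ * _]mulrA -exprMn mulVf// expr1n mulr1.
by apply: filterS (one_step UT L0 bf A0 mBad muBad BadU BadM sp hm) => x Hx px _; exact: Hx.
Qed.

Lemma below_le q : (mu (below q) <= (2^-1)%:E * mu (dcube u L q))%E.
Proof.
(* Lebesgue measure restricted to [Bad q]: on a dense cube it keeps a fixed share of the volume. *)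
pose m2 : {measure set Rn -> \bar R} := mrestr mu (mBad q).
have h : (mu (below q) <= (2 ^+ n.+1)%:E * m2 (below q))%E.
  apply: stopping_le => //.
  move=> p [[_ _ dp] _]; rewrite /m2 /= /mrestr.
  have c0 : (0 <= (2 ^+ n.+1 : R)%:E)%E by rewrite lee_fin exprn_ge0.
  have := lee_wpmul2l c0 (ltW dp).
  by rewrite muleA -EFinM -exprMn mulfV// expr1n mul1e.
apply: (le_trans h); rewrite /m2 /= /mrestr.
apply: (@le_trans _ _ ((2 ^+ n.+1)%:E * (2^-1 ^+ n.+2 * dside L q ^+ n)%:E)%E).
  apply: lee_wpmul2l; first by rewrite lee_fin exprn_ge0.
  apply: le_trans (muBad q); apply: mu_le => //.
  by apply: measurableI => //; exact: measurable_dcover.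
rewrite lebesgue_dcube// -!EFinM lee_fin mulrA [2^-1 ^+ n.+2]exprSr mulrA.
by rewrite -exprMn mulfV// expr1n mul1r.
Qed.

Lemma below_sub q : below q `<=` dcube u L q.
Proof. by move=> x [p [/(dcube_suffix L0) h _ _] /h]. Qed.

Lemma sparse_part_big q : (mu (dcube u L q) <= 2%:E * mu (E q))%E.
Proof.
have fin : mu (dcube u L q) \is a fin_num by rewrite lebesgue_dcube.
have mb : measurable (below q) by exact: measurable_dcover.
have finb : mu (below q) \is a fin_num.
  rewrite ge0_fin_numE//; apply: (@le_lt_trans _ _ (mu (dcube u L q))).
    by apply: mu_le => //; exact: below_sub.
  by rewrite -ge0_fin_numE.
have finE : mu (E q) \is a fin_num.
  rewrite ge0_fin_numE//; apply: (@le_lt_trans _ _ (mu (dcube u L q))).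
    by apply: mu_le => // x [].
  by rewrite -ge0_fin_numE.
have h1 : (mu (dcube u L q) <= mu (E q) + mu (below q))%E.
  apply: le_trans (measureU2 _ _ _) => //; apply: mu_le => //.
    exact: measurableU.
  by move=> x qx; have [bx|bx] := pselect (below q x); [right|left].
have := below_le q; move: h1.
rewrite -(fineK fin) -(fineK finb) -(fineK finE) -!EFinM -EFinD !lee_fin.
by move: (fine _) (fine _) (fine _) => x y z *; lra.
Qed.

Lemma trivIset_sparse_part : trivIset [set q | stp q = q] E.
Proof.
suff H q q' x : stp q = q -> stp q' = q' -> (size q <= size q')%N ->
    E q x -> E q' x -> q = q'.
  move=> q q' /= sq sq' [x [qx q'x]].
  have [s|/ltnW s] := leqP (size q) (size q'); first exact: (H q q' x).
  by apply/esym/(H q' q x).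
move=> sq sq' s [qx nb] [q'x _].
have su := dcube_comparable L0 s q'x qx.
have [|[r br rq]] := stop_dichotomy sq su; first by rewrite sq'.
by exfalso; apply: nb; exists r => //; exact: (dcube_suffix L0 rq).
Qed.

(** No grid cube around a point of [E q] has more than a share [2^-(n+1)] of its measure in [Bad q]:
    those inside [q] are not dense, and larger ones only dilute [Bad q]. By differentiation the
    indicator of [Bad q] is a.e. at most this number on [E q], hence zero. *)
Lemma sparse_part_good q :
  {ae mu, forall x, stp q = q -> E q x -> `|U (loc q) x| <= A * a q}.
Proof.
have h0 : 0 <= 2^-1 ^+ n.+1 :> R by rewrite exprn_ge0// invr_ge0.
have : {ae mu, forall x, E q x -> \1_(Bad q) x <= 2^-1 ^+ n.+1 :> R}.
  apply: (@dyadic_differentiation _ _ u L L0) => //.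
  - by move=> x [qx _]; exact: dcube_root qx.
  move=> p x [qx nb] px; rewrite integral_indic// setIC.
  have [s|s] := leqP (size q) (size p).
    have su := dcube_comparable L0 s px qx.
    have [->|/eqP pq] := eqVneq p q; first exact: not_dense_self.
    by rewrite leNgt; apply/negP => dp; apply: nb; exists p.
  have su := dcube_comparable L0 (ltnW s) qx px.
  apply: (@le_trans _ _ (mu (Bad q))); first by apply: mu_le => //; exact: measurableI.
  apply: (le_trans (muBad q)).
  apply: (@le_trans _ _ ((2^-1 ^+ n.+1)%:E * mu (dcube u L q))%E); last first.
    by apply: lee_wpmul2l => //; apply: mu_le => //; exact: dcube_suffix.
  rewrite lebesgue_dcube// -EFinM lee_fin.
  apply: ler_wpM2r; first by rewrite exprn_ge0// ltW// dside_gt0.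
  by rewrite [leLHS]exprS ler_piMl// invf_le1// ler1n.
move=> H; apply: filterS2 H (BadU q) => x H1 H2 _ Ex; apply: H2 => Bx.
have := H1 Ex; rewrite indicE mem_set// leNgt => /negP; apply.
by rewrite exprn_ilt1// ?invr_ge0// invf_lt1// ltr1n.
Qed.

(** Points of [q] in no sparse part lie in the next generation of selected cubes, which fills at
    most half of [q]; after [m] generations a share of at most [2^-m] is left. *)
Lemma sparse_part_cover :
  {ae mu, forall x, dcube u L [::] x -> exists2 q, stp q = q & E q x}.
Proof.
pose G : set Rn := \bigcup_(q in [set q | stp q = q]) E q.
have mG : measurable G by exact: measurable_bigcupI.
pose B := dcube u L [::] `\` G.
have mB : measurable B by exact: measurableD.
exists B; split => //; last first.
  move=> x /= /not_implyP[rx nx]; split => // -[q /= sq qx]; apply: nx; by exists q.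
have key m q : stp q = q -> (mu (dcube u L q `&` B) <= (2^-1 ^+ m)%:E * mu (dcube u L q))%E.
  elim: m q => [|m IH] q sq.
    by rewrite expr0 mul1e; apply: mu_le => //; exact: measurableI.
  pose m1 : {measure set Rn -> \bar R} := mrestr mu mB.
  have h0 : 0 <= 2^-1 ^+ m :> R by rewrite exprn_ge0// invr_ge0.
  have h : (m1 (below q) <= (2^-1 ^+ m)%:E * mu (below q))%E.
    apply: stopping_le => // p fp; rewrite /m1 /= /mrestr.
    apply: IH; exact: first_sbad_stop fp.
  apply: (@le_trans _ _ (m1 (below q))).
    rewrite /m1 /= /mrestr; apply: mu_le; first exact: measurableI.
      by apply: measurableI => //; exact: measurable_dcover.
    move=> x [qx Bx]; split => //; apply: contrapT => nb.
    by case: Bx => _; apply; exists q.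
  apply: (le_trans h); rewrite exprSr EFinM -muleA.
  by apply: lee_wpmul2l => //; exact: below_le.
apply/eqP; rewrite eq_le measure_ge0 andbT.
apply/lee_addgt0Pr => e e0; rewrite add0e.
have l0 : 0 < L ^+ n by rewrite exprn_gt0.
have [m me] := @dside_small R (L ^+ n) e e0.
have -> : B = dcube u L [::] `&` B by apply/seteqP; split => [x [h1 h2]|x []].
apply: (le_trans (key m [::] erefl)); rewrite lebesgue_dcube// -EFinM lee_fin.
by rewrite /dside expr0 divr1 exprVn mulrC ltW.
Qed.

(** A telescoping sum down the path to the selected [q] whose sparse part contains [x]: each change
    of [stop] costs [K] times a mean, and [sparse_part_good] closes the chain at [q]. The depth [N]
    is that of [q] and depends on [x]; the quantification over [s] leaves the choice of an
    enumeration open. *)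
Lemma sparse_pointwise : {ae mu, forall x, dcube u L [::] x ->
  exists N, forall s : seq dpath, uniq s ->
    (forall q, q \in s <-> stp q = q /\ (size q <= N)%N) ->
    `|U (loc [::]) x| <= K * \sum_(q <- s) a q * \1_(dcube u L q) x}.
Proof.
have K0 : 0 <= K by apply: le_trans (step_const_ge UT A0); exact: ltW.
have H1 := ae_forall_countable (fun v => ae_forall_countable (stop_step v)).
have H2 := ae_forall_countable sparse_part_good.
apply: filterS3 H1 H2 sparse_part_cover => x H1 H2 H3 rx.
have [q sq qx] := H3 rx; exists (size q) => s us sP.
(* The mean of the current stop is subtracted, since it is only paid for when the next stop is
   reached. *)
have chain p : dcube u L p x -> `|U (loc [::]) x| <=
    K * (\sum_(r <- stops dense p) a r - a (stp p)) + `|U (loc (stp p)) x|.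
  elim: p => [|v p IH] px.
    by rewrite /= big_seq1 subrr mulr0 add0r.
  have pp := IH (dcube_cons L0 px).
  have [d|nd] := pselect (dense (stp p) (v :: p)); last first.
    by rewrite /=; case: asboolP.
  have := H1 v p px d; rewrite /=; case: asboolP => // _.
  rewrite big_cons addrAC subrr add0r.
  by move: pp; rewrite mulrBr; move: (K * _) (K * a _) => *; lra.
have := chain q qx.1; rewrite sq => ch.
have := H2 q sq qx => hq.
have hA : A * a q <= K * a q.
  by apply: ler_wpM2r; [exact: dil_avg_ge0|exact: (step_const_ge UT A0)].
apply: (@le_trans _ _ (K * \sum_(r <- stops dense q) a r)).
  by move: ch; rewrite mulrBr; move: (K * _) (K * a _) hA => *; lra.
apply: ler_wpM2l => //.
rewrite (eq_big_seq (fun r => a r * \1_(dcube u L r) x)); last first.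
  move=> r; rewrite mem_stops => /andP[_ /(dcube_suffix L0) h].
  by rewrite indicE mem_set ?mulr1//; apply: h; exact: qx.1.
apply: ler_sum_subset => //; first exact: uniq_stops.
  move=> r; rewrite mem_stops => /andP[/eqP sr rq]; apply/sP; split => //.
  exact: size_suffix rq.
by move=> r; rewrite mulr_ge0// dil_avg_ge0.
Qed.

End one_function.

Theorem sparse_domination : exists2 K, 0 <= K & forall u L f, 0 < L -> bcs f ->
  exists (F : set dpath) (E : dpath -> set Rn),
  [/\ forall q, measurable (E q), forall q, E q `<=` dcube u L q, trivIset F E,
    forall q, (mu (dcube u L q) <= 2%:E * mu (E q))%E &
    {ae mu, forall x, dcube u L [::] x -> exists N, forall s : seq dpath, uniq s ->
      (forall q, q \in s <-> F q /\ (size q <= N)%N) ->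
      `|U (fun x => f x * \1_(dil bet u L [::]) x) x| <=
      K * \sum_(q <- s) dil_avg bet u L f q * \1_(dcube u L q) x}].
Proof.
have eps0 : 0 < 2^-1 ^+ n.+2 :> R by rewrite exprn_gt0// invr_gt0.
have [A A0 HA] := good_set n_gt0 UT eps0.
exists (@step_const R n C kap del A).
  by apply: le_trans (step_const_ge UT A0); exact: ltW.
move=> u L f L0 bf.
have /choice[Bad HBad] : forall p, exists B : set Rn, [/\ measurable B,
    (mu B <= (2^-1 ^+ n.+2 * dside L p ^+ n)%:E)%E,
    {ae mu, forall x, ~ B x ->
      `|U (fun x => f x * \1_(dil bet u L p) x) x| <= A * dil_avg bet u L f p} &
    forall x r, ~ B x -> 0 < r ->
    (\int[mu]_(y in sball (tnth x) r) `|(f y * \1_(dil bet u L p) y)%R|%:E <=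
     (A * dil_avg bet u L f p * r ^+ n)%:E)%E].
  move=> p; apply: HA.
  - by apply: bcs_indic => //; exact: measurable_dil.
  - exact: dil_avg_ge0.
  - by rewrite exprn_gt0// dside_gt0.
  - exact: dil_restrict_norm.
have mBad p : measurable (Bad p) by have [] := HBad p.
have muBad p : (mu (Bad p) <= (2^-1 ^+ n.+2 * dside L p ^+ n)%:E)%E by have [] := HBad p.
have BadU p : {ae mu, forall x, ~ Bad p x ->
    `|U (fun x => f x * \1_(dil bet u L p) x) x| <= A * dil_avg bet u L f p}.
  by have [] := HBad p.
have BadM p x r : ~ Bad p x -> 0 < r ->
    (\int[mu]_(y in sball (tnth x) r) `|(f y * \1_(dil bet u L p) y)%R|%:E <=
     (A * dil_avg bet u L f p * r ^+ n)%:E)%E.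
  by have [_ _ _] := HBad p; exact.
exists [set q | stop (dense u L Bad) q = q], (sparse_part u L Bad); split.
- by move=> q; apply: measurableD; [exact: measurable_dcube|exact: measurable_dcover].
- by move=> q x [].
- exact: trivIset_sparse_part.
- by move=> q; exact: sparse_part_big.
- exact: sparse_pointwise.
Qed.

End sparse_domination.

(** * The Carleson embedding on a tree *)

Section carleson_tree.
Context {R : realType} {n : nat}.
Local Notation dpath := (@dpath n).

(** Stated with numbers rather than Booleans, so that it can be summed against the coefficients
    [c]. *)
Lemma suffix_children (p r : dpath) :
  (suffix p r)%:R = (r == p)%:R + \sum_v (suffix (v :: p) r)%:R :> R.
Proof.
have [pr|pr] := boolP (suffix p r); last first.
  rewrite big1 ?addr0 => [|v _].
    by case: eqP pr => // ->; rewrite suffix_refl.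
  case: (boolP (suffix (v :: p) r)) => // h.
  by move: pr; rewrite (suffix_trans (suffix_cons _ _) h).
case/suffixP: pr => s ->; case: (lastP s) => [|t w] /=.
  rewrite eqxx big1 ?addr0// => v _; case: (boolP (suffix _ _)) => // /size_suffix.
  by rewrite /= ltnn.
have -> : (rcons t w ++ p == p) = false.
  apply/negP => /eqP /(congr1 size)/eqP.
  by rewrite size_cat size_rcons addSn -[X in _ == X]add0n -addSn eqn_add2r.
have sw v : suffix (v :: p) (rcons t w ++ p) = (v == w).
  rewrite cat_rcons suffixE size_cat /= addnK drop_size_cat//.
  by rewrite eqseq_cons eqxx andbT eq_sym.
rewrite add0r (bigD1 w)//= sw eqxx big1 ?addr0// => v vw.
by rewrite sw (negbTE vw).
Qed.

(** Engel form of Cauchy-Schwarz: [x^2 / w] lies above its tangent planes, here the one at the ratio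
    of the sums. It makes the Bellman function superadditive over the children. *)
Lemma titu (I : finType) (X W : I -> R) : (forall i, 0 < W i) ->
  (\sum_i X i) ^+ 2 / \sum_i W i <= \sum_i X i ^+ 2 / W i.
Proof.
move=> W0; set SX := \sum_i X i; set SW := \sum_i W i.
have [SW0|SW0] := eqVneq SW 0.
  by rewrite SW0 invr0 mulr0; apply: sumr_ge0 => i _; rewrite divr_ge0 ?sqr_ge0// ltW.
have -> : SX ^+ 2 / SW = \sum_i (2 * (SX / SW) * X i - (SX / SW) ^+ 2 * W i).
  by rewrite sumrB -!mulr_sumr -/SX -/SW; field.
apply: ler_sum => i _; rewrite -subr_ge0.
have -> : X i ^+ 2 / W i - (2 * (SX / SW) * X i - (SX / SW) ^+ 2 * W i) =
    (X i - SX / SW * W i) ^+ 2 / W i.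
  by field; rewrite SW0 gt_eqF.
by rewrite divr_ge0 ?sqr_ge0// ltW.
Qed.

Variables (I : eqType) (s : seq I) (pi : I -> dpath) (c : I -> R).
Variables (X Y V : dpath -> R).
Hypothesis c0 : forall i, 0 <= c i.
Hypothesis V0 : forall p, 0 < V p.
Hypothesis Xadd : forall p, X p = \sum_v X (v :: p).
Hypothesis Yadd : forall p, Y p = \sum_v Y (v :: p).
Hypothesis Vadd : forall p, V p = \sum_v V (v :: p).
Hypothesis XYV : forall p, X p ^+ 2 <= Y p * V p.
Let A p := \sum_(i <- s) (suffix p (pi i))%:R * c i.
Hypothesis AV : forall p, A p <= V p.

(* Bellman function argument: the right-hand side is superadditive along the
   tree, and its defect pays for the term of the root. *)
Lemma carleson_depth N p :
  \sum_(i <- s) (suffix p (pi i) && (size (pi i) < size p + N)%N)%:R *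
    ((X (pi i) / V (pi i)) ^+ 2 * c i) <=
  4 * (Y p - X p ^+ 2 / (V p + A p)).
Proof.
have A0 q : 0 <= A q by apply: sumr_ge0 => i _; rewrite mulr_ge0.
elim: N p => [|N IH] p.
  rewrite big1 => [|i _]; last first.
    rewrite addn0; case: (boolP (suffix _ _)) => [/size_suffix|]; rewrite ?mul0r//.
    by rewrite ltnNge => ->; rewrite mul0r.
  rewrite mulr_ge0// subr_ge0 ler_pdivrMr ?ltr_wpDr//.
  apply: (le_trans (XYV p)); apply: ler_wpM2l; last by rewrite lerDl.
  by have := le_trans (sqr_ge0 _) (XYV p); rewrite pmulr_lge0.
pose al := \sum_(i <- s) (pi i == p)%:R * c i.
have al0 : 0 <= al by apply: sumr_ge0 => i _; rewrite mulr_ge0.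
have AE : A p = al + \sum_v A (v :: p).
  rewrite /A /al exchange_big -big_split /=; apply: eq_bigr => i _.
  by rewrite suffix_children mulrDl mulr_suml.
have -> : \sum_(i <- s) (suffix p (pi i) && (size (pi i) < size p + N.+1)%N)%:R *
    ((X (pi i) / V (pi i)) ^+ 2 * c i) = (X p / V p) ^+ 2 * al +
   \sum_v \sum_(i <- s) (suffix (v :: p) (pi i) && (size (pi i) < size (v :: p) + N)%N)%:R *
    ((X (pi i) / V (pi i)) ^+ 2 * c i).
  rewrite exchange_big /al mulr_sumr -big_split /=; apply: eq_bigr => i _.
  rewrite -mulr_suml addSnnS.
  have [sz|sz] := boolP (size (pi i) < size p + N.+1)%N; last first.
    rewrite andbF mul0r big1 ?mul0r ?addr0 => [|v _]; last by rewrite andbF.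
    case: eqP sz => [->|_ _]; last by rewrite mul0r mulr0.
    by rewrite addnS ltnS leq_addr.
  under eq_bigr do rewrite andbT.
  rewrite andbT suffix_children mulrDl; congr (_ + _).
  by case: eqP => [->|_]; rewrite ?mul1r ?mul0r ?mulr0.
have h1 : \sum_v \sum_(i <- s) (suffix (v :: p) (pi i) && (size (pi i) < size (v :: p) + N)%N)%:R *
    ((X (pi i) / V (pi i)) ^+ 2 * c i) <=
    4 * (Y p - X p ^+ 2 / (V p + \sum_v A (v :: p))).
  apply: (le_trans (ler_sum _ (fun v _ => IH (v :: p)))).
  rewrite -mulr_sumr ler_pM2l// sumrB -Yadd lerD2l lerN2.
  rewrite [in leLHS]Xadd [in leLHS]Vadd -big_split /=.
  by apply: titu => v; rewrite ltr_wpDr.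
apply: (le_trans (lerD (lexx _) h1)); rewrite AE.
have := AV p; rewrite AE.
have SA0 : 0 <= \sum_v A (v :: p) by apply: sumr_ge0.
move: (\sum_v A (v :: p)) SA0 (V p) (V0 p) (X p) (Y p) al0.
move=> B B0 W W0 x y al0 BW.
have d1 : 0 < W + B by rewrite ltr_wpDr.
have d2 : 0 < W + (al + B) by rewrite ltr_wpDr// addr_ge0.
rewrite -subr_ge0.
have -> : 4 * (y - x ^+ 2 / (W + (al + B))) -
    ((x / W) ^+ 2 * al + 4 * (y - x ^+ 2 / (W + B))) =
    x ^+ 2 * al * (4 * W ^+ 2 - (W + (al + B)) * (W + B)) /
    (W ^+ 2 * (W + B) * (W + (al + B))).
  by field; rewrite !gt_eqF.
apply: divr_ge0; last by rewrite !mulr_ge0 ?sqr_ge0// ltW.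
apply: mulr_ge0; first by rewrite mulr_ge0// sqr_ge0.
(* By the Carleson condition [al + B <= W], so both factors are at most [2 W]; this is what fixes
   the constant 4. *)
rewrite subr_ge0 (_ : 4 * W ^+ 2 = (2 * W) * (2 * W)); last by ring.
by apply: ler_pM; rewrite ?(ltW d1) ?(ltW d2)//; lra.
Qed.

(** Indices are kept apart from cubes because [pi] need not be injective: several selected cubes may
    be sent to one cube of a shifted grid. The bound [N] exceeds all depths, so nothing is
    truncated. *)
Lemma carleson_tree : \sum_(i <- s) (X (pi i) / V (pi i)) ^+ 2 * c i <= 4 * Y [::].
Proof.
pose N := (\max_(i <- s) (size (pi i)).+1)%N.
have := carleson_depth N [::].
rewrite (eq_big_seq (fun i => (X (pi i) / V (pi i)) ^+ 2 * c i)); last first.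
  move=> i is_; rewrite suffix0s /= add0n (_ : (_ < N)%N) ?mul1r//.
  exact: (leq_bigmax_seq (F := fun i => (size (pi i)).+1)).
move/le_trans; apply; rewrite ler_pM2l// gerBl divr_ge0 ?sqr_ge0//.
by rewrite addr_ge0 ?(ltW (V0 _))//; apply: sumr_ge0 => i _; rewrite mulr_ge0.
Qed.

End carleson_tree.

(** * Cauchy-Schwarz and the weighted Carleson embedding *)

Section carleson_embedding.
Context {R : realType} {n : nat}.
Local Notation Rn := (n.-tuple R).
Local Notation mu := (@lebesgue_tuple R n).
Local Notation dpath := (@dpath n).

Lemma integral_gt0 (D : set Rn) (v : Rn -> R) : measurable D -> (0 < mu D)%E ->
  measurable_fun setT v -> (forall x, 0 <= v x) -> {ae mu, forall x, 0 < v x} ->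
  (0 < \int[mu]_(x in D) (v x)%:E)%E.
Proof.
move=> mD D0 mv v0 vpos; rewrite lt_neqAle; apply/andP; split; last first.
  by apply: integral_ge0 => x _; rewrite lee_fin.
apply/eqP => /esym i0; move: D0; rewrite lt_neqAle => /andP[/eqP + _]; apply.
have mvE : measurable_fun D (fun x => (v x)%:E).
  by apply/measurable_EFinP; exact: measurable_funTS.
have /(ae_eq_integral_abs mu mD mvE) H : (\int[mu]_(x in D) `|(v x)%:E| = 0)%E.
  by rewrite -[RHS]i0; apply: eq_integral => x _; rewrite gee0_abs// lee_fin.
apply/esym/eqP; rewrite eq_le measure_ge0 andbT -(@measure0 _ _ _ mu).
apply: mu_le_ae => //; apply: filterS2 H vpos => x Hx vx Dx.
by have [] := Hx Dx => vx0; move: vx; rewrite vx0 ltxx.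
Qed.

Lemma dcube_bigsetU (u : 'I_n -> R) (L : R) p : 0 < L ->
  dcube u L p = \big[setU/set0]_v dcube u L (v :: p).
Proof.
move=> L0; rewrite -bigcup_seq; apply/seteqP; split => [x|x [v _]].
  by move=> /(dcube_child L0)[v vx]; exists v => //=; rewrite mem_index_enum.
exact: dcube_cons.
Qed.

Lemma integral_children (u : 'I_n -> R) (L : R) p (y : Rn -> R) : 0 < L ->
  measurable_fun setT y -> (forall x, 0 <= y x) ->
  (\int[mu]_(x in dcube u L p) (y x)%:E =
   \sum_v \int[mu]_(x in dcube u L (v :: p)) (y x)%:E)%E.
Proof.
move=> L0 my y0; rewrite (dcube_bigsetU u p L0) ge0_integral_bigsetU//.
- by move=> v; exact: measurable_dcube.
- exact: index_enum_uniq.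
- by move=> v w _ _ [x [vx wx]]; exact: (dcube_child_uniq L0 vx wx).
- by apply/measurable_EFinP; exact: measurable_funTS.
- by move=> x _; rewrite lee_fin.
Qed.

(** Cauchy-Schwarz before a choice of [t], by integrating the pointwise [2 x <= t y + v / t]. *)
Lemma integral_amgm (A : set Rn) (x y v : Rn -> R) (t : R) : 0 < t ->
  measurable A -> measurable_fun setT x -> measurable_fun setT y ->
  measurable_fun setT v ->
  (forall z, 0 <= x z) -> (forall z, 0 <= y z) -> (forall z, 0 <= v z) ->
  {ae mu, forall z, x z ^+ 2 <= y z * v z} ->
  ((2%:E * \int[mu]_(z in A) (x z)%:E) <=
   t%:E * \int[mu]_(z in A) (y z)%:E + (t^-1)%:E * \int[mu]_(z in A) (v z)%:E)%E.
Proof.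
move=> t0 mA mx my mv x0 y0 v0 xyv; have ti : 0 < t^-1 by rewrite invr_gt0.
have mE (f : Rn -> R) : measurable_fun setT f -> measurable_fun A (fun z => (f z)%:E).
  by move=> mf; apply/measurable_EFinP; exact: measurable_funTS.
have f0E (f : Rn -> R) : (forall z, 0 <= f z) -> forall z, A z -> (0 <= (f z)%:E)%E.
  by move=> f0 z _; rewrite lee_fin.
rewrite -!ge0_integralZl_EFin ?(ltW t0) ?(ltW ti)//; try exact: mE; try exact: f0E.
rewrite -ge0_integralD//.
- apply: ae_ge0_le_integral => //.
  + by move=> z _; rewrite -EFinM lee_fin mulr_ge0.
  + by apply: measurable_funeM; exact: mE.
  + by move=> z _; rewrite -!EFinM -EFinD lee_fin addr_ge0// mulr_ge0// ltW.
  + by apply: emeasurable_funD; apply: measurable_funeM; exact: mE.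
  apply: filterS xyv => z xz _; rewrite -!EFinM -EFinD lee_fin.
  rewrite -(@ler_pXn2r _ 2)// ?nnegrE ?addr_ge0 ?mulr_ge0 ?(ltW t0) ?(ltW ti)//.
  have -> : (t * y z + t^-1 * v z) ^+ 2 = (t * y z - t^-1 * v z) ^+ 2 + 4 * (y z * v z).
    by field; rewrite gt_eqF.
  by rewrite exprMn -natrX ler_wpDl ?sqr_ge0// ler_wpM2l.
- by move=> z _; rewrite -EFinM lee_fin mulr_ge0// ltW.
- by apply: measurable_funeM; exact: mE.
- by move=> z _; rewrite -EFinM lee_fin mulr_ge0// ltW.
- by apply: measurable_funeM; exact: mE.
Qed.

(** The hypothesis [x^2 <= y v] a.e. fits the triples used later, [|f|, f^2 W, V] and
    [S W, S^2 W, W] and [1, V, W], without dividing by a weight. *)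
Lemma integral_cauchy_schwarz (A : set Rn) (x y v : Rn -> R) :
  measurable A -> measurable_fun setT x -> measurable_fun setT y ->
  measurable_fun setT v ->
  (forall z, 0 <= x z) -> (forall z, 0 <= y z) -> (forall z, 0 <= v z) ->
  {ae mu, forall z, x z ^+ 2 <= y z * v z} ->
  (\int[mu]_(z in A) (y z)%:E < +oo)%E -> (\int[mu]_(z in A) (v z)%:E < +oo)%E ->
  (\int[mu]_(z in A) (x z)%:E < +oo)%E /\
  fine (\int[mu]_(z in A) (x z)%:E) ^+ 2 <=
    fine (\int[mu]_(z in A) (y z)%:E) * fine (\int[mu]_(z in A) (v z)%:E).
Proof.
move=> mA mx my mv x0 y0 v0 xyv yfin vfin.
have I0 (f : Rn -> R) : (forall z, 0 <= f z) -> (0 <= \int[mu]_(z in A) (f z)%:E)%E.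
  by move=> f0; apply: integral_ge0 => z _; rewrite lee_fin.
have H t : 0 < t -> _ := fun t0 => integral_amgm t0 mA mx my mv x0 y0 v0 xyv.
have yF : (\int[mu]_(z in A) (y z)%:E)%E \is a fin_num by rewrite ge0_fin_numE ?I0.
have vF : (\int[mu]_(z in A) (v z)%:E)%E \is a fin_num by rewrite ge0_fin_numE ?I0.
have xfin : (\int[mu]_(z in A) (x z)%:E < +oo)%E.
  have h : (2%:E * \int[mu]_(z in A) (x z)%:E < +oo)%E.
    apply: (le_lt_trans (H 1 ltr01)); rewrite invr1 !mul1e.
    exact: lte_add_pinfty.
  move: (I0 _ x0) h.
  by case: (\int[mu]_(_ in _) _)%E => [r|//|//]; rewrite ?ltry// mulry gtr0_sg// mul1e.
split=> //; have xF : (\int[mu]_(z in A) (x z)%:E)%E \is a fin_num by rewrite ge0_fin_numE ?I0.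
have x0' := fine_ge0 (I0 _ x0); have y0' := fine_ge0 (I0 _ y0); have v0' := fine_ge0 (I0 _ v0).
move: H; rewrite -(fineK xF) -(fineK yF) -(fineK vF) /=.
move: x0' y0' v0'; move: (fine _) (fine _) (fine _) => c b a a0 b0 c0 H.
have {}H t : 0 < t -> 2 * a <= t * b + t^-1 * c.
  by move=> /H; rewrite -!EFinM -EFinD lee_fin.
move: a0; rewrite le_eqVlt => /predU1P[<-|a0]; first by rewrite expr0n /= mulr_ge0.
(* If the integral [c] of [v] vanishes, [t = a / (b + 1)] yields a contradiction; otherwise
   [t = c / a] gives the claim. *)
move: c0; rewrite le_eqVlt => /predU1P[c0|c0].
  have b1 : 0 < b + 1 by rewrite ltr_wpDl.
  have := H (a / (b + 1)) (divr_gt0 a0 b1); rewrite -c0 mulr0 addr0.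
  rewrite mulrAC ler_pdivlMr// => h; exfalso; have ab : 0 <= a * b by rewrite mulr_ge0// ltW.
  by move: h ab a0; rewrite mulrDr mulr1 -mulrA; clear; move: (a * b) => d *; lra.
have := H (c / a) (divr_gt0 c0 a0).
rewrite invf_div (_ : a / c * c = a); last by field; rewrite gt_eqF.
rewrite -subr_ge0.
have -> : c / a * b + a - 2 * a = (b * c - a ^+ 2) / a by field; rewrite gt_eqF.
by rewrite pmulr_lge0 ?invr_gt0// subr_ge0.
Qed.

Variables (u : 'I_n -> R) (L : R).
Hypothesis L0 : 0 < L.
Variables x y v : Rn -> R.
Hypotheses (mx : measurable_fun setT x) (my : measurable_fun setT y)
  (mv : measurable_fun setT v).
Hypotheses (x0 : forall z, 0 <= x z) (y0 : forall z, 0 <= y z)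
  (v0 : forall z, 0 <= v z).
Hypothesis xyv : {ae mu, forall z, x z ^+ 2 <= y z * v z}.
Hypothesis vpos : {ae mu, forall z, 0 < v z}.
Hypothesis yfin : (\int[mu]_(z in dcube u L [::]) (y z)%:E < +oo)%E.
Hypothesis vfin : (\int[mu]_(z in dcube u L [::]) (v z)%:E < +oo)%E.

Local Notation int f A := (fine (\int[mu]_(z in A) (f z)%:E)).

Let fin_sub (f : Rn -> R) (A : set Rn) : measurable A -> A `<=` dcube u L [::] ->
  measurable_fun setT f -> (forall z, 0 <= f z) ->
  (\int[mu]_(z in dcube u L [::]) (f z)%:E < +oo)%E ->
  (\int[mu]_(z in A) (f z)%:E)%E \is a fin_num.
Proof.
move=> mA Ar mf f0 ffin; rewrite ge0_fin_numE; last first.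
  by apply: integral_ge0 => z _; rewrite lee_fin.
apply: le_lt_trans ffin; apply: ge0_subset_integral => //.
- exact: measurable_dcube.
- by apply/measurable_EFinP; exact: measurable_funTS.
- by move=> z _; rewrite lee_fin.
Qed.


Let cauchy_schwarz p : int x (dcube u L p) ^+ 2 <=
  int y (dcube u L p) * int v (dcube u L p).
Proof.
have mp : measurable (dcube u L p) by exact: measurable_dcube.
have pr := dcube_root L0 (p := p).
have lt (f : Rn -> R) : measurable_fun setT f -> (forall z, 0 <= f z) ->
    (\int[mu]_(z in dcube u L [::]) (f z)%:E < +oo)%E ->
    (\int[mu]_(z in dcube u L p) (f z)%:E < +oo)%E.
  move=> mf f0 ff; have := fin_sub mp (pr u) mf f0 ff.
  by rewrite ge0_fin_numE// integral_ge0// => z _; rewrite lee_fin.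
have [] // := integral_cauchy_schwarz mp mx my mv x0 y0 v0 xyv (lt y my y0 yfin) (lt v mv v0 vfin).
Qed.

Let xfin : (\int[mu]_(z in dcube u L [::]) (x z)%:E < +oo)%E.
Proof.
by have [] := integral_cauchy_schwarz (measurable_dcube u L [::]) mx my mv x0 y0 v0 xyv yfin vfin.
Qed.

(** Writing [x = g v] and [y = g^2 v], the quotients are the means of [g] in the measure [v] and the
    right-hand side is four times its squared norm on the root. Disjoint [E i] inside the cubes give
    the Carleson condition with constant 1. *)
Theorem carleson_embedding (I : choiceType) (s : seq I) (pi : I -> dpath)
    (E : I -> set Rn) :
  uniq s -> (forall i, measurable (E i)) -> trivIset [set` s] E ->
  (forall i, i \in s -> E i `<=` dcube u L (pi i)) ->
  \sum_(i <- s) (int x (dcube u L (pi i)) / int v (dcube u L (pi i))) ^+ 2 *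
     int v (E i) <= 4 * int y (dcube u L [::]).
Proof.
move=> us mE tE Epi.
have mp p : measurable (dcube u L p) by exact: measurable_dcube.
have pr p := dcube_root L0 (u := u) (p := p).
have add (f : Rn -> R) : measurable_fun setT f -> (forall z, 0 <= f z) ->
    (\int[mu]_(z in dcube u L [::]) (f z)%:E < +oo)%E ->
    forall p, int f (dcube u L p) = \sum_v int f (dcube u L (v :: p)).
  move=> mf f0 ffin p; rewrite integral_children// sum_fine// => w _.
  exact: fin_sub.
apply: (@carleson_tree R n I s pi (fun i => int v (E i))
  (fun p => int x (dcube u L p)) (fun p => int y (dcube u L p))
  (fun p => int v (dcube u L p))).
- by move=> i; rewrite fine_ge0// integral_ge0// => z _; rewrite lee_fin.
- move=> p; rewrite -lte_fin fineK; last exact: fin_sub.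
  apply: integral_gt0 => //.
  by rewrite lebesgue_dcube// lte_fin exprn_gt0// dside_gt0.
- exact: add.
- exact: add.
- exact: add.
- exact: cauchy_schwarz.
move=> p; have Er i : i \in s -> E i `<=` dcube u L [::].
  by move=> si; exact: subset_trans (Epi i si) (pr _).
rewrite -lee_fin fineK; last exact: fin_sub.
rewrite -sumEFin (eq_big_seq (fun i => if suffix p (pi i) then
    \int[mu]_(z in E i) (v z)%:E else 0%E)%E); last first.
  move=> i si; case: ifP => _; last by rewrite mul0r.
  by rewrite mul1r fineK//; apply: fin_sub => //; exact: Er.
rewrite -big_mkcond -big_filter -ge0_integral_bigsetU//.
- apply: ge0_subset_integral => //.
  + exact: bigsetU_measurable.
  + by apply/measurable_EFinP; exact: measurable_funTS.
  + by move=> z _; rewrite lee_fin.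
  rewrite -bigcup_seq => z [i /=]; rewrite mem_filter => /andP[pi_ si] iz.
  exact: (dcube_suffix L0 pi_) (Epi i si z iz).
- exact: filter_uniq.
- move=> i j /=; rewrite !mem_filter => /andP[_ si] /andP[_ sj]; exact: tE.
- by apply/measurable_EFinP; exact: measurable_funTS.
- by move=> z _; rewrite lee_fin.
Qed.

End carleson_embedding.

(** * Shifted dyadic grids *)

Section shifted_grids.
Context {R : realType} {n : nat}.
Local Notation Rn := (n.-tuple R).
Local Notation dpath := (@dpath n).

(* The points b + h Z and b + 2^k h / 3 + h Z are h/3-separated, so a point
   cannot lie in the last third of a cell of both grids. *)
Lemma one_third (k : nat) (h b e : R) : 0 < h -> exists t : bool, forall m : nat,
  b + t%:R * (2 ^+ k * h / 3) + m%:R * h <= e ->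
  e < b + t%:R * (2 ^+ k * h / 3) + m%:R * h + h ->
  e < b + t%:R * (2 ^+ k * h / 3) + m%:R * h + 2 * h / 3.
Proof.
move=> h0; apply: contrapT => nex.
have H (t : bool) : exists m : nat, [/\
    b + t%:R * (2 ^+ k * h / 3) + m%:R * h <= e,
    e < b + t%:R * (2 ^+ k * h / 3) + m%:R * h + h &
    b + t%:R * (2 ^+ k * h / 3) + m%:R * h + 2 * h / 3 <= e].
  apply: contrapT => nm; apply: nex; exists t => m h1 h2.
  by rewrite ltNge; apply/negP => h3; apply: nm; exists m.
have [m0 [_ a2 a3]] := H false; have [m1 [_ b2 b3]] := H true.
rewrite /= mul0r addr0 in a2 a3; rewrite /= mul1r in b2 b3.
have e1 : (2 ^ k + 3 * m1)%:R * h < (3 * m0 + 1)%:R * h.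
  rewrite (natrD _ (2 ^ k)%N (3 * m1)%N) (natrD _ (3 * m0)%N 1) !(natrM _ 3) natrX.
  by move: (2 ^+ k) m0%:R m1%:R a2 a3 b2 b3 => x y z *; lra.
have e2 : (3 * m0)%:R * h < (2 ^ k + 3 * m1 + 1)%:R * h.
  rewrite (natrD _ (2 ^ k + 3 * m1)%N 1) (natrD _ (2 ^ k)%N (3 * m1)%N) !(natrM _ 3) natrX.
  by move: (2 ^+ k) m0%:R m1%:R a2 a3 b2 b3 => x y z *; lra.
move: e1 e2; rewrite !ltr_pM2r// !ltr_nat addn1 ltnS addn1 ltnS => e1 e2.
(* The two inequalities between integers force an equality, which is impossible modulo 3 since 3
   does not divide [2^k]. *)
have /eqP : (2 ^ k + 3 * m1 = 3 * m0)%N by apply/eqP; rewrite eqn_leq e1 e2.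
move=> /eqP /(congr1 (modn^~ 3)); rewrite modnMr -modnDmr modnMr addn0 => /eqP.
by rewrite -/(dvdn 3 _) Euclid_dvdX.
Qed.

Lemma dcorner_grid (u : 'I_n -> R) (L : R) (p : dpath) i :
  exists m : nat, dcorner u L p i = u i + m%:R * dside L p.
Proof.
elim: p => [|v p [m IH]] /=; first by exists 0%N; rewrite mul0r addr0.
exists (2 * m + v i)%N; rewrite IH (natrD _ (2 * m)%N (v i)) (natrM _ 2) (dside_cons L v p); ring.
Qed.

Lemma dcorner_in (u : 'I_n -> R) (L : R) (p : dpath) : 0 < L ->
  dcube u L p [tuple dcorner u L p i | i < n].
Proof. by move=> L0 i; rewrite tnth_mktuple lexx ltrDl dside_gt0. Qed.

(** The new root has side [L' = 2^j0 L]. Its corner is moved down by [2 L' / 3] or [L' / 3],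
    coordinate by coordinate: the two choices differ by [L' / 3], the shift in [one_third], and both
    leave room around the old root for the dilates. *)
Definition shift_corner (u : 'I_n -> R) (L : R) (j0 : nat)
    (t : {ffun 'I_n -> bool}) (i : 'I_n) : R :=
  u i - 2 / 3 * (2 ^+ j0 * L) + (t i)%:R * (2 ^+ j0 * L / 3).

(** In each coordinate take the shift for which the lower end of the dilate avoids the last third of
    its cell. The dilate has width [2 bet s], less than a third of the cell by [6 bet < 2^j0], so it
    does not leave the cell. *)
Lemma shifted_grid (u : 'I_n -> R) (L bet : R) (j0 : nat) (p : dpath) :
  0 < L -> 1 <= bet -> 6 * bet < 2 ^+ j0 ->
  exists t (q : dpath), size q = size p /\
    dil bet u L p `<=` dcube (shift_corner u L j0 t) (2 ^+ j0 * L) q.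
Proof.
move=> L0 bet1 jb; set L' := 2 ^+ j0 * L.
have L'0 : 0 < L' by rewrite mulr_gt0// exprn_gt0.
set s := dside L p; have s0 : 0 < s by exact: dside_gt0.
pose h := L' / 2 ^+ size p.
have hE : h = 2 ^+ j0 * s by rewrite /h /L' /s /dside mulrA.
have h0 : 0 < h by rewrite divr_gt0// exprn_gt0.
have L'E : L' = 2 ^+ size p * h by rewrite /h mulrCA divff ?mulr1// expf_neq0.
have bs : 6 * (bet * s) < h by rewrite hE mulrA ltr_pM2r.
pose e i := dcorner u L p i - bet * s.
have sL : s <= L.
  by rewrite /s /dside ler_pdivrMr ?exprn_gt0// ler_peMr ?(ltW L0)// exprn_ege1// ler1n.
have bL : 6 * (bet * L) < L' by rewrite /L' mulrA ltr_pM2r.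
have /choice[t tP] : forall i, exists t : bool, forall m : nat,
    u i - 2 / 3 * L' + t%:R * (2 ^+ size p * h / 3) + m%:R * h <= e i ->
    e i < u i - 2 / 3 * L' + t%:R * (2 ^+ size p * h / 3) + m%:R * h + h ->
    e i < u i - 2 / 3 * L' + t%:R * (2 ^+ size p * h / 3) + m%:R * h + 2 * h / 3.
  by move=> i; exact: one_third.
pose z : Rn := [tuple e i | i < n].
pose tf := [ffun i => t i].
have rz : dcube (shift_corner u L j0 tf) L' [::] z.
  move=> i; rewrite /= /dside expr0 divr1 /shift_corner tnth_mktuple ffunE -/L'.
  have := dcube_root L0 (dcorner_in u p L0) i.
  rewrite tnth_mktuple /= /dside expr0 divr1 /e => /andP[c1 c2].
  have bsL : bet * s <= bet * L by rewrite ler_pM2l// (lt_le_trans ltr01).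
  have bs0 : 0 < bet * s by rewrite mulr_gt0// (lt_le_trans ltr01).
  have LbL : L <= bet * L by rewrite ler_peMl// ltW.
  move: c1 c2 bsL bs0 bL LbL L0; move: (dcorner u L p i) (bet * s) (bet * L) (L') => c x y l *.
  by case: (t i) => /=; apply/andP; split; lra.
have [q [sq qz]] := dcube_depth L'0 (size p) rz.
exists tf, q; split => // y yp i.
have sqE : dside L' q = h by rewrite /dside sq.
have [m cm] := dcorner_grid (shift_corner u L j0 tf) L' q i.
have := qz i; have := yp i; rewrite -/s cm sqE /shift_corner tnth_mktuple ffunE -/L'.
have := tP i m; rewrite -L'E ltr_norml /e.
move: (_ + m%:R * h) (dcorner u L p i) (tnth y i) => x c w H /andP[y1 y2] /andP[z1 z2].
have := H z1 z2; move: bs y1 y2 z1 z2; move: (bet * s) => b *.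
by apply/andP; split; lra.
Qed.

End shifted_grids.

(** * The weighted bound for a finite sparse sum *)

Section weighted.
Context {R : realType} {n : nat}.
Local Notation Rn := (n.-tuple R).
Local Notation mu := (@lebesgue_tuple R n).
Local Notation dpath := (@dpath n).
Local Notation int f A := (fine (\int[mu]_(z in A) (f z)%:E)).
Variables (W V : Rn -> R) (Aw : R).
Hypotheses (mW : measurable_fun setT W) (mV : measurable_fun setT V).
Hypotheses (W0 : forall x, 0 <= W x) (V0 : forall x, 0 <= V x).
Hypotheses (Wpos : {ae mu, forall x, 0 < W x}) (Vpos : {ae mu, forall x, 0 < V x}).
Hypothesis WV : {ae mu, forall x, W x * V x = 1}.
Hypothesis Aw0 : 0 <= Aw.
Hypothesis Wfin : forall u l, 0 < l -> (\int[mu]_(x in hcube u l) (W x)%:E < +oo)%E.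
Hypothesis Vfin : forall u l, 0 < l -> (\int[mu]_(x in hcube u l) (V x)%:E < +oo)%E.
Hypothesis A2 : forall u l, 0 < l ->
  int W (hcube u l) * int V (hcube u l) <= Aw * (l ^+ n) ^+ 2.

Let mE (f : Rn -> R) A : measurable_fun setT f -> measurable_fun A (fun x => (f x)%:E).
Proof. by move=> mf; apply/measurable_EFinP; exact: measurable_funTS. Qed.

Lemma int_ge0 (f : Rn -> R) A : (forall x, 0 <= f x) -> 0 <= int f A.
Proof. by move=> f0; rewrite fine_ge0// integral_ge0// => x _; rewrite lee_fin. Qed.

Lemma int_le (f : Rn -> R) (A B : set Rn) : measurable A -> measurable B ->
  measurable_fun setT f -> (forall x, 0 <= f x) -> A `<=` B ->
  (\int[mu]_(x in B) (f x)%:E < +oo)%E ->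
  (\int[mu]_(x in A) (f x)%:E < +oo)%E /\ int f A <= int f B.
Proof.
move=> mA mB mf f0 AB Bfin.
have h : (\int[mu]_(x in A) (f x)%:E <= \int[mu]_(x in B) (f x)%:E)%E.
  apply: ge0_subset_integral => //; first exact: mE.
  by move=> x _; rewrite lee_fin.
have I0 C : (0 <= \int[mu]_(x in C) (f x)%:E)%E.
  by apply: integral_ge0 => x _; rewrite lee_fin.
have Afin := le_lt_trans h Bfin; split => //.
by rewrite fine_le// ge0_fin_numE.
Qed.

Lemma weighted_fin (g : Rn -> R) (M : R) u l : measurable_fun setT g -> 0 < l ->
  (forall x, `|g x| <= M) -> (forall x, ~ hcube u l x -> g x = 0) ->
  (\int[mu]_x (g x ^+ 2 * W x)%:E < +oo)%E.
Proof.
move=> mg l0 gM gu; have mh : measurable (hcube u l : set Rn) by exact: measurable_hcube.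
have M0 : 0 <= M ^+ 2 by exact: sqr_ge0.
apply: (@le_lt_trans _ _ (\int[mu]_x ((M ^+ 2)%:E * (W x * \1_(hcube u l) x)%:E))%E).
  have mWi : measurable_fun setT (fun x => W x * \1_(hcube u l) x).
    by apply: measurable_funM => //; exact: measurable_indic.
  apply: ge0_le_integral => //.
  - by move=> x _; rewrite lee_fin mulr_ge0// sqr_ge0.
  - by apply: mE; apply: measurable_funM => //; exact: measurable_funX.
  - by apply: measurable_funeM; exact: mE.
  move=> x _; rewrite -EFinM lee_fin.
  have [hx|/gu ->] := pselect (hcube u l x); last first.
    by rewrite expr0n mul0r /= mulr_ge0// mulr_ge0.
  rewrite indicE mem_set// mulr1; apply: ler_wpM2r => //.
  rewrite -real_normK ?num_real// ler_pXn2r ?nnegrE//.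
  exact: le_trans (gM x).
rewrite ge0_integralZl_EFin//.
- rewrite -integral_mul_indic; have := Wfin u l0.
  have : (0 <= \int[mu]_(x in hcube u l) (W x)%:E)%E.
    by apply: integral_ge0 => x _; rewrite lee_fin.
  by case: (\int[mu]_(_ in _) _)%E => [r|//|//] _ _; rewrite -EFinM ltry.
- by move=> x _; rewrite lee_fin mulr_ge0.
- by apply: mE; apply: measurable_funM => //; exact: measurable_indic.
Qed.

Section sparse.
Variables (f : Rn -> R) (u : 'I_n -> R) (L bet : R) (j0 : nat).
Hypothesis bf : bcs f.
Hypothesis L0 : 0 < L.
Hypothesis bet1 : 1 <= bet.
Hypothesis bj : 6 * bet < 2 ^+ j0.
Variables (s : seq dpath) (E : dpath -> set Rn).
Hypothesis us : uniq s.
Hypothesis mEq : forall q, measurable (E q).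
Hypothesis Eq : forall q, E q `<=` dcube u L q.
Hypothesis tE : trivIset [set` s] E.
Hypothesis bigE : forall q, (mu (dcube u L q) <= 2%:E * mu (E q))%E.

Local Notation a := (dil_avg bet u L f).
Let S x := \sum_(q <- s) a q * \1_(dcube u L q) x.
Let mq q : measurable (dcube u L q). Proof. exact: measurable_dcube. Qed.
Let mf : measurable_fun setT f. Proof. by case: bf. Qed.
Let a0 q : 0 <= a q. Proof. exact: dil_avg_ge0. Qed.
Let S0 x : 0 <= S x.
Proof. by apply: sumr_ge0 => q _; rewrite mulr_ge0. Qed.
Let mS : measurable_fun setT S.
Proof.
by apply: measurable_sum => q; exact: measurable_funM.
Qed.
Let n2 : 0 < 2 ^+ j0 * L. Proof. by rewrite mulr_gt0// exprn_gt0. Qed.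

Let f2W := fun x => f x ^+ 2 * W x.
Let S2W := fun x => S x ^+ 2 * W x.
Let SW := fun x => S x * W x.

Let mf2W : measurable_fun setT f2W.
Proof. by apply: measurable_funM => //; exact: measurable_funX. Qed.
Let mS2W : measurable_fun setT S2W.
Proof. by apply: measurable_funM => //; exact: measurable_funX. Qed.
Let mSW : measurable_fun setT SW.
Proof. exact: measurable_funM. Qed.
Let f2W0 x : 0 <= f2W x. Proof. by rewrite mulr_ge0// sqr_ge0. Qed.
Let S2W0 x : 0 <= S2W x. Proof. by rewrite mulr_ge0// sqr_ge0. Qed.
Let SW0 x : 0 <= SW x. Proof. by rewrite mulr_ge0. Qed.

Lemma bcs_weighted_fin : (\int[mu]_x (f2W x)%:E < +oo)%E.
Proof.
have [r r0 fr] := bcs_pos_support bf; have [_ [M fM] _] := bf.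
apply: (@weighted_fin f M (fun=> - r) (2 * r)) => //; first by rewrite mulr_gt0.
move=> x nx; apply: fr => h; apply: nx => i; have := h i.
rewrite subr0 ltr_norml => /andP[h1 h2]; apply/andP; split; first exact: ltW.
by move: h2; lra.
Qed.

Let S2Wfin : (\int[mu]_x (S2W x)%:E < +oo)%E.
Proof.
apply: (@weighted_fin S (\sum_(q <- s) a q) u L) => // x.
  rewrite ger0_norm//; apply: ler_sum => q _.
  by rewrite ler_piMr// indicE; case: (_ \in _).
move=> nx; rewrite /S big1// => q _; rewrite indicE memNset ?mulr0// => qx.
apply: nx => i; have := dcube_root L0 qx i.
by rewrite /= /dside expr0 divr1.
Qed.

Let c1 q := int V (E q).
Let c2 q := int W (E q).

(** Cauchy-Schwarz for [1 = V W] on [E q], together with [|q| <= 2 |E q|]. *)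
Let half_size q : (dside L q ^+ n) ^+ 2 <= 4 * (c1 q * c2 q).
Proof.
have Efin (g : Rn -> R) : measurable_fun setT g -> (forall x, 0 <= g x) ->
    (forall u l, 0 < l -> (\int[mu]_(x in hcube u l) (g x)%:E < +oo)%E) ->
    (\int[mu]_(x in E q) (g x)%:E < +oo)%E.
  move=> mg g0 gfin; have [] // := int_le (mEq q) (mq q) mg g0 (@Eq q).
  by apply: gfin; exact: dside_gt0.
have x1 : {ae mu, forall z : Rn, (1 : R) ^+ 2 <= V z * W z}.
  by apply: filterS WV => z; rewrite expr1n mulrC => ->.
have [_] := integral_cauchy_schwarz (mEq q)
  (@measurable_cst _ _ _ _ setT (1 : R)) mV mW (fun=> ler01) V0 W0 x1
  (Efin V mV V0 Vfin) (Efin W mW W0 Wfin).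
have I1 : (\int[mu]_(z in E q) (1 : R)%:E = mu (E q))%E.
  by rewrite integral_cst// mul1e.
rewrite [X in fine X ^+ 2 <= _](_ : _ = mu (E q)); last exact: I1.
rewrite -/(c1 q) -/(c2 q) => h.
have Ef : mu (E q) \is a fin_num.
  rewrite ge0_fin_numE//; apply: (@le_lt_trans _ _ (mu (dcube u L q))).
    by apply: mu_le => //; exact: Eq.
  by rewrite lebesgue_dcube// ltry.
have := bigE q; rewrite lebesgue_dcube// -(fineK Ef) -EFinM lee_fin => h2.
apply: (@le_trans _ _ ((2 * fine (mu (E q))) ^+ 2)).
  rewrite ler_pXn2r ?nnegrE//; last by rewrite mulr_ge0// fine_ge0.
  by rewrite exprn_ge0// ltW// dside_gt0.
by rewrite exprMn -natrX ler_pM2l.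
Qed.

Variables (tau : dpath -> {ffun 'I_n -> bool}) (pi : dpath -> dpath).
Hypothesis pisz : forall q, size (pi q) = size q.
Hypothesis dilpi : forall q, dil bet u L q `<=`
  dcube (shift_corner u L j0 (tau q)) (2 ^+ j0 * L) (pi q).

Let Q q := dcube (shift_corner u L j0 (tau q)) (2 ^+ j0 * L) (pi q).
Let mQ q : measurable (Q q). Proof. exact: measurable_dcube. Qed.
Let qQ q : dcube u L q `<=` Q q.
Proof.
apply: subset_trans (@dilpi q); apply: subset_trans (@dcube_sball _ _ _ _ _) _.
apply: sball_homo; rewrite ler_peMl// ltW// dside_gt0//.
Qed.
(** The A_2 constant times the squared ratio of the volumes of [Q q] and the cube of [q]. *)
Let B := 2 ^+ j0 ^+ n ^+ 2 * Aw.
(** Mean of [|f| W] over [Q q] in the measure [V dx]; [T q] is the mean of [S] over the cube of [q]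
    in the measure [W dx]. *)
Let P q := int (fun x => `|f x|) (Q q) / int V (Q q).
Let T q := int SW (dcube u L q) / int W (dcube u L q).

Let hpos (g : Rn -> R) u' L' q : 0 < L' -> measurable_fun setT g -> (forall x, 0 <= g x) ->
  {ae mu, forall x, 0 < g x} ->
  (forall u l, 0 < l -> (\int[mu]_(x in hcube u l) (g x)%:E < +oo)%E) ->
  0 < int g (dcube u' L' q).
Proof.
move=> L'0 mg g0 gpos gfin; rewrite -lte_fin fineK; last first.
  rewrite ge0_fin_numE; first by apply: gfin; exact: dside_gt0.
  by apply: integral_ge0 => x _; rewrite lee_fin.
apply: integral_gt0 => //; first exact: measurable_dcube.
by rewrite lebesgue_dcube// lte_fin exprn_gt0// dside_gt0.
Qed.

(** The A_2 condition on [Q q] bounds the term by [B * P q * T q] times the volume of the cube, and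
    [half_size] turns the volume into [2 sqrt(c1 q c2 q)]. The weights [8 B^2] and [1/8] of the
    arithmetic-geometric mean are such that the Carleson constant 4 leaves one half before the
    integral to be absorbed. *)
Let one_term q : a q * int SW (dcube u L q) <=
  8 * B ^+ 2 * (P q ^+ 2 * c1 q) + 8^-1 * (T q ^+ 2 * c2 q).
Proof.
set sn := dside L q ^+ n; have sn0 : 0 < sn by rewrite exprn_gt0// dside_gt0.
have VQ0 : 0 < int V (Q q) by exact: hpos.
have Wq0 : 0 < int W (dcube u L q) by exact: hpos.
have sQ : dside (2 ^+ j0 * L) (pi q) = 2 ^+ j0 * dside L q.
  by rewrite /dside pisz mulrA.
have hA2 : int W (dcube u L q) * int V (Q q) <= B * sn ^+ 2.
  apply: (@le_trans _ _ (int W (Q q) * int V (Q q))).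
    apply: ler_wpM2r; first exact: ltW.
    have [] // := int_le (mq q) (mQ q) mW W0 (@qQ q).
    by apply: Wfin; exact: dside_gt0.
  apply: (le_trans (A2 _ (dside_gt0 n2 (pi q)))).
  by rewrite sQ exprMn exprMn -/sn /B mulrA (mulrC Aw).
have ha : a q * sn <= int (fun x => `|f x|) (Q q).
  have mnf : measurable_fun setT (fun x => `|f x|) by exact: measurableT_comp.
  have nf0 x : 0 <= `|f x| by [].
  have [i i0 iE] := bcs_norm_fin bf.
  have [QF _] : (\int[mu]_(x in Q q) `|f x|%:E < +oo)%E /\
      int (fun x => `|f x|) (Q q) <= int (fun x => `|f x|) setT.
    by apply: int_le => //; rewrite iE ltry.
  have [_] := int_le (measurable_dil bet u L q) (mQ q) mnf nf0 (@dilpi q) QF.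
  by rewrite (@dil_avgE R n bet u L f L0 bf).
have X0 : 0 <= int SW (dcube u L q) by exact: int_ge0.
have P0 : 0 <= P q by rewrite divr_ge0 ?int_ge0// ltW.
have T0 : 0 <= T q by rewrite divr_ge0// ltW.
have B0 : 0 <= B by rewrite mulr_ge0// sqr_ge0.
have h1 : a q * int SW (dcube u L q) <= B * (P q * T q) * sn.
  have -> : int SW (dcube u L q) = T q * int W (dcube u L q).
    by rewrite /T [RHS]divfK// gt_eqF.
  have e1 : a q * sn <= P q * int V (Q q).
    by apply: (le_trans ha); rewrite /P [leRHS]divfK// gt_eqF.
  rewrite -(ler_pM2r sn0).
  apply: (@le_trans _ _ (P q * int V (Q q) * (T q * int W (dcube u L q)))).
    rewrite mulrAC; apply: ler_wpM2r => //; rewrite mulr_ge0// ltW//.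
  have -> : P q * int V (Q q) * (T q * int W (dcube u L q)) =
    (P q * T q) * (int W (dcube u L q) * int V (Q q)) by ring.
  have -> : B * (P q * T q) * sn * sn = (P q * T q) * (B * sn ^+ 2) by ring.
  by apply: ler_wpM2l => //; rewrite mulr_ge0.
apply: (le_trans h1).
have c10 : 0 <= c1 q by exact: int_ge0.
have c20 : 0 <= c2 q by exact: int_ge0.
have := half_size q; rewrite -/sn; move: sn sn0 {h1 ha hA2} P0 T0 c10 c20 B0.
move: (P q) (T q) (c1 q) (c2 q) (B) => x y z w b t t0 x0 y0 z0 w0 b0 tzw.
have r0 : 0 <= 8 * b ^+ 2 * (x ^+ 2 * z) + 8^-1 * (y ^+ 2 * w).
  by rewrite addr_ge0// !mulr_ge0// sqr_ge0.
rewrite -(@ler_pXn2r _ 2)// ?nnegrE//; last by rewrite !mulr_ge0// ltW.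
apply: (@le_trans _ _ ((b * (x * y)) ^+ 2 * (4 * (z * w)))).
  by rewrite exprMn; apply: ler_wpM2l => //; exact: sqr_ge0.
rewrite -subr_ge0.
have -> : (8 * b ^+ 2 * (x ^+ 2 * z) + 8^-1 * (y ^+ 2 * w)) ^+ 2 -
   (b * (x * y)) ^+ 2 * (4 * (z * w)) =
   (8 * b ^+ 2 * (x ^+ 2 * z) - 8^-1 * (y ^+ 2 * w)) ^+ 2 by field.
exact: sqr_ge0.
Qed.

(** The cubes [Q q] are spread over several grids, so the sum is split according to the shift
    [tau q] and the embedding is applied in each grid, with [y = f^2 W] and [v = V]. *)
Let sumP : \sum_(q <- s) P q ^+ 2 * c1 q <=
  #|{: {ffun 'I_n -> bool}}|%:R * (4 * int f2W setT).
Proof.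
rewrite (partition_big tau xpredT)//=.
apply: (@le_trans _ _ (\sum_(t : {ffun 'I_n -> bool}) 4 * int f2W setT)); last first.
  rewrite sumr_const -[leLHS]mulr_natl le_eqVlt; apply/orP; left; apply/eqP.
  by congr (_%:R * _); apply: eq_card.
apply: ler_sum => t _; rewrite -big_filter.
rewrite (eq_big_seq (fun q =>
  (int (fun x => `|f x|) (dcube (shift_corner u L j0 t) (2 ^+ j0 * L) (pi q)) /
   int V (dcube (shift_corner u L j0 t) (2 ^+ j0 * L) (pi q))) ^+ 2 * int V (E q)));
  last first.
  by move=> q; rewrite mem_filter => /andP[/eqP <- _].
have mr : measurable (dcube (shift_corner u L j0 t) (2 ^+ j0 * L) [::]).
  exact: measurable_dcube.
have [rfin rle] := int_le mr measurableT mf2W f2W0 (@subsetT _ _) bcs_weighted_fin.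
apply: (@le_trans _ _ (4 * int f2W (dcube (shift_corner u L j0 t) (2 ^+ j0 * L) [::]))); last first.
  by rewrite ler_pM2l.
apply: carleson_embedding => //.
- exact: measurableT_comp.
- apply: filterS WV => z WVz; rewrite -[leLHS]mulr1 -WVz real_normK ?num_real//.
  by rewrite mulrA.
- by apply: Vfin; exact: dside_gt0.
- exact: filter_uniq.
- by move=> p q /=; rewrite !mem_filter => /andP[_ ps] /andP[_ qs]; exact: tE.
- move=> q; rewrite mem_filter => /andP[/eqP <- _].
  exact: subset_trans (@Eq q) (@qQ q).
Qed.

Let sumT : \sum_(q <- s) T q ^+ 2 * c2 q <= 4 * int S2W setT.
Proof.
have mr : measurable (dcube u L [::]) by exact: measurable_dcube.
have [rfin rle] := int_le mr measurableT mS2W S2W0 (@subsetT _ _) S2Wfin.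
apply: (@le_trans _ _ (4 * int S2W (dcube u L [::]))); last by rewrite ler_pM2l.
apply: (@carleson_embedding R n u L L0 SW S2W W) => //.
- by apply: aeW => z; rewrite /SW /S2W exprMn -mulrA expr2.
- by apply: Wfin; exact: dside_gt0.
Qed.

Let S2WE : int S2W setT = \sum_(q <- s) a q * int SW (dcube u L q).
Proof.
have SWfin q : (\int[mu]_(x in dcube u L q) (SW x)%:E < +oo)%E.
  have [] // := @integral_cauchy_schwarz R n (dcube u L q) SW S2W W => //.
  - by apply: aeW => z; rewrite /SW /S2W exprMn -mulrA expr2.
  - by have [] := int_le (mq q) measurableT mS2W S2W0 (@subsetT _ _) S2Wfin.
  - by apply: Wfin; exact: dside_gt0.
have -> : (\int[mu]_x (S2W x)%:E =
    \sum_(q <- s) (a q)%:E * \int[mu]_(x in dcube u L q) (SW x)%:E)%E.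
  rewrite (eq_integral (fun x => \sum_(q <- s)
    ((a q)%:E * (SW x * \1_(dcube u L q) x)%:E)%E)); last first.
    move=> x _; rewrite sumEFin; congr EFin.
    rewrite /S2W expr2 -mulrA -/(SW x) {1}/S mulr_suml; apply: eq_bigr => q _.
    by rewrite -mulrA (mulrC (SW x)).
  have mi q : measurable_fun setT (fun x => SW x * \1_(dcube u L q) x).
    by apply: measurable_funM => //; exact: measurable_indic.
  rewrite ge0_integral_sum//; first last.
  - by move=> q x _; rewrite -EFinM lee_fin; apply: mulr_ge0 => //; apply: mulr_ge0.
  - by move=> q; apply: measurable_funeM; exact: mE.
  apply: eq_bigr => q _; rewrite ge0_integralZl_EFin//; last 2 first.
  - by move=> x _; rewrite lee_fin mulr_ge0.
  - exact: mE.
  by rewrite -integral_mul_indic.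
rewrite -sum_fine => [|q _].
  by apply: eq_bigr => q _; rewrite fineM// ge0_fin_numE// integral_ge0// => x _; rewrite lee_fin.
rewrite fin_numM// ge0_fin_numE// integral_ge0// => x _; rewrite lee_fin//.
Qed.

(** The sum with [T] contributes at most half of the left-hand side and is absorbed; what remains is
    doubled, whence [64 = 2 * 8 * 4]. *)
Lemma sparse_weighted_grid : int S2W setT <=
  64 * #|{: {ffun 'I_n -> bool}}|%:R * B ^+ 2 * int f2W setT.
Proof.
have h : int S2W setT <= 8 * B ^+ 2 * (\sum_(q <- s) P q ^+ 2 * c1 q) +
    8^-1 * \sum_(q <- s) T q ^+ 2 * c2 q.
  rewrite {1}S2WE !mulr_sumr -big_split /=.
  by apply: ler_sum => q _; exact: one_term.
have hB : 0 <= 8 * B ^+ 2 by rewrite mulr_ge0// sqr_ge0.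
have h1 := ler_wpM2l hB sumP.
have h2 : 8^-1 * (\sum_(q <- s) T q ^+ 2 * c2 q) <= 8^-1 * (4 * int S2W setT).
  by rewrite ler_pM2l ?invr_gt0//; exact: sumT.
move: h h1 h2; move: (\sum_(q <- s) P q ^+ 2 * c1 q) (\sum_(q <- s) T q ^+ 2 * c2 q).
move: (int S2W setT) (int f2W setT) (#|_|%:R) (B ^+ 2) => G Ff c b x y *.
lra.
Qed.

Lemma sparse_weighted :
  (\int[mu]_x ((\sum_(q <- s) a q * \1_(dcube u L q) x) ^+ 2 * W x)%:E <=
   (64 * #|{: {ffun 'I_n -> bool}}|%:R * B ^+ 2)%:E * \int[mu]_x (f x ^+ 2 * W x)%:E)%E.
Proof.
have I0 (g : Rn -> R) : (forall x, 0 <= g x) -> (0 <= \int[mu]_x (g x)%:E)%E.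
  by move=> g0; apply: integral_ge0 => x _; rewrite lee_fin.
have fF : (\int[mu]_x (f2W x)%:E)%E \is a fin_num.
  by rewrite ge0_fin_numE ?I0// bcs_weighted_fin.
have SF : (\int[mu]_x (S2W x)%:E)%E \is a fin_num by rewrite ge0_fin_numE ?I0.
have := sparse_weighted_grid.
by rewrite -lee_fin EFinM (fineK fF) (fineK SF).
Qed.

End sparse.
End weighted.

(** * The weighted bound for real singular integrals *)

Section weighted_bound.
Context {R : realType} {n : nat}.
Hypothesis n_gt0 : (0 < n)%N.
Local Notation Rn := (n.-tuple R).
Local Notation mu := (@lebesgue_tuple R n).
Local Notation dpath := (@dpath n).

(** A weight and its inverse as two functions that are nonnegative everywhere, with the A_2
    condition on half-open cubes in the finite real form that the dyadic arguments use. *)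
Record A2_pair (W V : Rn -> R) (Aw : R) : Prop := A2Pair {
  A2p_mW : measurable_fun setT W;
  A2p_mV : measurable_fun setT V;
  A2p_W0 : forall x, 0 <= W x;
  A2p_V0 : forall x, 0 <= V x;
  A2p_Wpos : {ae mu, forall x, 0 < W x};
  A2p_Vpos : {ae mu, forall x, 0 < V x};
  A2p_WV : {ae mu, forall x, W x * V x = 1};
  A2p_Aw : 0 <= Aw;
  A2p_Wfin : forall u l, 0 < l -> (\int[mu]_(x in hcube u l) (W x)%:E < +oo)%E;
  A2p_Vfin : forall u l, 0 < l -> (\int[mu]_(x in hcube u l) (V x)%:E < +oo)%E;
  A2p_A2 : forall u l, 0 < l ->
    fine (\int[mu]_(x in hcube u l) (W x)%:E) *
    fine (\int[mu]_(x in hcube u l) (V x)%:E) <= Aw * (l ^+ n) ^+ 2 }.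

(** The depth [N] in the sparse bound depends on the point. The limit of the increasing [psi N]
    dominates [phi] almost everywhere, and monotone convergence keeps the bound on the integrals. *)
Lemma integral_le_sup (D : set Rn) (phi : Rn -> R) (psi : nat -> Rn -> R) (b : \bar R) :
  measurable D -> measurable_fun setT phi -> (forall x, 0 <= phi x) ->
  (forall N, measurable_fun setT (psi N)) -> (forall N x, 0 <= psi N x) ->
  (forall x, {homo psi^~ x : N M / (N <= M)%N >-> N <= M}) ->
  {ae mu, forall x, D x -> exists N, phi x <= psi N x} ->
  (forall N, (\int[mu]_(x in D) (psi N x)%:E <= b)%E) ->
  (\int[mu]_(x in D) (phi x)%:E <= b)%E.
Proof.
move=> mD mphi phi0 mpsi psi0 ndpsi H Hb.
have mE (f : Rn -> R) : measurable_fun setT f -> measurable_fun D (fun x => (f x)%:E).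
  by move=> mf; apply/measurable_EFinP; exact: measurable_funTS.
have ndE x : {homo (fun N => (psi N x)%:E) : N M / (N <= M)%N >-> (N <= M)%E}.
  by move=> N M NM; rewrite lee_fin; exact: ndpsi.
have limE x : limn (fun N => (psi N x)%:E) = ereal_sup (range (fun N => (psi N x)%:E)).
  by apply/cvg_lim => //; exact: ereal_nondecreasing_cvgn.
have lim_ge N x : ((psi N x)%:E <= limn (fun N => (psi N x)%:E))%E.
  by rewrite limE; apply: ereal_sup_ubound; exists N.
have mlim : measurable_fun D (fun x => limn (fun N => (psi N x)%:E)).
  have -> : (fun x => limn (fun N => (psi N x)%:E)) =
      (fun x => limn_esup (fun N => (psi N x)%:E)).
    apply/funext => x; apply/esym/is_cvg_limn_esupE.
    exact: ereal_nondecreasing_is_cvgn.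
  apply: measurable_fun_limn_esup => N; exact: mE.
apply: (@le_trans _ _ (\int[mu]_(x in D) limn (fun N => (psi N x)%:E))%E).
  apply: ae_ge0_le_integral => //.
  - by move=> x _; rewrite lee_fin.
  - exact: mE.
  - move=> x _; apply: le_trans (lim_ge 0%N x); by rewrite lee_fin.
  apply: filterS H => x Hx Dx; have [N xN] := Hx Dx.
  by apply: le_trans (lim_ge N x); rewrite lee_fin.
rewrite (monotone_convergence mu mD (g' := fun N x => (psi N x)%:E))//.
- apply: lime_le; last by apply: nearW => N; exact: Hb.
  apply: ereal_nondecreasing_is_cvgn => N M NM.
  apply: ge0_le_integral => //; [|exact: mE|exact: mE|].
    by move=> x _; rewrite lee_fin.
  by move=> x _; exact: ndE.
- by move=> N; exact: mE.
- by move=> N x _; rewrite lee_fin.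
Qed.

Variables (U : (Rn -> R) -> Rn -> R) (k : Rn -> Rn -> R) (C kap del : R).
Hypothesis UT : real_cz U k C kap del.

(** Sparse domination speaks of one root at a time. Roots of half-width [r + m] contain the support
    of [f], so localising to the dilate of the root leaves [f] unchanged, and they exhaust the space
    as [m] grows, with constants independent of [m]. *)
Theorem real_cz_weighted : exists2 K, 0 <= K & forall W V Aw f,
  A2_pair W V Aw -> bcs f ->
  (\int[mu]_x (U f x ^+ 2 * W x)%:E <=
   (K * Aw ^+ 2)%:E * \int[mu]_x (f x ^+ 2 * W x)%:E)%E.
Proof.
have [K0 K00 HK] := sparse_domination n_gt0 UT.
set bet := kap + 1; have bet1 : 1 <= bet.
  by rewrite /bet lerDr; apply: le_trans (cz_kap UT).
have [j0 jb] : exists j0, 6 * bet < 2 ^+ j0 :> R.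
  have [j] := @dside_small R (6 * bet) 1 ltr01.
  by rewrite ltr_pdivrMr ?exprn_gt0// mul1r; exists j.
pose c := 64 * #|{: {ffun 'I_n -> bool}}|%:R * ((2 ^+ j0) ^+ n ^+ 2) ^+ 2 : R.
have c0 : 0 <= c by rewrite !mulr_ge0// sqr_ge0.
exists (K0 ^+ 2 * c); first by rewrite mulr_ge0// sqr_ge0.
move=> W V Aw f HW bf.
have mUf := cz_meas UT bf; have mW := A2p_mW HW; have W0 := A2p_W0 HW.
have [r r0 fr] := bcs_pos_support bf.
pose um (m : nat) : 'I_n -> R := fun=> - (r + m%:R).
pose Lm (m : nat) := 2 * (r + m%:R).
have rm0 (m : nat) : 0 < r + m%:R by rewrite ltr_wpDr.
have Lm0 m : 0 < Lm m by rewrite mulr_gt0.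
pose root m := dcube (um m) (Lm m) [::].
have rootE m x : root m x <-> forall i, - (r + m%:R) <= tnth x i < r + m%:R.
  rewrite /root /dcube /hcube /= /dside expr0 divr1 /um /Lm.
  by split => H i; have := H i; rewrite (_ : - (r + m%:R) + _ = r + m%:R) //; ring.
set bnd := ((K0 ^+ 2 * c * Aw ^+ 2)%:E * _)%E.
have key m : (\int[mu]_(x in root m) (U f x ^+ 2 * W x)%:E <= bnd)%E.
  have [F [E [mE Eq tE bigE dom]]] := HK (um m) (Lm m) f (Lm0 m) bf.
  have /choice[s sP] : forall N, exists s : seq dpath,
      uniq s /\ forall q, (q \in s) <-> F q /\ (size q <= N)%N.
    by move=> N; exact: dpath_enum_set.
  pose S N x := \sum_(q <- s N) dil_avg bet (um m) (Lm m) f q * \1_(dcube (um m) (Lm m) q) x.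
  have term0 q x : 0 <= dil_avg bet (um m) (Lm m) f q * \1_(dcube (um m) (Lm m) q) x.
    by rewrite mulr_ge0// dil_avg_ge0.
  have S0 N x : 0 <= S N x by apply: sumr_ge0 => q _.
  have mS N : measurable_fun setT (S N).
    apply: measurable_sum => q; apply: measurable_funM => //.
    by apply: measurable_indic; exact: measurable_dcube.
  have floc : (fun x => f x * \1_(dil bet (um m) (Lm m) [::]) x) = f.
    apply/funext => x; rewrite indicE; have [|] := boolP (x \in _); first by rewrite mulr1.
    rewrite notin_setE mulr0 => nx; rewrite fr// => xr; apply: nx => i.
    have := xr i; rewrite subr0 /= /um /Lm /dside expr0 divr1 !ltr_norml => /andP[h1 h2].
    have m0 : 0 <= m%:R :> R by [].
    have : 2 * (r + m%:R) <= bet * (2 * (r + m%:R)) by rewrite ler_peMl// ltW// Lm0.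
    by move: h1 h2 m0; move: (bet * _) => b *; apply/andP; split; lra.
  have /choice[tq tqP] : forall q, exists tq : {ffun 'I_n -> bool} * dpath,
      size tq.2 = size q /\ dil bet (um m) (Lm m) q `<=`
        dcube (shift_corner (um m) (Lm m) j0 tq.1) (2 ^+ j0 * Lm m) tq.2.
    by move=> q; have [t [q' h]] := shifted_grid (um m) q (Lm0 m) bet1 jb; exists (t, q').
  have SW N : (\int[mu]_x (S N x ^+ 2 * W x)%:E <=
      (c * Aw ^+ 2)%:E * \int[mu]_x (f x ^+ 2 * W x)%:E)%E.
    have [us sF] := sP N.
    have := @sparse_weighted R n W V Aw mW (A2p_mV HW) W0 (A2p_V0 HW) (A2p_Wpos HW)
      (A2p_Vpos HW) (A2p_WV HW) (A2p_Aw HW) (A2p_Wfin HW) (A2p_Vfin HW) (A2p_A2 HW)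
      f (um m) (Lm m) bet j0 bf (Lm0 m) bet1 (s N) E us mE Eq _ bigE
      (fun q => (tq q).1) (fun q => (tq q).2)
      (fun q => (tqP q).1) (fun q => (tqP q).2).
    rewrite exprMn mulrA; apply.
    by move=> p q /= /sF[Fp _] /sF[Fq _]; exact: tE.
  apply: (@integral_le_sup _ _ (fun N x => K0 ^+ 2 * (S N x ^+ 2 * W x))).
  - exact: measurable_dcube.
  - by apply: measurable_funM => //; exact: measurable_funX.
  - by move=> x; rewrite mulr_ge0// sqr_ge0.
  - move=> N; apply: measurable_funM => //; apply: measurable_funM => //.
    exact: measurable_funX.
  - by move=> N x; rewrite !mulr_ge0// sqr_ge0.
  - move=> x N M NM; apply: ler_wpM2l; first exact: sqr_ge0.
    apply: ler_wpM2r => //; rewrite ler_pXn2r ?nnegrE//.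
    apply: ler_sum_subset => //; [by have [] := sP N|by have [] := sP M|].
    move=> q; have [_ sN] := sP N; have [_ sM] := sP M.
    by move=> /sN[Fq qN]; apply/sM; split => //; exact: leq_trans NM.
  - apply: filterS dom => x Hx rx; have [N HN] := Hx rx; exists N.
    have [us sF] := sP N; have := HN (s N) us sF; rewrite floc => h.
    rewrite mulrA -exprMn; apply: ler_wpM2r => //.
    rewrite -real_normK ?num_real// ler_pXn2r ?nnegrE//.
    exact: mulr_ge0.
  - move=> N; apply: (@le_trans _ _ (\int[mu]_x (K0 ^+ 2 * (S N x ^+ 2 * W x))%:E)%E).
      apply: ge0_subset_integral => //.
      + exact: measurable_dcube.
      + apply/measurable_EFinP; apply: measurable_funM => //; apply: measurable_funM => //.
        exact: measurable_funX.
      + by move=> x _; rewrite lee_fin !mulr_ge0// sqr_ge0.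
    under eq_integral do rewrite EFinM.
    rewrite ge0_integralZl_EFin ?sqr_ge0//.
    + have -> : bnd = ((K0 ^+ 2)%:E *
          ((c * Aw ^+ 2)%:E * \int[mu]_x (f x ^+ 2 * W x)%:E))%E.
        by rewrite /bnd muleA -EFinM (mulrA (K0 ^+ 2) c).
      by apply: lee_wpmul2l => //; rewrite lee_fin sqr_ge0.
    + by move=> x _; rewrite lee_fin mulr_ge0// sqr_ge0.
    + by apply/measurable_EFinP; apply: measurable_funM => //; exact: measurable_funX.
have nd : {homo root : m p / (m <= p)%N >-> (m <= p)%O}.
  move=> m p mp; apply/subsetPset => x /rootE H; apply/rootE => i.
  have : m%:R <= p%:R :> R by rewrite ler_nat.
  by have /andP[h1 h2] := H i; move=> h3; apply/andP; split; lra.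
have cup : \bigcup_m root m = setT.
  apply/seteqP; split => // x _.
  pose M := \sum_i `|tnth x i|.
  exists (Num.truncn M).+1 => //; apply/rootE => i.
  have xM : `|tnth x i| <= M by rewrite /M (bigD1 i)//= lerDl sumr_ge0.
  have := le_lt_trans xM (truncnS_gt M); rewrite ltr_norml => /andP[h1 h2].
  by apply/andP; split; lra.
have := @ge0_nondecreasing_set_cvg_integral _ _ _ root (fun x => (U f x ^+ 2 * W x)%:E) mu nd.
have mI : measurable_fun setT (fun x => (U f x ^+ 2 * W x)%:E).
  by apply/measurable_EFinP; apply: measurable_funM => //; exact: measurable_funX.
rewrite cup => H; apply: (cvge_to_le (H _ _ _)).
- by move=> m; exact: measurable_dcube.
- by move=> m; exact: measurable_funTS.
- by move=> m x _; rewrite lee_fin mulr_ge0// sqr_ge0.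
- by apply: nearW => m; exact: key.
Qed.

End weighted_bound.

(** * Neighbourhoods, compact sets and essential supports *)

Section topology.
Context {R : realType} {n : nat}.
Local Notation Rn := (n.-tuple R).
Local Notation mu := (@lebesgue_tuple R n).
Local Notation dpath := (@dpath n).

Let rowt (x : Rn) : 'rV[R]_n := \row_(i < n) tnth x i.

Lemma nbhs_sball (x : Rn) r : 0 < r -> nbhs x (sball (tnth x) r).
Proof.
move=> r0; have := @initial_continuous _ _ rowt x.
move=> /(_ (ball (rowt x) r) (nbhsx_ballx _ _ r0)) H.
have {}H : nbhs x (rowt @^-1` ball (rowt x) r) by exact: H.
move: H; apply: filterS => y /= [_ H] i.
have := H ord0 i; rewrite !mxE /ball /=.
by rewrite distrC.
Qed.

Lemma nbhs_sub_sball (x : Rn) (U : set Rn) : nbhs x U ->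
  exists2 r, 0 < r & sball (tnth x) r `<=` U.
Proof.
rewrite nbhsE => -[B [[C oC CB] Bx] BU].
have : nbhs (rowt x) C by apply: open_nbhs_nbhs; split=> //; rewrite -CB in Bx.
move=> /nbhs_ballP[r r0 rC]; exists r => // y H; apply: BU; rewrite -CB.
apply: rC; split => // i j; rewrite !mxE /ball /= distrC; exact: H.
Qed.

Lemma compact_sub_sball (A : set Rn) : compact A ->
  exists r, A `<=` sball (fun=> 0) r.
Proof.
move=> cA.
have ct i : continuous (fun x : Rn => tnth x i).
  move=> x; have F : Filter (nbhs x) by exact: (@nbhs_filter Rn x).
  apply/cvgrPdist_lt => e e0.
  have [B [oB Bx] Be] : exists2 B, open_nbhs x B & B `<=` sball (tnth x) e.
    by have := nbhs_sball x e0; rewrite nbhsE.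
  apply: (@filterS _ (nbhs x) (nbhs_filter x) B); last exact: open_nbhs_nbhs.
  move=> y /Be/(_ i).
  by rewrite distrC.
have bA i : exists M, forall x, A x -> `|tnth x i| < M.
  have : compact ((fun x : Rn => tnth x i) @` A).
    by apply: continuous_compact => //; exact: continuous_subspaceT.
  move=> /compact_bounded[M [_ HM]]; exists (M + 2) => x Ax.
  by apply: (le_lt_trans (HM (M + 1) _ _ _)); [lra|exists x|lra].
pose M i := sval (cid (bA i)).
have HM i : forall x, A x -> `|tnth x i| < M i by rewrite /M; case: cid.
exists (\sum_i `|M i|) => x Ax i; rewrite subr0.
apply: (lt_le_trans (HM i _ Ax)); apply: (le_trans (ler_norm _)).
by rewrite (bigD1 i)//= lerDl; exact: sumr_ge0.
Qed.

(* Countably many dyadic cubes generate the topology, so the largest open set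
   on which f vanishes a.e. is a countable union of cubes with this property. *)
Lemma ae_ess_support (f : Rn -> R[i]) :
  {ae mu, forall x, ~ ess_support f x -> f x = 0}.
Proof.
pose B (m : nat) p : set Rn := dcube (fun=> - m%:R : R) (2 * m%:R) p.
have H : (forall q, {ae mu, forall y, {ae mu, forall y, B q.1 q.2 y -> f y = 0} ->
    B q.1 q.2 y -> f y = 0}) -> {ae mu, forall y, forall q : nat * dpath,
    {ae mu, forall y, B q.1 q.2 y -> f y = 0} -> B q.1 q.2 y -> f y = 0}.
  exact: ae_forall_countable.
apply: filterS (H _) => [|[m p] /=]; last first.
  have [h|h] := pselect {ae mu, forall y, B m p y -> f y = 0}.
    by apply: filterS h => y hy _; exact: hy.
  by apply: aeW => y /h.
move=> x Hx /contrapT[W Wx Wf].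
have [r r0 rW] := nbhs_sub_sball Wx.
pose m := (Num.truncn (\sum_i `|tnth x i|)).+1.
have m0 : (0 : R) < 2 * m%:R by rewrite mulr_gt0// ltr0n.
have xB : B m [::] x.
  move=> i; rewrite /dside expr0 divr1 /=.
  have : `|tnth x i| < m%:R.
    apply: le_lt_trans (truncnS_gt _).
    by rewrite (bigD1 i)//= lerDl; exact: sumr_ge0.
  rewrite ltr_norml => /andP[h1 h2]; apply/andP; split; [exact: ltW|lra].
have [k kr] := @dside_small R (2 * m%:R) r r0.
have [p [pk px]] := dcube_depth m0 k xB.
apply: (Hx (m, p)) => //; apply: filterS Wf => y h yB; apply/h/rW => i /=.
apply: lt_trans kr; rewrite -pk.
exact: dcube_dist yB px.
Qed.

End topology.

(** * Real and imaginary parts of the operator *)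

Section real_parts.
Context {R : realType} {n : nat}.
Hypothesis n_gt0 : (0 < n)%N.
Local Notation Rn := (n.-tuple R).
Local Notation mu := (@lebesgue_tuple R n).
Local Notation Cabs := (@ComplexField.Normc.normc R).
Implicit Types (z : R[i]) (f g : Rn -> R) (F G : Rn -> R[i]).

(** The part is chosen by a Boolean so that one proof serves for both. *)
Definition cpart (b : bool) z : R := if b then complex.Re z else complex.Im z.

Definition rc f : Rn -> R[i] := fun x => Complex (f x) 0.

Lemma ae_EFin_integral (D : set Rn) f g : measurable D ->
  measurable_fun setT f -> measurable_fun setT g -> {ae mu, forall x, f x = g x} ->
  (\int[mu]_(x in D) (f x)%:E = \int[mu]_(x in D) (g x)%:E)%E.
Proof.
move=> mD mf mg fg; apply: ae_eq_integral => //.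
- by apply/measurable_EFinP; exact: measurable_funTS.
- by apply/measurable_EFinP; exact: measurable_funTS.
- by apply: filterS fg => x -> _.
Qed.

Lemma normc_ge0 z : 0 <= Cabs z.
Proof. by case: z => a b; exact: sqrtr_ge0. Qed.

Lemma normc_sqr z : Cabs z ^+ 2 = cpart true z ^+ 2 + cpart false z ^+ 2.
Proof. by case: z => a b; rewrite /= sqr_sqrtr// addr_ge0// sqr_ge0. Qed.

Lemma cpartD b z z' : cpart b (z + z') = cpart b z + cpart b z'.
Proof. by case: b z z' => -[? ?] [? ?]. Qed.

Lemma cpartZ b (a : R) z : cpart b (Complex a 0 * z) = a * cpart b z.
Proof. by case: b z => -[x y] /=; rewrite mul0r ?subr0 ?addr0. Qed.

Lemma cpartB b z z' : cpart b (z - z') = cpart b z - cpart b z'.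
Proof. by case: b z z' => -[? ?] [? ?]. Qed.

Lemma cpart_sqr_le b z : cpart b z ^+ 2 <= Cabs z ^+ 2.
Proof. by rewrite normc_sqr; case: b; rewrite ?lerDl ?lerDr sqr_ge0. Qed.

Lemma cpart_le b z : `|cpart b z| <= Cabs z.
Proof.
by rewrite -(ler_pXn2r (ltn0Sn 1)) ?nnegrE ?normc_ge0// real_normK ?num_real// cpart_sqr_le.
Qed.

Lemma measurable_cpart b F : cmeasurable F ->
  measurable_fun setT (fun x => cpart b (F x)).
Proof. by case: b => -[]. Qed.

Lemma measurable_normc_sqr F : cmeasurable F ->
  measurable_fun setT (fun x => Cabs (F x) ^+ 2).
Proof.
move=> mF; under eq_fun do rewrite normc_sqr.
by apply: measurable_funD; apply: measurable_funX; exact: measurable_cpart.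
Qed.

Lemma L2norm_sqr F : (L2norm F `^ 2 = \int[mu]_x (Cabs (F x) ^+ 2)%:E)%E.
Proof.
rewrite /L2norm poweR_Lnorm//; apply: eq_integral => x _.
by rewrite /= ger0_norm ?normc_ge0// powR_mulrn ?normc_ge0.
Qed.

Lemma L2norm_lt_pinfty F : (\int[mu]_x (Cabs (F x) ^+ 2)%:E < +oo)%E ->
  (L2norm F < +oo)%E.
Proof. by rewrite -L2norm_sqr; exact: lty_poweRy. Qed.

Lemma L2_boundedP (T : (Rn -> R[i]) -> Rn -> R[i]) : L2_bounded T ->
  exists2 C : R, 0 <= C & forall F, inL2 F -> cmeasurable (T F) /\
    (\int[mu]_x (Cabs (T F x) ^+ 2)%:E <= C%:E * \int[mu]_x (Cabs (F x) ^+ 2)%:E)%E.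
Proof.
move=> [C HC]; exists (`|C| ^+ 2); first exact: sqr_ge0.
move=> F LF; have [[mTF _] TF] := HC F LF; split=> //.
have C0 : (0 <= (`|C|)%:E)%E by rewrite lee_fin.
have L0 G : (0 <= L2norm G)%E by exact: Lnorm_ge0.
rewrite -!L2norm_sqr.
have -> : ((`|C| ^+ 2)%:E * L2norm F `^ 2 = ((`|C|)%:E * L2norm F) `^ 2)%E.
  rewrite (poweRM 2 C0 (L0 F)). by rewrite poweR_EFin powR_mulrn.
apply: gt0_ler_poweR => //.
- by rewrite in_itv /= L0 leey.
- by rewrite in_itv /= leey andbT mule_ge0.
- by apply: (le_trans TF); apply: lee_wpmul2r => //; rewrite lee_fin ler_norm.
Qed.

Lemma normc_rc f x : Cabs (rc f x) ^+ 2 = f x ^+ 2.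
Proof. by rewrite normc_sqr /= expr0n addr0. Qed.

Lemma rc_inL2 f : bcs f -> inL2 (rc f).
Proof.
move=> bf; have mf : measurable_fun setT f by case: bf.
split; first by split => //; exact: measurable_cst.
apply: L2norm_lt_pinfty; under eq_integral do rewrite normc_rc.
have [i _ iE] := bcs_norm_fin (bcs_sqr bf).
suff -> : (\int[mu]_x (f x ^+ 2)%:E = i%:E)%E by rewrite ltry.
by rewrite -iE; apply: eq_integral => x _; rewrite ger0_norm ?sqr_ge0.
Qed.

Lemma euclid_dist_le (x y : Rn) rho : 0 <= rho ->
  (forall i, `|tnth x i - tnth y i| <= rho) -> euclid_dist x y <= n%:R * rho.
Proof.
move=> rho0 H; have nr : 0 <= n%:R * rho by rewrite mulr_ge0.
rewrite /euclid_dist -(ger0_norm nr) -sqrtr_sqr; apply: ler_wsqrtr.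
apply: (@le_trans _ _ (\sum_(i < n) rho ^+ 2)).
  by apply: ler_sum => i _; rewrite -[leLHS]real_normK ?num_real// ler_pXn2r ?nnegrE.
rewrite sumr_const card_ord -[leLHS]mulr_natl exprMn ler_wpM2r ?sqr_ge0//.
by rewrite expr2 -natrM ler_nat leq_pmull.
Qed.

Lemma euclid_dist_ge (x y : Rn) i : `|tnth x i - tnth y i| <= euclid_dist x y.
Proof.
rewrite -sqrtr_sqr /euclid_dist; apply: ler_wsqrtr.
rewrite (bigD1 i)//= lerDl; apply: sumr_ge0 => j _; exact: sqr_ge0.
Qed.

(** Points at sup-distance [rho] have Euclidean distance at most [n rho], and [4 n rho <= r] makes
    this at most a quarter of [r], itself at most the distance of [x] and [y]; this is within the
    range of the regularity condition, and [kap = 4 n] results. *)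
Lemma kernel_regularity_sball K (c delta : R) : 0 < delta ->
  kernel_regularity K c delta ->
  forall (x x' y : Rn) rho r, 0 < rho ->
    (forall i, `|tnth x i - tnth x' i| <= rho) -> 4 * n%:R * rho <= r ->
    ~ sball (tnth x) r y ->
    Cabs (K x y - K x' y) + Cabs (K y x - K y x') <=
      `|c| * ((4 * n%:R * rho / r) `^ delta / r ^+ n).
Proof.
move=> d0 Kreg x x' y rho r rho0 xx' kr yr.
have n1 : (1 : R) <= n%:R by rewrite ler1n.
have nrho : 0 < n%:R * rho by rewrite mulr_gt0// (lt_le_trans ltr01).
have r0 : 0 < r by apply: lt_le_trans kr; rewrite -mulrA mulr_gt0.
have dxx' := euclid_dist_le (ltW rho0) xx'.
have dxy : r <= euclid_dist x y.
  rewrite leNgt; apply/negP => h; apply: yr => i /=.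
  by rewrite distrC; apply: le_lt_trans h; exact: euclid_dist_ge.
have dx0 : 0 <= euclid_dist x x' by exact: sqrtr_ge0.
have d1 : euclid_dist x x' < euclid_dist x y / 2.
  by move: kr; rewrite -mulrA; move: (n%:R * rho) nrho dxx' => *; lra.
apply: (le_trans (Kreg _ _ _ d1)).
apply: (@le_trans _ _ (`|c| * (euclid_dist x x' `^ delta / euclid_dist x y `^ (n%:R + delta)))).
  by apply: ler_wpM2r; rewrite ?ler_norm// divr_ge0 ?powR_ge0.
apply: ler_wpM2l => //.
have -> : (4 * n%:R * rho / r) `^ delta / r ^+ n =
    (4 * n%:R * rho) `^ delta / r `^ (n%:R + delta).
  rewrite powRD; last by rewrite (gt_eqF r0) implybT.
  rewrite powR_mulrn ?(ltW r0)// powRM ?invr_ge0 ?(ltW r0)//; last first.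
    by rewrite -mulrA mulr_ge0 ?(ltW nrho).
  rewrite invfM -mulrA; congr (_ * _); rewrite mulrC; congr (_ * _).
  by rewrite -powR_inv1 ?(ltW r0)// -powRrM mulN1r powRN.
apply: ler_pM; rewrite ?powR_ge0 ?invr_ge0 ?powR_ge0//.
- apply: ge0_ler_powR; rewrite ?nnegrE ?(ltW d0)//.
    by rewrite -mulrA mulr_ge0 ?(ltW nrho).
  by apply: (le_trans dxx'); rewrite -mulrA; move: (n%:R * rho) nrho => *; lra.
- rewrite lef_pV2 ?posrE ?powR_gt0//; last exact: lt_le_trans dxy.
  apply: ge0_ler_powR; rewrite ?nnegrE ?(ltW r0)//.
    by rewrite addr_ge0 ?(ltW d0).
  exact: ltW (lt_le_trans r0 dxy).
Qed.

(** On real functions the part [b] of [T] has as kernel the part [b] of [K], and linearity is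
    applied with the real scalar [Complex a 0]. The constant [|c| + CL] serves for the kernel as
    well as for the L^2 bound. *)
Lemma real_cz_cpart b (T : (Rn -> R[i]) -> Rn -> R[i]) : calderon_zygmund T ->
  exists k C kap del, real_cz (fun f x => cpart b (T (rc f) x)) k C kap del.
Proof.
move=> [Tlin /L2_boundedP[CL CL0 TL] [K [c [Trep _ [delta [/andP[d0 _] Kreg]]]]]].
exists (fun x y => cpart b (K x y)), (`|c| + CL), (4 * n%:R), delta; split => //.
- by rewrite addr_ge0.
- have n1 : (1 : R) <= n%:R by rewrite ler1n.
  lra.
- by move=> f /rc_inL2 /TL[mTf _]; exact: measurable_cpart.
- move=> a f g bf bg.
  have -> : rc (fun y => a * f y + g y) = fun y => Complex a 0 * rc f y + rc g y.
    apply/funext => y; rewrite /rc; simpc.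
    by rewrite -[RHS]/(Complex _ _); congr Complex; rewrite ?mulr0 ?mul0r ?addr0 ?subr0.
  have := Tlin (Complex a 0) _ _ (rc_inL2 bf) (rc_inL2 bg).
  by apply: filterS => x ->; rewrite cpartD cpartZ.
- move=> f bf; have [mTf Tf] := TL _ (rc_inL2 bf).
  have mf : measurable_fun setT f by case: bf.
  apply: (@le_trans _ _ (\int[mu]_x (Cabs (T (rc f) x) ^+ 2)%:E)%E).
    apply: ge0_le_integral => //.
    + by move=> x _; rewrite lee_fin sqr_ge0.
    + by apply/measurable_EFinP; apply: measurable_funX; exact: measurable_cpart.
    + by apply/measurable_EFinP; exact: measurable_normc_sqr.
    + by move=> x _; rewrite lee_fin cpart_sqr_le.
  apply: (le_trans Tf); under eq_integral do rewrite normc_rc.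
  apply: lee_wpmul2r; last by rewrite lee_fin lerDr.
  by apply: integral_ge0 => x _; rewrite lee_fin sqr_ge0.
- move=> f bf; have := Trep _ (rc_inL2 bf); apply: filterS => x H [r r0 fr].
  have [] := H.
    apply; exists (sball (tnth x) r); first exact: nbhs_sball.
    by apply: aeW => y /fr; rewrite /rc => ->.
  move=> [i1 i2] TE.
  have E y : cpart b (K x y * rc f y) = cpart b (K x y) * f y.
    by rewrite mulrC cpartZ mulrC.
  rewrite TE; split.
    under eq_fun do rewrite /comp -E.
    by case: b {E}.
  rewrite /Rintegral; under eq_integral do rewrite -E.
  by case: b {E}.
- move=> x x' y rho r rho0 xx' kr yr.
  have r0 : 0 <= r by apply: le_trans kr; rewrite !mulr_ge0// ltW.
  have H := kernel_regularity_sball d0 Kreg rho0 xx' kr yr.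
  have {}H : Cabs (K x y - K x' y) + Cabs (K y x - K y x') <=
      (`|c| + CL) * ((4 * n%:R * rho / r) `^ delta / r ^+ n).
    apply: (le_trans H); apply: ler_wpM2r; last by rewrite lerDl.
    by rewrite divr_ge0 ?powR_ge0 ?exprn_ge0.
  rewrite -!cpartB; split; apply: (le_trans (cpart_le _ _)); apply: le_trans H.
    by rewrite lerDl normc_ge0.
  by rewrite lerDr normc_ge0.
Qed.

End real_parts.

(** * From an A_2 weight to a pair of nonnegative functions *)

Section weights.
Context {R : realType} {n : nat}.
Local Notation Rn := (n.-tuple R).
Local Notation mu := (@lebesgue_tuple R n).
Variable w : Rn -> R.
Hypothesis A2w : A2_weight w.

(** A weight is positive only almost everywhere. Absolute values repair the null set, and in [V] the
    power [-1] is a nonnegative measurable form of the inverse. *)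
Let W x := `|w x|.
Let V x := `|w x| `^ (-1).

Let mw : measurable_fun setT w.
Proof. by case: A2w => -[]. Qed.

Let wpos : {ae mu, forall x, 0 < w x}.
Proof. by case: A2w => -[]. Qed.

Let mW : measurable_fun setT W.
Proof. exact: measurableT_comp. Qed.

Let mV : measurable_fun setT V.
Proof. by apply: (measurableT_comp (measurable_powR _)). Qed.

Let WE : {ae mu, forall x, w x = W x}.
Proof. by apply: filterS wpos => x w0; rewrite /W gtr0_norm. Qed.

Let VE : {ae mu, forall x, (w x)^-1 = V x}.
Proof. by apply: filterS wpos => x w0; rewrite /V gtr0_norm// powR_inv1 ?ltW. Qed.

Let Wpos : {ae mu, forall x, 0 < W x}.
Proof. by apply: filterS wpos => x w0; rewrite /W gtr0_norm. Qed.

Let Vpos : {ae mu, forall x, 0 < V x}.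
Proof. by apply: filterS wpos => x w0; rewrite /V powR_gt0// gtr0_norm. Qed.

Let measurable_inv : measurable_fun setT (fun x => (w x)^-1).
Proof.
(* The identity also holds where [w] vanishes, since [0^-1 = 0]. *)
have -> : (fun x => (w x)^-1) = fun x => w x * V x ^+ 2.
  apply/funext => x; rewrite /V powR_inv1//.
  have [->|w0] := eqVneq (w x) 0; first by rewrite invr0 mul0r.
  by rewrite exprVn real_normK ?num_real// expr2 invfM mulrA divff// mul1r.
by apply: measurable_funM => //; exact: measurable_funX.
Qed.

Let cube_A2 (a : Rn) l : 0 < l ->
  [/\ (0 < \int[mu]_(x in cube a l) (W x)%:E)%E,
      (0 < \int[mu]_(x in cube a l) (V x)%:E)%E &
      ((\int[mu]_(x in cube a l) (W x)%:E) * (\int[mu]_(x in cube a l) (V x)%:E) *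
        ((l ^+ n ^+ 2)^-1)%:E <= A2_const w)%E].
Proof.
move=> l0; have mc : measurable (cube a l : set Rn) by exact: measurable_cube.
have ln : 0 < l ^+ n by rewrite exprn_gt0.
have cpos : (0 < mu (cube a l))%E by rewrite lebesgue_cube ?ltW// lte_fin.
split.
- by apply: integral_gt0 => // x; exact: normr_ge0.
- by apply: integral_gt0 => // x; exact: powR_ge0.
- rewrite /A2_const; apply: ereal_sup_ubound; exists a, l; split => //.
  rewrite (ae_EFin_integral mc mw mW WE) (ae_EFin_integral mc measurable_inv mV VE).
  rewrite lebesgue_cube ?ltW// -EFin_expe inver ifF//.
  by rewrite expf_eq0 /= gt_eqF.
Qed.

Lemma A2_const_ge0 : (0 <= A2_const w)%E.
Proof.
have [p1 p2] := cube_A2 [tuple 0 | i < n] ltr01.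
by apply: le_trans; rewrite mule_ge0 ?mule_ge0// ?(ltW p1) ?(ltW p2)// lee_fin invr_ge0 sqr_ge0.
Qed.

Lemma A2_const_fineK : (fine (A2_const w))%:E = A2_const w.
Proof. by rewrite fineK// ge0_fin_numE ?A2_const_ge0//; case: A2w. Qed.

(** The A_2 condition itself makes both integrals finite on cubes: each is positive, so an infinite
    factor would make the product infinite. *)
Lemma A2_weight_pair : A2_pair W V (fine (A2_const w)).
Proof.
have H u l : 0 < l -> [/\ (\int[mu]_(x in hcube u l) (W x)%:E < +oo)%E,
   (\int[mu]_(x in hcube u l) (V x)%:E < +oo)%E &
   fine (\int[mu]_(x in hcube u l) (W x)%:E) *
   fine (\int[mu]_(x in hcube u l) (V x)%:E) <= fine (A2_const w) * (l ^+ n) ^+ 2].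
  move=> l0; have [p1 p2] := cube_A2 [tuple u i | i < n] l0.
  have mc : measurable (cube [tuple u i | i < n] l : set Rn) by exact: measurable_cube.
  have ln : 0 < l ^+ n ^+ 2 by rewrite !exprn_gt0.
  rewrite -A2_const_fineK lee_pdivrMr// -EFinM.
  have sub (f : Rn -> R) : measurable_fun setT f -> (forall x, 0 <= f x) ->
      (\int[mu]_(x in hcube u l) (f x)%:E <=
       \int[mu]_(x in cube [tuple u i | i < n] l) (f x)%:E)%E.
    move=> mf f0; apply: ge0_subset_integral => //.
    + exact: measurable_hcube.
    + by apply/measurable_EFinP; exact: measurable_funTS.
    + by move=> x _; rewrite lee_fin.
    + exact: hcube_sub_cube.
  have V0 x : 0 <= V x by exact: powR_ge0.
  have W0 x : 0 <= W x by exact: normr_ge0.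
  have sW := sub W mW W0; have sV := sub V mV V0.
  have iW : (0 <= \int[mu]_(x in hcube u l) (W x)%:E)%E.
    by apply: integral_ge0 => x _; rewrite lee_fin.
  have iV : (0 <= \int[mu]_(x in hcube u l) (V x)%:E)%E.
    by apply: integral_ge0 => x _; rewrite lee_fin.
  move: sW sV iW iV p1 p2.
  move: (\int[mu]_(x in hcube u l) (W x)%:E)%E (\int[mu]_(x in hcube u l) (V x)%:E)%E.
  move: (\int[mu]_(x in cube _ l) (W x)%:E)%E (\int[mu]_(x in cube _ l) (V x)%:E)%E.
  move=> [b| |] [c| |] [a| |] [d| |] //=; rewrite ?lte_fin ?lee_fin ?ltry//.
  + by move=> ab dc a0 d0 b0 c0 bc; split => //; apply: le_trans bc; exact: ler_pM.
  + by move=> _ _ _ _ b0 _; rewrite gt0_muley.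
  + by move=> _ _ _ _ b0 _; rewrite gt0_muley.
  + by move=> _ _ _ _ _ c0; rewrite gt0_mulye.
  + by move=> _ _ _ _ _ c0; rewrite gt0_mulye.
split => //.
- by move=> x; exact: normr_ge0.
- by move=> x; exact: powR_ge0.
- apply: filterS wpos => x w0.
  by rewrite /W /V gtr0_norm// powR_inv1 ?ltW// divff// gt_eqF.
- by rewrite fine_ge0// A2_const_ge0.
- by move=> u l /(H u)[].
- by move=> u l /(H u)[].
- by move=> u l /(H u)[].
Qed.

End weights.

(** * The operator norm on the weighted space *)

Section weighted_operator.
Context {R : realType} {n : nat}.
Hypothesis n_gt0 : (0 < n)%N.
Local Notation Rn := (n.-tuple R).
Local Notation mu := (@lebesgue_tuple R n).
Local Notation Cabs := (@ComplexField.Normc.normc R).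
Implicit Types (f g : Rn -> R) (F G : Rn -> R[i]) (T : (Rn -> R[i]) -> Rn -> R[i]).

Lemma integral_sqr_ge0 f : (0 <= \int[mu]_x (f x ^+ 2)%:E)%E.
Proof. by apply: integral_ge0 => x _; rewrite lee_fin sqr_ge0. Qed.

Lemma cmeasurable_lin (a : R[i]) F G : cmeasurable F -> cmeasurable G ->
  cmeasurable (fun x => a * F x + G x).
Proof.
case: a => a b [F1 F2] [G1 G2]; split.
  have -> : (fun x => complex.Re ((a +i* b)%C * F x + G x)) =
    fun x => a * complex.Re (F x) - b * complex.Im (F x) + complex.Re (G x).
    by apply/funext => x; case: (F x) (G x) => [? ?] [? ?].
  by apply: measurable_funD => //; apply: measurable_funB; exact: measurable_funM.
have -> : (fun x => complex.Im ((a +i* b)%C * F x + G x)) =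
  fun x => a * complex.Im (F x) + b * complex.Re (F x) + complex.Im (G x).
  by apply/funext => x; case: (F x) (G x) => [? ?] [? ?].
by apply: measurable_funD => //; apply: measurable_funD; exact: measurable_funM.
Qed.

(** Linearity gives [T (G - F) = T G - T F] a.e., and boundedness makes [T (G - F)] vanish a.e.
    because [G - F] has norm zero. *)
Lemma L2_ae_eq T F G : L2_linear T -> L2_bounded T -> inL2 F -> inL2 G ->
  {ae mu, forall x, F x = G x} -> {ae mu, forall x, T F x = T G x}.
Proof.
move=> Tlin /L2_boundedP[C C0 TL] LF LG FG.
pose D x := -1 * F x + G x.
have mD : cmeasurable D by apply: cmeasurable_lin; [case: LF|case: LG].
have D0 : (\int[mu]_x (Cabs (D x) ^+ 2)%:E = 0)%E.
  have -> : (\int[mu]_x (Cabs (D x) ^+ 2)%:E = \int[mu]_x (0 : R)%:E)%E.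
    apply: ae_EFin_integral => //; first exact: measurable_normc_sqr.
    apply: filterS FG => x FGx.
    by rewrite /D FGx mulN1r addNr normc_sqr /= expr0n addr0.
  by rewrite integral0.
have LD : inL2 D by split => //; apply: L2norm_lt_pinfty; rewrite D0.
have [mTD] := TL _ LD; rewrite D0 mule0 => TD0.
have {}TD0 : (\int[mu]_x (Cabs (T D x) ^+ 2)%:E = 0)%E.
  by apply/eqP; rewrite eq_le TD0 /=; exact: integral_sqr_ge0.
have {TD0} : {ae mu, forall x, setT x -> (Cabs (T D x) ^+ 2)%:E = 0%E}.
  apply/ae_eq_integral_abs => //.
    by apply/measurable_EFinP; exact: measurable_normc_sqr.
  by rewrite -[RHS]TD0; apply: eq_integral => x _; rewrite gee0_abs// lee_fin sqr_ge0.
have := Tlin (-1) _ _ LF LG; rewrite -/D.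
apply: filterS2 => x TDx /(_ I)[] /eqP.
rewrite sqrf_eq0 => /eqP /ComplexField.Normc.eq0_normc.
by rewrite TDx mulN1r addrC => /eqP; rewrite subr_eq0 => /eqP.
Qed.

(** The support being essential, [F] may be nonzero on a null set outside of it. Cutting with a ball
    around the support removes this, whence an identity that holds only a.e. *)
Lemma bounded_compactly_supported_bcs F : bounded_compactly_supported F ->
  exists f : bool -> Rn -> R, [/\ forall b, bcs (f b),
    forall x, f true x ^+ 2 + f false x ^+ 2 <= Cabs (F x) ^+ 2 &
    {ae mu, forall x, F x = 'i%C * rc (f false) x + rc (f true) x}].
Proof.
move=> [mF [M FM] /compact_sub_sball[r Fr]].
pose B : set Rn := sball (fun=> 0) r.
have mB : measurable B by exact: measurable_sball.
have out x : ~ B x -> ~ ess_support F x by move=> Bx /Fr.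
exists (fun b x => cpart b (F x) * \1_B x); split.
- move=> b; split.
  + by apply: measurable_funM; [exact: measurable_cpart|exact: measurable_indic].
  + exists M => x; rewrite normrM indicE; case: (x \in B).
      by rewrite normr1 mulr1; apply: le_trans (FM x); exact: cpart_le.
    by rewrite normr0 mulr0; apply: le_trans (FM x); exact: normc_ge0.
  + by exists r => x xr; rewrite indicE memNset ?mulr0.
- move=> x; rewrite normc_sqr indicE; case: (x \in B); rewrite ?mulr1 ?mulr0//.
  by rewrite expr0n addr0 addr_ge0// sqr_ge0.
- apply: filterS (ae_ess_support F) => x Fx.
  have -> : F x = Complex (cpart true (F x) * \1_B x) (cpart false (F x) * \1_B x).
    rewrite indicE; have [_|] := boolP (x \in B); first by rewrite !mulr1; case: (F x).
    by rewrite notin_setE => /out/Fx ->; rewrite !mulr0.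
  rewrite /rc; apply/eqP; rewrite eq_complex /=.
  by rewrite !mul0r !mul1r subrr !add0r !addr0 !eqxx.
Qed.

Lemma real_cz_cpart_weighted b T : calderon_zygmund T -> exists2 K, 0 <= K &
  forall W V Aw f, A2_pair W V Aw -> bcs f ->
  (\int[mu]_x (cpart b (T (rc f) x) ^+ 2 * W x)%:E <=
    (K * Aw ^+ 2)%:E * \int[mu]_x (f x ^+ 2 * W x)%:E)%E.
Proof.
move=> /(real_cz_cpart n_gt0 b)[k [C [kap [del UT]]]].
have [K K0 HK] := real_cz_weighted n_gt0 UT.
by exists K => // W V Aw f AW bf; exact: HK AW bf.
Qed.

(** Four real inequalities, for each part of [T] on each part of [F], are added; the factor 2 comes
    from [(x + y)^2 <= 2 x^2 + 2 y^2]. The conclusion [inL2 F] later gives the measurability of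
    [T F]. *)
Lemma calderon_zygmund_weighted T : calderon_zygmund T -> exists2 K, 0 <= K &
  forall W V Aw F, A2_pair W V Aw -> bounded_compactly_supported F ->
    inL2 F /\ (\int[mu]_x (Cabs (T F x) ^+ 2 * W x)%:E <=
      (K * Aw ^+ 2)%:E * \int[mu]_x (Cabs (F x) ^+ 2 * W x)%:E)%E.
Proof.
move=> cT; have [Tlin Tbd _] := cT; have [C C0 TL] := L2_boundedP Tbd.
have HK b := real_cz_cpart_weighted b cT.
have [K1 K10 H1] := HK true; have [K2 K20 H2] := HK false.
exists (2 * (K1 + K2)); first by rewrite mulr_ge0// addr_ge0.
move=> W V Aw F AW bF; have [mF _ _] := bF.
have [f [bf fF FE]] := bounded_compactly_supported_bcs bF.
have mf b : measurable_fun setT (f b) by case: (bf b).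
pose G x := 'i%C * rc (f false) x + rc (f true) x.
have mG : cmeasurable G.
  by apply: cmeasurable_lin; [case: (rc_inL2 (bf false))|case: (rc_inL2 (bf true))].
have LG : inL2 G.
  split => //; apply: L2norm_lt_pinfty.
  have -> : (\int[mu]_x (Cabs (G x) ^+ 2)%:E =
      \int[mu]_x (f true x ^+ 2)%:E + \int[mu]_x (f false x ^+ 2)%:E)%E.
    rewrite -ge0_integralD//; first last.
    + by apply/measurable_EFinP; exact: measurable_funX.
    + by move=> x _; rewrite lee_fin sqr_ge0.
    + by apply/measurable_EFinP; exact: measurable_funX.
    + by move=> x _; rewrite lee_fin sqr_ge0.
    apply: eq_integral => x _; rewrite -EFinD normc_sqr /G /=.
    by rewrite !mul0r !mul1r subrr !add0r !addr0.
  have fin b : (\int[mu]_x (f b x ^+ 2)%:E < +oo)%E.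
    have -> : (\int[mu]_x (f b x ^+ 2)%:E = L2norm (rc (f b)) `^ 2)%E.
      by rewrite L2norm_sqr; apply: eq_integral => x _; rewrite normc_rc.
    by apply: poweR_lty; case: (rc_inL2 (bf b)).
  exact: lte_add_pinfty.
have LF : inL2 F.
  split => //; apply: L2norm_lt_pinfty.
  have -> : (\int[mu]_x (Cabs (F x) ^+ 2)%:E = \int[mu]_x (Cabs (G x) ^+ 2)%:E)%E.
    apply: ae_EFin_integral => //; try exact: measurable_normc_sqr.
    by apply: filterS FE => x ->.
  by rewrite -L2norm_sqr; apply: poweR_lty; case: LG.
split => //.
have mW := A2p_mW AW; have W0 := A2p_W0 AW.
have [mTF _] := TL _ LF.
have mT b b' : measurable_fun setT (fun x => cpart b (T (rc (f b')) x)).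
  by apply: measurable_cpart; case: (TL _ (rc_inL2 (bf b'))).
pose u b b' x := cpart b (T (rc (f b')) x) ^+ 2 * W x.
have u0 b b' x : (0 <= (u b b' x)%:E)%E by rewrite lee_fin mulr_ge0// sqr_ge0.
have mu' b b' : measurable_fun setT (fun x => (u b b' x)%:E).
  by apply/measurable_EFinP; apply: measurable_funM => //; exact: measurable_funX.
pose J b := (\int[mu]_x (f b x ^+ 2 * W x)%:E)%E.
have J0 b : (0 <= J b)%E.
  by apply: integral_ge0 => x _; rewrite lee_fin mulr_ge0// sqr_ge0.
have JF : (J true + J false <= \int[mu]_x (Cabs (F x) ^+ 2 * W x)%:E)%E.
  have mJ b : measurable_fun setT (fun x => (f b x ^+ 2 * W x)%:E).
    by apply/measurable_EFinP; apply: measurable_funM => //; exact: measurable_funX.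
  have J1 b x : (0 <= (f b x ^+ 2 * W x)%:E)%E by rewrite lee_fin mulr_ge0// sqr_ge0.
  rewrite /J -ge0_integralD//; apply: ge0_le_integral => //.
  - by move=> x _; exact: adde_ge0.
  - exact: emeasurable_funD.
  - apply/measurable_EFinP; apply: measurable_funM => //; exact: measurable_normc_sqr.
  - by move=> x _; rewrite -EFinD lee_fin -mulrDl ler_wpM2r.
have ub b b' : (\int[mu]_x (u b b' x)%:E <= ((if b then K1 else K2) * Aw ^+ 2)%:E * J b')%E.
  by case: b; [exact: H1 AW (bf b')|exact: H2 AW (bf b')].
apply: (@le_trans _ _ (2%:E * ((\int[mu]_x (u true true x)%:E + \int[mu]_x (u true false x)%:E)
    + (\int[mu]_x (u false true x)%:E + \int[mu]_x (u false false x)%:E)))%E).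
  have m2 b : measurable_fun setT (fun x => (u b true x)%:E + (u b false x)%:E)%E.
    exact: emeasurable_funD.
  rewrite -!ge0_integralD//; try by move=> x _; rewrite ?adde_ge0.
  rewrite -ge0_integralZl//; try by move=> x _; rewrite ?adde_ge0// adde_ge0.
  - apply: ae_ge0_le_integral => //.
    + by move=> x _; rewrite lee_fin mulr_ge0// sqr_ge0.
    + by apply/measurable_EFinP; apply: measurable_funM => //; exact: measurable_normc_sqr.
    + by move=> x _; rewrite mule_ge0 ?lee_fin// !addr_ge0// -lee_fin.
    + by apply: measurable_funeM; exact: emeasurable_funD.
    + have TFG := L2_ae_eq Tlin Tbd LF LG FE.
      have := Tlin 'i%C _ _ (rc_inL2 (bf false)) (rc_inL2 (bf true)).
      apply: filterS2 TFG => x -> TGx _.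
      rewrite -!EFinD -EFinM lee_fin /u -!mulrDl mulrA ler_wpM2r//.
      rewrite TGx normc_sqr !cpartD.
      case: (T (rc (f false)) x) (T (rc (f true)) x) => [a b] [c d] /=.
      rewrite !mul0r !mul1r sub0r add0r.
      by have := sqr_ge0 (c + b); have := sqr_ge0 (a - d); rewrite !expr2; lra.
  - exact: emeasurable_funD.
apply: (@le_trans _ _ (2%:E * ((K1 * Aw ^+ 2)%:E * (J true + J false) +
    (K2 * Aw ^+ 2)%:E * (J true + J false)))%E).
  apply: lee_wpmul2l; first by rewrite lee_fin.
  have JD K : (K%:E * (J true + J false) = K%:E * J true + K%:E * J false)%E.
    exact: ge0_muleDr.
  rewrite (JD (K1 * _)) (JD (K2 * _)).
  by apply: leeD; apply: leeD; [exact: (ub true)|exact: (ub true)|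
    exact: (ub false)|exact: (ub false)].
have KA0 K : 0 <= K -> (0 <= (K * Aw ^+ 2)%:E)%E.
  by move=> ?; rewrite lee_fin mulr_ge0// sqr_ge0.
rewrite -(ge0_muleDl _ (KA0 _ K10) (KA0 _ K20)) muleA -EFinD -EFinM.
rewrite -mulrDl mulrA; apply: lee_wpmul2l => //.
by rewrite lee_fin mulr_ge0 ?sqr_ge0// mulr_ge0// addr_ge0.
Qed.

Lemma wL2_opnorm_le T : calderon_zygmund T -> exists c : R,
  forall w, A2_weight w -> (wL2_opnorm T w <= c%:E * A2_const w)%E.
Proof.
move=> cT; have [_ Tbd _] := cT; have [C C0 TL] := L2_boundedP Tbd.
have [K K0 HK] := calderon_zygmund_weighted cT.
(* The integrals are squares of norms, so [K * Aw^2] becomes [sqrt K * Aw], linear in the A_2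
   constant. *)
exists (Num.sqrt K) => w A2w; have AW := A2_weight_pair A2w.
have A0 := A2p_Aw AW; rewrite -(A2_const_fineK A2w) -EFinM.
set Aw := fine _ in AW A0 *.
have mw : measurable_fun setT w by case: A2w => -[].
have wpos : {ae mu, forall x, 0 < w x} by case: A2w => -[].
apply: ereal_inf_lbound; split; first by rewrite lee_fin mulr_ge0// sqrtr_ge0.
move=> F bF; have [LF TF] := HK _ _ _ _ AW bF.
have WE G : cmeasurable G -> (\int[mu]_x (Cabs (G x) ^+ 2 * w x)%:E =
    \int[mu]_x (Cabs (G x) ^+ 2 * `|w x|)%:E)%E.
  move=> /measurable_normc_sqr mG; apply: ae_EFin_integral => //.
  - exact: measurable_funM.
  - by apply: measurable_funM => //; exact: measurableT_comp.
  - by apply: filterS wpos => x w0; rewrite gtr0_norm.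
have I0 G : (0 <= \int[mu]_x (Cabs (G x) ^+ 2 * `|w x|)%:E)%E.
  by apply: integral_ge0 => x _; rewrite lee_fin mulr_ge0// sqr_ge0.
have KA : 0 <= K * Aw ^+ 2 by rewrite mulr_ge0// sqr_ge0.
rewrite /wL2norm !WE; [|by case: LF|by case: (TL _ LF)].
have -> : Num.sqrt K * Aw = (K * Aw ^+ 2) `^ 2^-1.
  by rewrite powR12_sqrt// sqrtrM// sqrtr_sqr ger0_norm.
rewrite -poweR_EFin -poweRM//; apply: gt0_ler_poweR => //.
- by rewrite in_itv /= I0 leey.
- by rewrite in_itv /= leey andbT mule_ge0.
Qed.

End weighted_operator.

Theorem theorem1p1 (R : realType) (n : nat) (hn : (0 < n)%N)
  (T : (n.-tuple R -> R[i]) -> n.-tuple R -> R[i]) (hT : calderon_zygmund T) :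
  exists c : R, forall w : n.-tuple R -> R, A2_weight w ->
    (wL2_opnorm T w <= c%:E * A2_const w)%E.
Proof. exact: wL2_opnorm_le. Qed.
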